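(* Let $\Lambda\subset\mathbb{R}^n$ be a lattice, $n\ge 1$, $T^n:=\mathbb{R}^n/\Lambda$ the associated flat torus, $\alpha,\beta>0$ and $1\le p\le n$. The spectrum of $F_{\alpha\beta,p}^{T^n}$, as a weighted set, is the weighted union over all $l\in\Lambda^*$ of $\lambda_\alpha^l$ taken with multiplicity $\binom{n-1}{p-1}$ and of $\lambda_\beta^l$ taken with multiplicity $\binom{n-1}{p}$; that is, for every $\lambda\in\mathbb{C}$, $$\mathrm{Spec}(F_{\alpha\beta,p}^{T^n})(\lambda)=\binom{n-1}{p-1}\,\#\{l\in\Lambda^*\mid\lambda_\alpha^l=\lambda\}+\binom{n-1}{p}\,\#\{l\in\Lambda^*\mid\lambda_\beta^l=\lambda\}.$$ The associated eigenspaces are, for $k\in\Lambda^*$, $$\mathrm{Eig}(F_{\alpha\beta,p}^{T^n},\lambda_\alpha^k)=\bigoplus_{l\in\Lambda^*:\ |l|=|k|}V_l^p\ \oplus\bigoplus_{l\in\Lambda^*:\ |l|=\sqrt{\alpha/\beta}\,|k|}W_l^p$$ and $$\mathrm{Eig}(F_{\alpha\beta,p}^{T^n},\lambda_\beta^k)=\bigoplus_{l\in\Lambda^*:\ |l|=\sqrt{\beta/\alpha}\,|k|}V_l^p\ \oplus\bigoplus_{l\in\Lambda^*:\ |l|=|k|}W_l^p.$$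
   Context: A lattice $\Lambda\subset\mathbb{R}^n$ is the $\mathbb{Z}$-span of a basis of $\mathbb{R}^n$; its dual lattice is $\Lambda^*=\{l\in(\mathbb{R}^n)^*\mid l(\lambda)\in\mathbb{Z}\ \forall\lambda\in\Lambda\}$. The torus $T^n=\mathbb{R}^n/\Lambda$ carries the metric induced by the standard metric of $\mathbb{R}^n$. $d$ is the exterior derivative, $\delta$ its formal $L^2$-adjoint, and $F_{\alpha\beta,p}^{T^n}:=\alpha d\delta+\beta\delta d$ on smooth $p$-forms. $\mathrm{Eig}(F_{\alpha\beta,p}^{T^n},\lambda)$ is the space of smooth complex-valued $p$-forms $\omega$ with $F_{\alpha\beta,p}^{T^n}\omega=\lambda\omega$, and $\mathrm{Spec}(F_{\alpha\beta,p}^{T^n})(\lambda):=\dim_{\mathbb{C}}\mathrm{Eig}(F_{\alpha\beta,p}^{T^n},\lambda)$ (equal to the real dimension of the space of real-valued eigenforms when $\lambda$ is real). $|\cdot|$ is the norm on $(\mathbb{R}^n)^*$ dual to the Euclidean norm. For $l\in\Lambda^*$: $\chi_l:T^n\to\mathbb{C}$, $\chi_l([x])=e^{2\pi i l(x)}$; $l^\sharp\in\mathbb{R}^n$ is the vector with $\langle l^\sharp,\cdot\rangle=l$; $l$ is also regarded as a parallel $1$-form on $T^n$ and $l^\sharp$ as a parallel vector field. $X\lrcorner\,\omega:=\omega(X,\cdot,\dots,\cdot)$. $\Omega^q_{\mathrm{par}}(T^n,\mathbb{C})$ is the space of parallel complex $q$-forms on $T^n$, i.e. complex constant-coefficient combinations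 of $dx^{i_1}\wedge\dots\wedge dx^{i_q}$. For $\gamma\in\mathbb{R}$ set $\lambda_\gamma^l:=4\pi^2\gamma|l|^2$, and $$V_l^p:=\chi_l\{l\wedge\eta\mid\eta\in\Omega^{p-1}_{\mathrm{par}}(T^n,\mathbb{C})\},\qquad W_l^p:=\chi_l\{\omega\in\Omega^p_{\mathrm{par}}(T^n,\mathbb{C})\mid l^\sharp\lrcorner\,\omega=0\}.$$ *)

(* Defs.v *)
From HB Require Import structures.
From mathcomp Require Import all_boot all_order all_algebra.
From mathcomp Require Import complex.
From mathcomp Require Import all_classical all_reals all_analysis.

Set Implicit Arguments.
Unset Strict Implicit.
Unset Printing Implicit Defensive.

Import Order.TTheory GRing.Theory Num.Theory.
Import numFieldNormedType.Exports.

Local Open Scope classical_set_scope.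
Local Open Scope complex_scope.
Local Open Scope ring_scope.

(* Vectors of R^n are rows 'rV_n and elements of the dual space (R^n)^* are
   columns 'cV_n, paired by l(x) = (x *m l) 0 0; thus l^# is l^T. *)

Section Lattices.
Context {R : realType} {n : nat}.
Implicit Types (B : 'M[R]_n) (x : 'rV[R]_n) (l : 'cV[R]_n).

Definition pairing l x : R := (x *m l) 0 0.

Definition sharp l : 'rV[R]_n := l^T.

(* The Z-span of the rows of B; the lattices are the case B \in unitmx. *)
Definition lattice B : set 'rV[R]_n :=
  [set x | exists z : 'rV[int]_n, x = map_mx intr z *m B].

Definition dual_lattice B : set 'cV[R]_n :=
  [set l | forall x, lattice B x -> pairing l x \is a Num.int].

(* The library norm of 'rV_n is the sup norm, hence this definition. *)
Definition euclid_norm x : R := Num.sqrt (\sum_(i < n) x 0 i ^+ 2).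

Definition dual_norm l : R :=
  sup [set `|pairing l x| | x in [set x | euclid_norm x <= 1]].

Definition lambda (gamma : R) l : R := 4 * pi ^+ 2 * gamma * dual_norm l ^+ 2.

Definition chi l x : R[i] :=
  cos (2 * pi * pairing l x) +i* sin (2 * pi * pairing l x).

End Lattices.

Section Smooth.
Context {R : realType} {n : nat}.

Fixpoint Ck (k : nat) (f : 'rV[R]_n -> R) : Prop :=
  continuous f /\
  if k is k'.+1 then
    forall v, (forall x, derivable f x v) /\ Ck k' (fun x => 'D_v f x)
  else True.

Definition smooth (f : 'rV[R]_n -> R[i]) : Prop :=
  forall k, Ck k (fun x => complex.Re (f x)) /\
            Ck k (fun x => complex.Im (f x)).

Definition cderive (v : 'rV[R]_n) (f : 'rV[R]_n -> R[i]) (x : 'rV[R]_n) : R[i] :=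
  'D_v (fun y => complex.Re (f y)) x +i* 'D_v (fun y => complex.Im (f y)) x.

End Smooth.

(* A p-covector is a function of p vectors, given as the rows of a p x n
   matrix. A form on R^n / Lambda is identified with its pull-back to R^n, a
   Lambda-periodic field of covectors. *)
Notation covector R n p := ('M[R]_(p, n) -> R[i]).
Notation covfield R n p := ('rV[R]_n -> covector R n p).

Section Forms.
Context {R : realType} {n : nat}.

Definition multilinear p (w : covector R n p) : Prop :=
  forall (i : 'I_p) (a : R) (A A1 A2 : 'M[R]_(p, n)),
    row i A = a *: row i A1 + row i A2 ->
    row' i A1 = row' i A -> row' i A2 = row' i A ->
    w A = a%:C * w A1 + w A2.

Definition alternating p (w : covector R n p) : Prop :=
  forall (A : 'M[R]_(p, n)) (i j : 'I_p),
    i != j -> row i A = row j A -> w A = 0.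

Definition alt_covector p (w : covector R n p) : Prop :=
  multilinear w /\ alternating w.

Definition contract p (X : 'rV[R]_n) (w : covector R n p.+1) : covector R n p :=
  fun A => w (col_mx X A).

Definition wedge p (l : 'cV[R]_n) (w : covector R n p) : covector R n p.+1 :=
  fun A => \sum_(i < p.+1)
    (-1) ^+ i * (pairing l (row i A))%:C * w (row' i A).

(* The dx^I with I increasing are orthonormal: each occurs p! times below. *)
Definition inner p (v w : covector R n p) : R[i] :=
  (p`!%:R)^-1 * \sum_(f : {ffun 'I_p -> 'I_n})
    v (rowsub f 1%:M) * (w (rowsub f 1%:M))^*.

Definition Omega (B : 'M[R]_n) p : set (covfield R n p) :=
  [set w | [/\ forall x, alt_covector (w x),
               forall A, smooth (fun x => w x A) &
               forall v x, lattice B v -> w (x + v) = w x]].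

Definition Omega_par p : set (covfield R n p) :=
  [set w | exists2 c : covector R n p, alt_covector c & w = fun=> c].

(* Cartan's formula, on constant vector fields *)
Definition ext_d p (w : covfield R n p) : covfield R n p.+1 :=
  fun x A => \sum_(i < p.+1)
    (-1) ^+ i * cderive (row i A) (fun y => w y (row' i A)) x.

End Forms.

Arguments Omega_par {R n} p.

Section Codifferential.
Context {R : realType}.

Fixpoint cube_integral n : ('rV[R]_n -> R) -> R :=
  if n is m.+1 then fun f =>
    \int[lebesgue_measure]_(t in `[0, 1])
      cube_integral (fun y : 'rV[R]_m => f (row_mx (t%:M : 'rV[R]_1) y))
  else fun f => f 0.

Context {n : nat}.
Implicit Types (B : 'M[R]_n).

(* Riemannian integral over R^n / lattice B of a periodic function, computed
   on the fundamental domain [0, 1]^n *m B *)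
Definition torus_integral B (f : 'rV[R]_n -> R[i]) : R[i] :=
  (`|\det B| * cube_integral (fun t => complex.Re (f (t *m B)))) +i*
  (`|\det B| * cube_integral (fun t => complex.Im (f (t *m B)))).

Definition L2_inner B p (v w : covfield R n p) : R[i] :=
  torus_integral B (fun x => inner (v x) (w x)).

Definition formal_adjoint_at B p (w : covfield R n p.+1) : set (covfield R n p) :=
  [set u | Omega B u /\ forall v, Omega B v ->
     L2_inner B (ext_d v) w = L2_inner B v u].

(* The adjoint is unique on smooth forms; the value 0 when there is none is
   never used on them. *)
Definition codiff B p (w : covfield R n p.+1) : covfield R n p :=
  xget (0 : covfield R n p) (formal_adjoint_at B w).

End Codifferential.

Section LinearAlgebra.

Definition has_dim (K : fieldType) (V : lmodType K) (E : set V) (m : nat) : Prop :=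
  exists b : 'I_m -> V,
    set_bij setT E (fun c : {ffun 'I_m -> K} => \sum_i c i *: b i).

(* The external direct sum of the U i, i \in D *)
Definition ext_dsum (I : choiceType) (V : nmodType) (D : set I) (U : I -> set V) :
    set (I -> V) :=
  [set u | [/\ forall i, D i -> U i (u i), forall i, ~ D i -> u i = 0 &
               finite_set [set i | u i <> 0]]].

Definition is_direct_sum (I : choiceType) (V : nmodType) (E : set V)
    (D : set I) (U : I -> set V) : Prop :=
  set_bij (ext_dsum D U) E (fun u => \sum_(i \in D) u i).

End LinearAlgebra.

Section Spectrum.
Context {R : realType} {n : nat}.
Context (B : 'M[R]_n) (alpha beta : R) (p : nat).
Implicit Types (w : covfield R n p.+1) (l : 'cV[R]_n).

Definition F_op w : covfield R n p.+1 :=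
  alpha%:C *: ext_d (codiff B w) + beta%:C *: codiff B (ext_d w).

Definition Eig (z : R[i]) : set (covfield R n p.+1) :=
  [set w | Omega B w /\ F_op w = z *: w].

(* Spec z m: the multiplicity of z in the spectrum is m, and finite. *)
Definition Spec (z : R[i]) (m : nat) : Prop := has_dim (Eig z) m.

Definition V_space l : set (covfield R n p.+1) :=
  [set (fun x => chi l x *: wedge l (eta x)) | eta in Omega_par p].

Definition W_space l : set (covfield R n p.+1) :=
  [set (fun x => chi l x *: w x) | w in
     [set w | Omega_par p.+1 w /\ forall x, contract (sharp l) (w x) = 0]].

(* Index set and summands of a sum of V_l over |l| = r and W_l over |l| = s *)
Definition VW_index (r s : R) : set ('cV[R]_n + 'cV[R]_n) :=
  [set i | match i with
           | inl l => dual_lattice B l /\ dual_norm l = r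
           | inr l => dual_lattice B l /\ dual_norm l = s
           end].

Definition VW_space (i : 'cV[R]_n + 'cV[R]_n) : set (covfield R n p.+1) :=
  match i with inl l => V_space l | inr l => W_space l end.

End Spectrum.

Arguments Spec {R n} B alpha beta p z m.
Arguments Eig {R n} B alpha beta p z.
Arguments VW_space {R n} p i.

(* Main.v *)
Require Import Defs.
From mathcomp Require Import finmap.
From mathcomp Require Import all_boot all_order all_algebra.
From mathcomp Require Import complex.
From mathcomp Require Import all_classical all_reals all_analysis.
From mathcomp Require Import fingroup perm.
From mathcomp Require Import ring lra zify.

Set Implicit Arguments.
Unset Strict Implicit.
Unset Printing Implicit Defensive.

Import Order.TTheory GRing.Theory Num.Theory.
Import numFieldNormedType.Exports.

Local Open Scope classical_set_scope.
Local Open Scope card_scope.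
Local Open Scope complex_scope.
Local Open Scope ring_scope.

(** The proof is Fourier analysis. Writing a form as a series of plane waves
    chi_l c_l, with l in the dual lattice and c_l an alternating covector,
    turns d into 2 pi i times the exterior product with l, and delta into
    - 2 pi i times the contraction with l^#. Hence F acts on c_l as

      4 pi^2 (alpha l /\ (l^# _| c) + beta l^# _| (l /\ c)).

    By the Cartan identity [contract_wedge], the maps c |-> l /\ (l^# _| c) and
    c |-> l^# _| (l /\ c) add up to |l|^2. They are diagonal: take a basis P of
    R^n whose j-th row is l^# and whose other rows lie in the kernel of l, an
    [adapted] basis, and read an alternating (p+1)-covector on the (p+1)-subsets
    S of the rows of P, the [frame]s. The first map multiplies the value at S by
    |l|^2 if j is in S and by 0 otherwise, the second does the opposite
    ([symbol_frame]). The binom(n-1, p) subsets through j carry V_l, with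
    eigenvalue lambda_alpha^l, and the binom(n-1, p+1) others carry W_l, with
    eigenvalue lambda_beta^l. So an eigenform is a form whose Fourier coefficients vanish at all pairs (l, S)
    with the wrong eigenvalue ([Eig_frame]). Only finitely many pairs have a
    given eigenvalue, because alpha and beta are positive and balls contain
    finitely many points of the dual lattice ([finite_dual_ball]). Counting these
    pairs gives the multiplicities ([Spec_formula]), and sorting them according
    to l and to whether j is in S gives the decompositions ([eig_direct_sum]).
    For l = 0 the space V_0 vanishes and W_0 consists of all parallel forms;
    there every pair (0, S) is assigned to W_0.

    Two facts of analysis support this algebra.

    The operator delta is characterized by the L^2 product on the torus. The
    divergence - sum_j e_j _| D_j w is adjoint to d by integration by parts,
    and the adjoint is unique as the product is definite ([codiffE]). The integral
    is the iterated integral over the unit cube in the coordinates given by a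
    lattice basis. The inductions on dimension use compactness of the cube
    ([tube]) for continuity of the inner integrals and for differentiation under
    the integral sign.

    A continuous periodic function whose Fourier coefficients all vanish is
    zero ([fourier_unique]). If a real such function g were positive at x0, it
    would be orthogonal to all powers of a trigonometric polynomial that exceeds
    1 at x0, exceeds 1 only where g is bounded below by a positive constant, and
    is at least - 1 everywhere. The integrals of g against these powers tend to
    infinity, which is absurd ([fourier_unique_real]). *)

(** * Integration over the unit cube *)

Lemma continuous_lin {R : realType} (T : topologicalType) (a : R) (f g : T -> R) :
  continuous f -> continuous g -> continuous (fun x => a * f x + g x).
Proof.
move=> cf cg x; apply: (@cvgD _ R^o); last exact: cg.
by apply: cvgM; [exact: cvg_cst|exact: cf].
Qed.

Lemma continuous_mul {R : realType} (T : topologicalType) (f g : T -> R) :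
  continuous f -> continuous g -> continuous (fun x => f x * g x).
Proof. by move=> cf cg x; apply: cvgM; [exact: cf|exact: cg]. Qed.

Lemma continuous_sub {R : realType} (T : topologicalType) (f g : T -> R) :
  continuous f -> continuous g -> continuous (fun x => f x - g x).
Proof. by move=> cf cg x; apply: (@cvgB _ R^o); [exact: cf|exact: cg]. Qed.

Section UnitInterval.
Context {R : realType}.
Implicit Types f g : R -> R.
Local Notation mu := (@lebesgue_measure R).
Local Notation J f := (\int[mu]_(t in `[0, 1]) f t).

Lemma integrable_unit f : continuous f ->
  mu.-integrable `[0, 1] (EFin \o f).
Proof.
move=> cf; apply: continuous_compact_integrable; first exact: segment_compact.
exact: continuous_subspaceT.
Qed.

Lemma unit_int_le f g : continuous f -> continuous g ->
  (forall t, t \in `[0, 1] -> f t <= g t) -> J f <= J g.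
Proof.
move=> cf cg fg; apply: le_Rintegral => //; exact: integrable_unit.
Qed.

Lemma unit_int_lin (a : R) f g : continuous f -> continuous g ->
  J (fun t => a * f t + g t) = a * J f + J g.
Proof.
move=> cf cg.
rewrite RintegralD//; last 2 first.
- apply: (@integrable_unit (fun t => a * f t)) => t.
  by apply: cvgM; [exact: cst_continuous|exact: cf].
- exact: integrable_unit.
by rewrite RintegralZl//; exact: integrable_unit.
Qed.

Lemma unit_int_cst (c : R) : J (fun=> c) = c.
Proof.
by rewrite Rintegral_cst//= lebesgue_measure_itv/= lte_fin ltr01 sube0/= mulr1.
Qed.

Lemma unit_int_gt0 f (t0 : R) : continuous f ->
  (forall t, t \in `[0, 1] -> 0 <= f t) -> t0 \in `[0, 1] -> 0 < f t0 -> 0 < J f.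
Proof.
move=> cf f0 t01 ft0.
have [e /= e0 he] : \forall t \near t0, f t0 / 2 < f t.
  by apply: (@cvgr_gt R R^o (nbhs t0) _ f (f t0)) => //; [exact: cf|lra].
move: t01; rewrite in_itv/= => /andP[t00 t01].
(* The interval [a, b] has positive length and stays within the radius e on
   which f exceeds f t0 / 2. *)
pose a := Num.max 0 (t0 - e / 2); pose b := Num.min 1 (t0 + e / 2).
have ab : a < b.
  by rewrite /a /b gt_max !lt_min; apply/andP; split; apply/andP; split; lra.
have a0 : 0 <= a by rewrite le_max lexx.
have b1 : b <= 1 by rewrite ge_min lexx.
have sub : (`[a, b] `<=` `[0, 1])%classic.
  by move=> t /=; rewrite !in_itv/= => /andP[h1 h2]; apply/andP; split; lra.
have iab : mu.-integrable `[a, b] (EFin \o f).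
  by apply: integrableS (integrable_unit cf).
apply: (@lt_le_trans _ _ (\int[mu]_(t in `[a, b]) f t)).
  apply: (@lt_le_trans _ _ (\int[mu]_(t in `[a, b]) (f t0 / 2))).
    rewrite Rintegral_cst//= lebesgue_measure_itv/= lte_fin ab/=.
    by apply: mulr_gt0; lra.
  apply: le_Rintegral => //.
    apply: integrableS (@integrable_unit (fun=> f t0 / 2) _) => //.
    by move=> t; exact: cvg_cst.
  move=> t /=; rewrite in_itv/= /a /b ge_max le_min => /andP[/andP[_ h1] /andP[_ h2]].
  apply/ltW/he => /=; rewrite ltr_norml; apply/andP; split; lra.
rewrite /Rintegral fine_le//.
- by rewrite integrable_fin_num.
- by rewrite integrable_fin_num//; exact: integrable_unit.
apply: ge0_subset_integral => //.
  by have /measurable_int := integrable_unit cf.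
Qed.

Lemma unit_int_derive f df : continuous df ->
  (forall t, is_derive (t : R) 1 f (df t)) -> J df = f 1 - f 0.
Proof.
move=> cdf hf.
have cf : continuous f.
  by move=> t; apply/differentiable_continuous/derivable1_diffP; exact: ex_derive.
rewrite /Rintegral (@continuous_FTC2 _ df f)//.
- exact: continuous_subspaceT.
- split=> [x _||].
  + exact: ex_derive.
  + exact/cvg_at_right_filter/cf.
  + exact/cvg_at_left_filter/cf.
- by move=> x _; rewrite derive1E; exact: derive_val.
Qed.

End UnitInterval.

Section Cube.
Context {R : realType}.

Definition cube m : set 'rV[R]_m := [set y | forall i, y 0 i \in `[0, 1]].

(** The first entry is the variable of the outermost integral in
    [cube_integral]. *)
Definition cons_row m (t : R) (y : 'rV[R]_m) : 'rV[R]_(1 + m) :=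
  row_mx (t%:M : 'rV_1) y.

Lemma cons_row0 m t (y : 'rV[R]_m) : cons_row t y 0 ord0 = t.
Proof.
by rewrite /cons_row mxE; case: splitP => // j; rewrite ord1 mxE eqxx.
Qed.

Lemma cons_row_lift m t (y : 'rV[R]_m) (i : 'I_m) :
  cons_row t y 0 (lift ord0 i) = y 0 i.
Proof.
rewrite /cons_row (_ : lift ord0 i = rshift 1 i); last exact/val_inj.
by rewrite row_mxEr.
Qed.

Lemma cons_row_cube m t (y : 'rV[R]_m) :
  t \in `[0, 1] -> cube y -> cube (cons_row t y).
Proof.
move=> ht hy i; case: (unliftP ord0 i) => [j ->|->].
  by rewrite cons_row_lift; exact: hy.
by rewrite cons_row0.
Qed.

Lemma cons_row_eta m (y : 'rV[R]_m.+1) :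
  y = cons_row (y 0 ord0) (\row_i y 0 (lift ord0 i)).
Proof.
apply/rowP => i; case: (unliftP ord0 i) => [j ->|->].
  by rewrite cons_row_lift mxE.
by rewrite cons_row0.
Qed.

Lemma cube_compact m : compact (@cube m).
Proof.
by apply: (@rV_compact R m (fun=> `[0, 1]%classic)) => _; exact: segment_compact.
Qed.

Lemma continuous_rV (T : topologicalType) m (F : T -> 'rV[R]_m) (x : T) :
  (forall i, {for x, continuous (fun y => F y 0 i)}) -> {for x, continuous F}.
Proof.
move=> h; apply/cvg_ballP => e e0.
have : \forall y \near x, forall i, ball (F x 0 i) e (F y 0 i).
  apply: filter_forall => i.
  by have /cvg_ballP/(_ _ e0) := h i; exact.
apply: filterS => y hy; split => // i j.
by rewrite ord1.
Qed.

Lemma continuous_cons_row (T : topologicalType) m (a : T -> R)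
    (b : T -> 'rV[R]_m) (x : T) :
  {for x, continuous a} -> {for x, continuous b} ->
  {for x, continuous (fun z => cons_row (a z) (b z))}.
Proof.
move=> ca cb; apply: continuous_rV => i; case: (unliftP ord0 i) => [j ->|->].
  rewrite (_ : (fun y => _) = (fun M : 'rV[R]_m => M 0 j) \o b); last first.
    by apply/funext => y /=; rewrite cons_row_lift.
  by apply: continuous_comp => //; exact: coord_continuous.
by rewrite (_ : (fun y => _) = a)//; apply/funext => y /=; rewrite cons_row0.
Qed.

Lemma continuous_slice m (f : 'rV[R]_(1 + m) -> R) t : continuous f ->
  continuous (fun y => f (cons_row t y)).
Proof.
move=> cf y; apply: (@continuous_comp _ _ _ (fun y => cons_row t y) f); last first.
  exact: cf.
by apply: continuous_cons_row; [exact: cst_continuous|exact: cvg_id].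
Qed.

(** The cube is compact, so that continuity at the slice over [t] is uniform
    in the other variables. Continuity and differentiability of iterated
    integrals both rest on this. *)
Lemma tube m (f : 'rV[R]_(1 + m) -> R) (t e : R) : continuous f -> 0 < e ->
  \forall s \near t, forall y, cube y ->
    `|f (cons_row s y) - f (cons_row t y)| <= e.
Proof.
move=> cf e0.
have /compact_near_coveringP/(_ R (nbhs t) (fun s y =>
  `|f (cons_row s y) - f (cons_row t y)| <= e) _) := @cube_compact m.
apply => y _.
pose h (p : 'rV[R]_m * R) : R := f (cons_row p.2 p.1) - f (cons_row t p.1).
have c1 : h @ (y, t) --> h (y, t).
  apply: (@cvgB _ R^o).
    apply: (@continuous_comp _ _ _ (fun p : 'rV[R]_m * R => cons_row p.2 p.1) f).
      apply: continuous_cons_row; [exact: cvg_snd|exact: cvg_fst].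
    exact: cf.
  apply: (@continuous_comp _ _ _ (fun p : 'rV[R]_m * R => cons_row t p.1) f).
    apply: continuous_cons_row; [exact: cst_continuous|exact: cvg_fst].
  exact: cf.
have h0 : h (y, t) = 0 by rewrite /h subrr.
rewrite h0 in c1.
exact: (@cvgr0_norm_le _ R^o _ _ _ h c1 e e0).
Qed.

Local Notation I := (@cube_integral R _).

Lemma cube_integralS m (f : 'rV[R]_m.+1 -> R) :
  I f = \int[lebesgue_measure]_(t in `[0, 1]) I (fun y : 'rV[R]_m => f (cons_row t y)).
Proof. by []. Qed.

(** The properties of integration over [m] variables that make the result
    continuous in one more variable. That continuity is in turn what the next
    integration requires, so both are carried through one induction on the
    dimension. *)
Definition mean_value m (M : ('rV[R]_m -> R) -> R) : Prop :=
  [/\ forall f g : 'rV[R]_m -> R, continuous f -> continuous g ->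
        (forall y, cube y -> f y <= g y) -> M f <= M g,
      forall (a : R) (f g : 'rV[R]_m -> R), continuous f -> continuous g ->
        M (fun y => a * f y + g y) = a * M f + M g &
      forall c : R, M (fun=> c) = c].

Lemma mean_value_dist m M (f g : 'rV[R]_m -> R) (e : R) : mean_value M ->
  continuous f -> continuous g ->
  (forall y, cube y -> `|f y - g y| <= e) -> `|M f - M g| <= e.
Proof.
move=> [le_M lin_M cst_M] cf cg h.
have leD (u v : 'rV[R]_m -> R) : continuous u -> continuous v ->
    (forall y, cube y -> u y - v y <= e) -> M u - M v <= e.
  move=> cu cv huv; rewrite -[leRHS]cst_M lerBlDl -[X in X + _]mul1r.
  have ce : continuous (fun _ : 'rV[R]_m => e) by exact: cst_continuous.
  rewrite -lin_M//; apply: le_M => //; first exact: continuous_lin.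
  by move=> y /huv; rewrite mul1r lerBlDl.
rewrite ler_norml; apply/andP; split.
  rewrite lerNl opprB; apply: leD => // y /h; rewrite ler_norml => /andP[]; lra.
by apply: leD => // y /h; rewrite ler_norml => /andP[]; lra.
Qed.

Lemma mean_value_continuous m M (f : 'rV[R]_m.+1 -> R) : mean_value M ->
  continuous f -> continuous (fun t => M (fun y : 'rV[R]_m => f (cons_row t y))).
Proof.
move=> hM cf t; apply/(@cvgrPdist_le _ R^o) => e e0.
have := tube t cf e0; apply: filterS => s hs.
by rewrite distrC; apply: mean_value_dist => //; exact: continuous_slice.
Qed.

Lemma cube_integral_mean_value m : mean_value (@cube_integral R m).
Proof.
elim: m => [|m hI].
  split=> //= f g _ _; apply; by move=> -[].
have [le_I lin_I cst_I] := hI.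
split.
- move=> f g cf cg fg; rewrite !cube_integralS.
  apply: unit_int_le => [||t ht]; [exact: mean_value_continuous..|].
  apply: le_I; [exact: continuous_slice..|] => y hy.
  exact/fg/cons_row_cube.
- move=> a f g cf cg; rewrite !cube_integralS -unit_int_lin; try exact: mean_value_continuous.
  by apply: eq_Rintegral => t _; rewrite lin_I//; exact: continuous_slice.
- move=> c; rewrite cube_integralS; under eq_Rintegral do rewrite cst_I.
  exact: unit_int_cst.
Qed.

Lemma cube_integral_le m (f g : 'rV[R]_m -> R) : continuous f -> continuous g ->
  (forall y, cube y -> f y <= g y) -> I f <= I g.
Proof. by have [h _ _] := cube_integral_mean_value m; exact: h. Qed.

Lemma cube_integral_lin m (a : R) (f g : 'rV[R]_m -> R) :
  continuous f -> continuous g ->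
  I (fun y => a * f y + g y) = a * I f + I g.
Proof. by have [_ h _] := cube_integral_mean_value m; exact: h. Qed.

Lemma cube_integral_cst m (c : R) : I (fun _ : 'rV[R]_m => c) = c.
Proof. by have [_ _ h] := cube_integral_mean_value m; exact: h. Qed.

Lemma cube_integralZ m (a : R) (f : 'rV[R]_m -> R) : continuous f ->
  I (fun y => a * f y) = a * I f.
Proof.
move=> cf; rewrite -[RHS]addr0 -[X in _ + X](cube_integral_cst m) -cube_integral_lin//.
  by under [in RHS]eq_fun do rewrite addr0.
exact: cst_continuous.
Qed.

Lemma cube_integralB m (f g : 'rV[R]_m -> R) : continuous f -> continuous g ->
  I (fun y => f y - g y) = I f - I g.
Proof.
move=> cf cg; rewrite addrC -mulN1r -cube_integral_lin//.
by under [in RHS]eq_fun do rewrite mulN1r addrC.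
Qed.

Lemma cube_integral_dist m (f g : 'rV[R]_m -> R) (e : R) :
  continuous f -> continuous g ->
  (forall y, cube y -> `|f y - g y| <= e) -> `|I f - I g| <= e.
Proof. exact/mean_value_dist/cube_integral_mean_value. Qed.

Lemma continuous_cube_integral m (f : 'rV[R]_m.+1 -> R) : continuous f ->
  continuous (fun t => I (fun y : 'rV[R]_m => f (cons_row t y))).
Proof. exact/mean_value_continuous/cube_integral_mean_value. Qed.

Lemma cube_integral_gt0 m (f : 'rV[R]_m -> R) y0 : continuous f ->
  (forall y, cube y -> 0 <= f y) -> cube y0 -> 0 < f y0 -> 0 < I f.
Proof.
elim: m f y0 => [|m IH] f y0 cf f0 hy fy0.
  by rewrite /= (_ : 0 = y0)//; apply/rowP => -[].
rewrite cube_integralS.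
have y00 : y0 0 ord0 \in `[0, 1] by exact: hy.
apply: (@unit_int_gt0 _ _ (y0 0 ord0)) => //.
- exact: continuous_cube_integral.
- move=> t ht; rewrite -(cube_integral_cst m 0); apply: cube_integral_le.
  + by exact: cst_continuous.
  + exact: continuous_slice.
  + by move=> y h; apply/f0/cons_row_cube.
- apply: (IH _ (\row_i y0 0 (lift ord0 i))).
  + exact: continuous_slice.
  + by move=> y h; apply/f0/cons_row_cube.
  + by move=> i; rewrite mxE; exact: hy.
  + by rewrite -cons_row_eta.
Qed.

(** A directional derivative only sees the function along a line. This
    transports derivatives to slices, through linear changes of variables and
    along lattice translations without a chain rule. *)
Lemma derive_along (V W : normedModType R) (f : V -> R) (g : W -> R) x v y w :
  (forall h : R, f (h *: v + x) = g (h *: w + y)) ->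
  'D_v f x = 'D_w g y /\ (derivable f x v -> derivable g y w).
Proof.
move=> E; have xy : f x = g y by have := E 0; rewrite !scale0r !add0r.
have EE : (fun h => h^-1 *: ((f \o shift x) (h *: v) - f x)) =
    (fun h => h^-1 *: ((g \o shift y) (h *: w) - g y)).
  by apply/funext => h /=; rewrite E xy.
by rewrite /derive /derivable EE.
Qed.

Lemma derive_cons0 m (f : 'rV[R]_m.+1 -> R) (t : R) (y : 'rV[R]_m) :
  'D_(delta_mx 0 ord0) f (cons_row t y) = 'D_1 (fun s => f (cons_row s y)) t /\
  (derivable f (cons_row t y) (delta_mx 0 ord0) ->
   derivable (fun s => f (cons_row s y)) t 1).
Proof.
apply: (@derive_along _ (GRing.regular R : normedModType R)) => h.
congr f; apply/rowP => i; rewrite mxE [X in X + _]mxE mxE /=.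
by case: (unliftP ord0 i) => [j ->|->]; rewrite ?cons_row_lift ?cons_row0 ?mulr0 ?add0r//= mulr1.
Qed.

Lemma derive_consS m (f : 'rV[R]_m.+1 -> R) (t : R) (y : 'rV[R]_m) (i : 'I_m) :
  'D_(delta_mx 0 (lift ord0 i)) f (cons_row t y) =
    'D_(delta_mx 0 i) (fun z => f (cons_row t z)) y /\
  (derivable f (cons_row t y) (delta_mx 0 (lift ord0 i)) ->
   derivable (fun z => f (cons_row t z)) y (delta_mx 0 i)).
Proof.
apply: derive_along => h.
congr f; apply/rowP => j; rewrite mxE [X in X + _]mxE mxE /=.
case: (unliftP ord0 j) => [k ->|->].
  by rewrite !cons_row_lift !mxE (inj_eq lift_inj).
by rewrite !cons_row0 /= mulr0 add0r.
Qed.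

Lemma MVT_abs (f df : R -> R) (t h : R) : (forall s, is_derive s (1 : R) f (df s)) ->
  exists2 c, `|c - t| <= `|h| & f (h + t) - f t = df c * h.
Proof.
move=> hf.
have cf : continuous f.
  by move=> s; apply/differentiable_continuous/derivable1_diffP; exact: ex_derive.
have [h0|h0] := leP 0 h.
  have [||c] := @MVT_segment R f df t (h + t) _ (fun x _ => hf x).
  - lra.
  - exact: continuous_subspaceT.
  rewrite in_itv/= => /andP[c1 c2] E; exists c; last by rewrite E addrK.
  by rewrite (ger0_norm h0) ger0_norm; lra.
have [||c] := @MVT_segment R f df (h + t) t _ (fun x _ => hf x).
- lra.
- exact: continuous_subspaceT.
rewrite in_itv/= => /andP[c1 c2] E; exists c.
  by rewrite (ltr0_norm h0) ler0_norm; lra.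
by rewrite -opprB E opprD addrCA subrr addr0 mulrN opprK.
Qed.

(** By the mean value theorem, the difference quotient at [y] is a value of
    [df] on a slice near that over [t]; by [tube] its distance to the value
    over [t] is small uniformly in [y]. *)
Lemma is_derive_cube_integral m (f df : 'rV[R]_m.+1 -> R) (t : R) :
  continuous f -> continuous df ->
  (forall s y, is_derive s (1 : R) (fun s => f (cons_row s y)) (df (cons_row s y))) ->
  is_derive t (1 : R) (fun t => I (fun y : 'rV[R]_m => f (cons_row t y)))
    (I (fun y => df (cons_row t y))).
Proof.
move=> cf cdf hf; set G := fun t => _.
suff H : h^-1 *: (G (h *: 1 + t) - G t) @[h --> (0 : R)^'] -->
    (I (fun y => df (cons_row t y)) : R^o).
  by apply: DeriveDef; [apply/cvg_ex; eexists; exact: H|exact: cvg_lim H].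
apply/(@cvgrPdist_le _ R^o) => e e0.
have [d /= d0 hd] := tube t cdf e0.
near=> h.
have h0 : h != 0 by near: h; exact: nbhs_dnbhs_neq.
have hlt : `|h| < d by near: h; apply: dnbhs0_lt.
rewrite distrC [h *: 1]mulr1.
have -> : h^-1 *: (G (h + t) - G t) =
    I (fun y => h^-1 * (f (cons_row (h + t) y) - f (cons_row t y))).
  rewrite cube_integralZ; last first.
    by apply: continuous_sub; exact: continuous_slice.
  by rewrite cube_integralB//; exact: continuous_slice.
apply: cube_integral_dist.
- apply: continuous_mul; first exact: cst_continuous.
  by apply: continuous_sub; exact: continuous_slice.
- exact: continuous_slice.
move=> y hy.
have [c hc ->] := @MVT_abs (fun s => f (cons_row s y)) _ t h (fun s => hf s y).
rewrite mulrCA mulVf// mulr1; apply: hd => //=.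
by rewrite distrC (le_lt_trans hc).
Unshelve. all: by end_near. Qed.

(** For the outermost variable, differentiate under the integral and use the
    fundamental theorem of calculus: the values at the two ends agree. Any
    other variable is a variable of each slice. *)
Lemma cube_integral_derive0 m (f : 'rV[R]_m -> R) (i : 'I_m) :
  continuous f -> (forall x, derivable f x (delta_mx 0 i)) ->
  continuous ('D_(delta_mx 0 i) f) ->
  (forall x, f (x + delta_mx 0 i) = f x) -> I ('D_(delta_mx 0 i) f) = 0.
Proof.
elim: m f i => [f []//|m IH] f i cf df cdf pf.
case: (unliftP ord0 i) => [j ij|i0]; last first.
  rewrite i0 in df cdf pf *.
  have hG t : is_derive t (1 : R) (fun t => I (fun y : 'rV_m => f (cons_row t y)))
      (I (fun y => 'D_(delta_mx 0 ord0) f (cons_row t y))).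
    apply: (@is_derive_cube_integral _ _ ('D_(delta_mx 0 ord0) f)) => // s y.
    by have [-> h] := derive_cons0 f s y; apply/derivableP/h; exact: df.
  rewrite cube_integralS (unit_int_derive (continuous_cube_integral cdf) hG).
  apply/eqP; rewrite subr_eq0; apply/eqP; congr I; apply/funext => y.
  rewrite -[RHS]pf; congr f; apply/rowP => k; rewrite [RHS]mxE [X in _ = _ + X]mxE /=.
  by case: (unliftP ord0 k) => [l ->|->]; rewrite ?cons_row_lift ?cons_row0 ?add0r ?addr0.
rewrite ij in df cdf pf *.
have DE t : (fun y => 'D_(delta_mx 0 (lift ord0 j)) f (cons_row t y)) =
    'D_(delta_mx 0 j) (fun y => f (cons_row t y)).
  by apply/funext => y; have [-> _] := derive_consS f t y j.
have slice0 (t : R) : I (fun y => 'D_(delta_mx 0 (lift ord0 j)) f (cons_row t y)) = 0.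
  rewrite DE; apply: IH.
  - exact: continuous_slice.
  - by move=> y; have [_] := derive_consS f t y j; apply; exact: df.
  - by have := @continuous_slice _ _ t cdf; rewrite DE.
  - move=> y; rewrite -[RHS]pf; congr f; apply/rowP => k; rewrite [RHS]mxE [X in _ = _ + X]mxE/=.
    case: (unliftP ord0 k) => [l ->|->]; rewrite ?cons_row_lift ?cons_row0 ?addr0//.
    by rewrite !mxE (inj_eq lift_inj).
rewrite cube_integralS; under eq_Rintegral do rewrite slice0.
exact: unit_int_cst.
Qed.

End Cube.

(** * Smooth functions and characters *)

Section RealSmooth.
Context {R : realType} {n : nat}.
Implicit Types (f g : 'rV[R]_n -> R) (u v x : 'rV[R]_n).

Lemma is_derive_line f v x (s : R) : (forall y, derivable f y v) ->
  is_derive s (1 : R) (fun s => f (s *: v + x)) ('D_v f (s *: v + x)).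
Proof.
move=> df.
have E (h : R) : f (h *: v + (s *: v + x)) = f ((h *: (1 : R^o) + s) *: v + x).
  by rewrite [h *: 1]mulr1 scalerDl addrA.
have [-> h] := @derive_along R _ R^o f (fun s : R => f (s *: v + x)) _ _ _ _ E.
by apply/derivableP/h; exact: df.
Qed.

(** The definition of C^1 speaks of each direction separately, so additivity
    in the direction has to come from continuity: the increment along [a *: u
    + v] is one along [a *: u] followed by one along [v], and the mean value
    theorem evaluates both at points that tend to [x]. *)
Lemma derive_linear_dir f (a : R) u v x :
  (forall w y, derivable f y w) -> (forall w, continuous ('D_w f)) ->
  'D_(a *: u + v) f x = a * 'D_u f x + 'D_v f x.
Proof.
move=> df cdf; apply: cvg_lim => //.
apply/(@cvgrPdist_le _ R^o) => e e0.
have near_D w (e' : R) : 0 < e' ->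
    exists2 d, 0 < d & forall y, `|y| < d -> `|'D_w f (y + x) - 'D_w f x| <= e'.
  move=> e'0; have /(@cvgrPdist_le _ R^o)/(_ _ e'0)/nbhs_ballP[d /= d0 hd] := cdf w x.
  exists d => // y yd; rewrite distrC; apply: hd; rewrite -ball_normE /=.
  by rewrite opprD addrCA subrr addr0 normrN.
pose A := `|a| + 1; have A0 : 0 < A by rewrite /A; have := normr_ge0 a; lra.
have [d1 d10 h1] := near_D u (e / 2 / A) ltac:(by rewrite !divr_gt0).
have [d2 d20 h2] := near_D v (e / 2) ltac:(by rewrite divr_gt0).
(* Both intermediate points lie within |h| K of x. *)
pose K := `|a *: u| + `|v| + 1.
have K0 : 0 < K by rewrite /K; have := normr_ge0 v; have := normr_ge0 (a *: u); lra.
near=> h.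
have h0 : h != 0 by near: h; exact: nbhs_dnbhs_neq.
have hd1 : `|h| < d1 / K by near: h; apply: dnbhs0_lt; exact: divr_gt0.
have hd2 : `|h| < d2 / K by near: h; apply: dnbhs0_lt; exact: divr_gt0.
rewrite ltr_pdivlMr// in hd1; rewrite ltr_pdivlMr// in hd2.
have [c1 hc1 E1] := @MVT_abs R (fun s => f (s *: u + x)) _ 0 (h * a)
  (fun s => is_derive_line x s (fun y => df u y)).
have [c2 hc2 E2] := @MVT_abs R (fun s => f (s *: v + (h *: (a *: u) + x))) _ 0 h
  (fun s => is_derive_line _ s (fun y => df v y)).
rewrite !subr0 in hc1 hc2; rewrite !addr0 scale0r add0r in E1 E2.
have -> : h^-1 *: ((f \o shift x) (h *: (a *: u + v)) - f x) =
    a * 'D_u f (c1 *: u + x) + 'D_v f (c2 *: v + h *: (a *: u) + x).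
  rewrite /= [LHS](_ : _ = h^-1 * ((f (h *: (a *: u + v) + x) - f (h *: (a *: u) + x)) +
    (f ((h * a) *: u + x) - f x))); last first.
    by rewrite scalerA [LHS]/GRing.scale/= ; congr (_ * _); rewrite addrA subrK.
  rewrite scale0r add0r in E2.
  rewrite E1 (_ : h *: (a *: u + v) + x = h *: v + (h *: (a *: u) + x)); last first.
    by rewrite scalerDr addrA [_ + h *: v]addrC.
  by rewrite E2 addrA; field.
rewrite opprD addrACA -mulrBr (splitr e).
have hu : `|c1 *: u| < d1.
  rewrite normrZ (le_lt_trans (ler_wpM2r (normr_ge0 u) hc1))// normrM -mulrA -normrZ.
  apply: le_lt_trans hd1; apply: ler_wpM2l => //; rewrite /K; have := normr_ge0 v; lra.
have hv : `|c2 *: v + h *: (a *: u)| < d2.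
  apply: le_lt_trans hd2; apply: (le_trans (ler_normD _ _)); rewrite [in X in X + _]normrZ.
  rewrite [in X in _ + X]normrZ (le_trans (lerD (ler_wpM2r (normr_ge0 v) hc2) (lexx _)))//.
  by rewrite -mulrDr ler_wpM2l// /K; lra.
apply: (le_trans (ler_normD _ _)); apply: lerD.
  rewrite normrM distrC; apply: (@le_trans _ _ (`|a| * (e / 2 / A))).
    by apply: ler_wpM2l => //; exact: h1.
  rewrite mulrCA -[leRHS]mulr1 ler_wpM2l//; first by rewrite ltW// divr_gt0.
  by rewrite ler_pdivrMr// mul1r /A; lra.
by rewrite distrC; exact: h2.
Unshelve. all: by end_near. Qed.

Lemma derive_addE f g v x : derivable f x v -> derivable g x v ->
  'D_v (fun y => f y + g y) x = 'D_v f x + 'D_v g x.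
Proof. exact: deriveD. Qed.

Lemma derive_subE f g v x : derivable f x v -> derivable g x v ->
  'D_v (fun y => f y - g y) x = 'D_v f x - 'D_v g x.
Proof. exact: deriveB. Qed.

Lemma derive_oppE f v x : derivable f x v -> 'D_v (fun y => - f y) x = - 'D_v f x.
Proof. exact: deriveN. Qed.

Lemma derive_mulE f g v x : derivable f x v -> derivable g x v ->
  'D_v (fun y => f y * g y) x = f x * 'D_v g x + g x * 'D_v f x.
Proof. exact: deriveM. Qed.

Lemma derivable_mul f g v x : derivable f x v -> derivable g x v ->
  derivable (fun y => f y * g y) x v.
Proof. exact: derivableM. Qed.

Lemma CkW k f : Ck k.+1 f -> Ck k f.
Proof.
elim: k f => [|k IH] f [cf df]; split=> // v.
by have [dv Dv] := df v; split=> //; exact: IH.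
Qed.

Lemma Ck_cst k (c : R) : Ck k (fun _ : 'rV[R]_n => c).
Proof.
elim: k c => [|k IH] c; split; try exact: cst_continuous.
  by [].
move=> v; split; first by move=> x; exact: derivable_cst.
rewrite (_ : 'D_v _ = (fun=> 0)); first exact: IH.
by apply/funext => x; rewrite derive_cst.
Qed.

Lemma Ck_lin k (a : R) f g : Ck k f -> Ck k g -> Ck k (fun x => a * f x + g x).
Proof.
elim: k f g => [|k IH] f g [cf df] [cg dg]; split; try exact: continuous_lin.
  by [].
move=> v; have [dfv Dfv] := df v; have [dgv Dgv] := dg v.
have daf x : derivable (fun x => a * f x) x v by exact: (@derivableZ _ _ R^o f a).
split; first by move=> x; apply: (@derivableD _ _ R^o (fun x => a * f x)).
rewrite (_ : (fun x => _) = (fun x => a * 'D_v f x + 'D_v g x)); first exact: IH.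
apply/funext => x; rewrite (@deriveD _ _ R^o (fun x => a * f x) g)//.
by rewrite (@deriveZ _ _ R^o f a).
Qed.

Lemma CkM k f g : Ck k f -> Ck k g -> Ck k (fun x => f x * g x).
Proof.
elim: k f g => [|k IH] f g hf hg.
  by split => //; have [cf _] := hf; have [cg _] := hg; exact: continuous_mul.
have [cf df] := hf; have [cg dg] := hg; split; first exact: continuous_mul.
move=> v; have [dfv Dfv] := df v; have [dgv Dgv] := dg v.
split; first by move=> x; exact: derivableM.
rewrite (_ : (fun x => _) = (fun x => 1 * (f x * 'D_v g x) + g x * 'D_v f x)).
  by apply: Ck_lin; apply: IH => //; exact: CkW.
by apply/funext => x; rewrite deriveM// mul1r.
Qed.

Lemma pairingD (l : 'cV[R]_n) x y : pairing l (x + y) = pairing l x + pairing l y.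
Proof. by rewrite /pairing mulmxDl mxE. Qed.

Lemma pairingZ (l : 'cV[R]_n) a x : pairing l (a *: x) = a * pairing l x.
Proof. by rewrite /pairing -scalemxAl mxE. Qed.

Lemma pairing_addl (l k : 'cV[R]_n) x : pairing (l + k) x = pairing l x + pairing k x.
Proof. by rewrite /pairing mulmxDr mxE. Qed.

Lemma pairing_oppl (l : 'cV[R]_n) x : pairing (- l) x = - pairing l x.
Proof. by rewrite /pairing mulmxN mxE. Qed.

Lemma continuous_sum (T : topologicalType) (I : Type) (r : seq I) (F : I -> T -> R) :
  (forall i, continuous (F i)) -> continuous (fun t : T => \sum_(i <- r) F i t).
Proof.
move=> cF; elim: r => [|i r IH].
  by under eq_fun do rewrite big_nil; exact: cst_continuous.
under eq_fun do rewrite big_cons -[F i _]mul1r.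
exact: continuous_lin.
Qed.

Lemma continuous_mulmx m (B : 'M[R]_(n, m)) : continuous (fun x : 'rV[R]_n => x *m B).
Proof.
move=> x; apply: continuous_rV => j; move: x.
rewrite (_ : (fun y => _) = (fun y : 'rV_n => \sum_i y 0 i * B i j)); last first.
  by apply/funext => y; rewrite mxE.
apply: continuous_sum => i; apply: continuous_mul; last exact: cst_continuous.
exact: coord_continuous.
Qed.

Lemma continuous_comp_mulmx m (B : 'M[R]_(n, m)) (h : 'rV[R]_m -> R) :
  continuous h -> continuous (fun x : 'rV[R]_n => h (x *m B)).
Proof.
move=> ch x; apply: (@continuous_comp _ _ _ (fun x : 'rV[R]_n => x *m B) h).
  exact: continuous_mulmx.
exact: ch.
Qed.

Lemma continuous_pairing (l : 'cV[R]_n) : continuous (pairing l).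
Proof.
move=> x; apply: (@continuous_comp _ _ _ (fun x => x *m l) (fun M : 'rV[R]_1 => M 0 0)).
  exact: continuous_mulmx.
exact: coord_continuous.
Qed.

(** For F = cos and F = sin these are the two coordinates of [chi l]. *)
Lemma is_derive_wave (F dF : R -> R) (l : 'cV[R]_n) v x :
  (forall t, is_derive t (1 : R) F (dF t)) ->
  is_derive x v (fun y => F (2 * pi * pairing l y))
    (2 * pi * pairing l v * dF (2 * pi * pairing l x)).
Proof.
move=> hF; pose b := 2 * pi * pairing l v; pose c := 2 * pi * pairing l x.
have H (h : R) : F (b * (h *: (1 : R^o) + 0) + c) = F (2 * pi * pairing l (h *: v + x)).
  by rewrite /= pairingD pairingZ; congr F; rewrite /b /c addr0 [h *: 1]mulr1; ring.
have [E h] := @derive_along R R^o _ (fun s : R => F (b * s + c))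
  (fun y => F (2 * pi * pairing l y)) _ _ _ _ H.
have dl : is_derive (0 : R) (1 : R) (fun s : R => b * s + c) b.
  pose x0 : R^o := 0; pose x1 : R^o := 1.
  have := @is_deriveD R R^o R^o (fun s => b *: s) (cst c) x0 x1 _ _
    (@is_deriveZ R R^o R^o id b x0 x1 x1 (is_derive_id x0 x1)) (is_derive_cst c x0 x1).
  by rewrite addr0 [_ *: _]mulr1.
have d0 := @is_derive1_comp R F (fun s : R => b * s + c) 0 _ _ (hF _) dl.
apply: DeriveDef; first by apply: h; exact: ex_derive.
by rewrite -E (@derive_val _ _ _ _ _ _ _ d0) /= mulr0 add0r mulrC.
Qed.

(** Proved together, as each of the two functions is a multiple of the
    derivative of the other. *)
Lemma Ck_wave k (l : 'cV[R]_n) :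
  Ck k (fun x => cos (2 * pi * pairing l x)) /\
  Ck k (fun x => sin (2 * pi * pairing l x)).
Proof.
have cF (F : R -> R) : continuous F -> continuous (fun x => F (2 * pi * pairing l x)).
  move=> cF x; apply: (@continuous_comp _ _ _ (fun x => 2 * pi * pairing l x) F).
    move: x; apply: continuous_mul; [exact: cst_continuous|exact: continuous_pairing].
  exact: cF.
elim: k => [|k [IHc IHs]].
  by split; split => //; apply: cF; [exact: continuous_cos|exact: continuous_sin].
split; split; try by apply: cF; [exact: continuous_cos|exact: continuous_sin].
- by apply: cF; exact: continuous_cos.
- move=> v; have h x := is_derive_wave l v x (@is_derive_cos R).
  split; first by move=> x; exact: ex_derive.
  rewrite (_ : (fun x => _) = (fun x => (- (2 * pi * pairing l v)) *
     sin (2 * pi * pairing l x) + 0)); first by apply: Ck_lin; [|exact: Ck_cst].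
  by apply/funext => x; rewrite derive_val; ring.
- by apply: cF; exact: continuous_sin.
- move=> v; have h x := is_derive_wave l v x (@is_derive_sin R).
  split; first by move=> x; exact: ex_derive.
  rewrite (_ : (fun x => _) = (fun x => (2 * pi * pairing l v) *
     cos (2 * pi * pairing l x) + 0)); first by apply: Ck_lin; [|exact: Ck_cst].
  by apply/funext => x; rewrite derive_val addr0.
Qed.

End RealSmooth.

Lemma Re_mul {R : realType} (a b : R[i]) :
  complex.Re (a * b) = complex.Re a * complex.Re b - complex.Im a * complex.Im b.
Proof. by case: a b => [a1 a2] [b1 b2]. Qed.

Lemma Im_mul {R : realType} (a b : R[i]) :
  complex.Im (a * b) = complex.Re a * complex.Im b + complex.Im a * complex.Re b.
Proof. by case: a b => [a1 a2] [b1 b2]. Qed.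

Lemma Re_cconj {R : realType} (a : R[i]) : complex.Re a^* = complex.Re a.
Proof. by case: a. Qed.

Lemma Im_cconj {R : realType} (a : R[i]) : complex.Im a^* = - complex.Im a.
Proof. by case: a. Qed.

Lemma cconjM {R : realType} (a b : R[i]) : (a * b)^* = a^* * b^*.
Proof. exact: rmorphM. Qed.

Lemma eq_complexP {R : realType} (a b : R[i]) :
  complex.Re a = complex.Re b -> complex.Im a = complex.Im b -> a = b.
Proof. by case: a b => [a1 a2] [b1 b2] /= -> ->. Qed.

Section ComplexSmooth.
Context {R : realType} {n : nat}.
Implicit Types (f g : 'rV[R]_n -> R[i]) (u v x : 'rV[R]_n).

Definition ccont f := continuous (fun x => complex.Re (f x)) /\
  continuous (fun x => complex.Im (f x)).

Lemma smooth_ccont f : smooth f -> ccont f.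
Proof. by move=> /(_ 0%N)[[cr _] [ci _]]. Qed.

Lemma ccont_cst (c : R[i]) : ccont (fun=> c).
Proof. by split; exact: cst_continuous. Qed.

Lemma ccont_lin (a : R[i]) f g : ccont f -> ccont g -> ccont (fun x => a * f x + g x).
Proof.
move=> [fr fi] [gr gi]; split.
  under eq_fun do rewrite [complex.Re _]raddfD/= Re_mul -addrA -mulNr.
  by do 2 apply: continuous_lin => //.
under eq_fun do rewrite [complex.Im _]raddfD/= Im_mul -addrA.
by do 2 apply: continuous_lin => //.
Qed.

Lemma ccontM f g : ccont f -> ccont g -> ccont (fun x => f x * g x).
Proof.
move=> [fr fi] [gr gi]; split.
  under eq_fun do rewrite Re_mul.
  by apply: continuous_sub; apply: continuous_mul.
under eq_fun do rewrite Im_mul -[X in X + _]mul1r.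
by apply: continuous_lin; apply: continuous_mul.
Qed.

Lemma ccontJ f : ccont f -> ccont (fun x => (f x)^*).
Proof.
move=> [fr fi]; split.
  by under eq_fun do rewrite Re_cconj.
under eq_fun do rewrite Im_cconj -sub0r.
by apply: continuous_sub => //; exact: cst_continuous.
Qed.

Lemma ccont_sum (I : Type) (r : seq I) (F : I -> 'rV[R]_n -> R[i]) :
  (forall i, ccont (F i)) -> ccont (fun x => \sum_(i <- r) F i x).
Proof.
move=> cF; elim: r => [|i r IH].
  by under eq_fun do rewrite big_nil; exact: ccont_cst.
under eq_fun do rewrite big_cons -[F i _]mul1r.
exact: ccont_lin.
Qed.

Lemma smooth_cst (c : R[i]) : smooth (fun _ : 'rV[R]_n => c).
Proof. by move=> k; split; exact: Ck_cst. Qed.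

Lemma smooth_lin (a : R[i]) f g : smooth f -> smooth g ->
  smooth (fun x => a * f x + g x).
Proof.
move=> hf hg k; have [fr fi] := hf k; have [gr gi] := hg k; split.
  under eq_fun do rewrite [complex.Re _]raddfD/= Re_mul -addrA -mulNr.
  by do 2 apply: Ck_lin => //.
under eq_fun do rewrite [complex.Im _]raddfD/= Im_mul -addrA.
by do 2 apply: Ck_lin => //.
Qed.

Lemma smoothM f g : smooth f -> smooth g -> smooth (fun x => f x * g x).
Proof.
move=> hf hg k; have [fr fi] := hf k; have [gr gi] := hg k; split.
  under eq_fun do rewrite Re_mul addrC -mulN1r.
  by apply: Ck_lin; apply: CkM.
under eq_fun do rewrite Im_mul -[X in X + _]mul1r.
by apply: Ck_lin; apply: CkM.
Qed.

Lemma smoothZ (a : R[i]) f : smooth f -> smooth (fun x => a * f x).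
Proof. by apply: smoothM; exact: smooth_cst. Qed.

Lemma smoothJ f : smooth f -> smooth (fun x => (f x)^*).
Proof.
move=> hf k; have [fr fi] := hf k; split.
  by under eq_fun do rewrite Re_cconj.
under eq_fun do rewrite Im_cconj -[- _]addr0 -mulN1r.
by apply: Ck_lin => //; exact: Ck_cst.
Qed.

Lemma smooth_sum (I : Type) (r : seq I) (F : I -> 'rV[R]_n -> R[i]) :
  (forall i, smooth (F i)) -> smooth (fun x => \sum_(i <- r) F i x).
Proof.
move=> cF; elim: r => [|i r IH].
  by under eq_fun do rewrite big_nil; exact: smooth_cst.
under eq_fun do rewrite big_cons -[F i _]mul1r.
exact: smooth_lin.
Qed.

Lemma smooth_cderive v f : smooth f -> smooth (cderive v f).
Proof.
move=> hf k; have [[_ fr] [_ fi]] := hf k.+1.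
by split; [have [] := fr v|have [] := fi v].
Qed.

Lemma smooth_derivable v f x : smooth f ->
  derivable (fun y => complex.Re (f y)) x v /\ derivable (fun y => complex.Im (f y)) x v.
Proof.
move=> /(_ 1%N)[[_ fr] [_ fi]].
by split; [have [] := fr v|have [] := fi v].
Qed.

Lemma cderive_cst v (c : R[i]) x : cderive v (fun=> c) x = 0.
Proof. by apply: eq_complexP; rewrite /= derive_cst. Qed.

Lemma cderiveD v f g x : smooth f -> smooth g ->
  cderive v (fun y => f y + g y) x = cderive v f x + cderive v g x.
Proof.
move=> /(smooth_derivable v x)[fr fi] /(smooth_derivable v x)[gr gi].
apply: eq_complexP => /=.
  under eq_fun do rewrite [complex.Re _]raddfD/=.
  by rewrite derive_addE.
under eq_fun do rewrite [complex.Im _]raddfD/=.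
by rewrite derive_addE.
Qed.

Lemma cderiveM v f g x : smooth f -> smooth g ->
  cderive v (fun y => f y * g y) x = cderive v f x * g x + f x * cderive v g x.
Proof.
move=> /(smooth_derivable v x)[fr fi] /(smooth_derivable v x)[gr gi].
apply: eq_complexP.
  rewrite [LHS]/=; under eq_fun do rewrite Re_mul.
  rewrite derive_subE; try exact: derivable_mul.
  by rewrite !derive_mulE// [RHS]raddfD/= !Re_mul/=; ring.
rewrite [LHS]/=; under eq_fun do rewrite Im_mul.
rewrite derive_addE; try exact: derivable_mul.
by rewrite !derive_mulE// [RHS]raddfD/= !Im_mul/=; ring.
Qed.

Lemma cderiveZ v (a : R[i]) f x : smooth f ->
  cderive v (fun y => a * f y) x = a * cderive v f x.
Proof.
move=> hf; rewrite cderiveM//; last exact: smooth_cst.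
by rewrite cderive_cst mul0r add0r.
Qed.

Lemma cderiveJ v f x : smooth f -> cderive v (fun y => (f y)^*) x = (cderive v f x)^*.
Proof.
move=> /(smooth_derivable v x)[fr fi].
apply: eq_complexP => /=; first by under eq_fun do rewrite Re_cconj.
under eq_fun do rewrite Im_cconj.
by rewrite derive_oppE.
Qed.

Lemma cderive_linear_dir (a : R) u v f x : smooth f ->
  cderive (a *: u + v) f x = a%:C * cderive u f x + cderive v f x.
Proof.
move=> hf; have H (g : 'rV[R]_n -> R) : Ck 1 g ->
    'D_(a *: u + v) g x = a * 'D_u g x + 'D_v g x.
  move=> [_ hg]; apply: derive_linear_dir => w; have [dg [cg _]] := hg w => //.
have [/H hr /H hi] := hf 1%N.
by apply: eq_complexP; rewrite /= ?hr ?hi; ring.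
Qed.

Lemma cderive0 f x : cderive 0 f x = 0.
Proof. by apply: eq_complexP; rewrite /= derive0. Qed.

Lemma cderive_sum_dir (I : Type) (r : seq I) (a : I -> R) (w : I -> 'rV[R]_n) f x :
  smooth f ->
  cderive (\sum_(i <- r) a i *: w i) f x = \sum_(i <- r) (a i)%:C * cderive (w i) f x.
Proof.
move=> hf; elim: r => [|i r IH]; first by rewrite !big_nil cderive0.
by rewrite !big_cons cderive_linear_dir// IH.
Qed.

Lemma smooth_chi (l : 'cV[R]_n) : smooth (chi l).
Proof. by move=> k; exact: Ck_wave. Qed.

Lemma cderive_chi v (l : 'cV[R]_n) x :
  cderive v (chi l) x = (2 * pi * pairing l v)%:C * 'i%C * chi l x.
Proof.
have hc := is_derive_wave l v x (@is_derive_cos R).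
have hs := is_derive_wave l v x (@is_derive_sin R).
by apply: eq_complexP; rewrite /= derive_val; ring.
Qed.

Lemma chiD (l k : 'cV[R]_n) x : chi (l + k) x = chi l x * chi k x.
Proof.
apply: eq_complexP; rewrite ?Re_mul ?Im_mul/= pairing_addl mulrDr ?cosD ?sinD; ring.
Qed.

Lemma chiN (l : 'cV[R]_n) x : chi (- l) x = (chi l x)^*.
Proof.
by apply: eq_complexP; rewrite ?Re_cconj ?Im_cconj/= pairing_oppl mulrN ?cosN ?sinN.
Qed.

Lemma chi0 x : chi (0 : 'cV[R]_n) x = 1.
Proof. by apply: eq_complexP; rewrite /= /pairing mulmx0 mxE mulr0 ?cos0 ?sin0. Qed.

Lemma chi_conj (l : 'cV[R]_n) x : chi l x * (chi l x)^* = 1.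
Proof. by rewrite -chiN -chiD subrr chi0. Qed.

End ComplexSmooth.

(** * Periodic functions and the integral over the torus *)

Section Torus.
Context {R : realType} {n : nat} (B : 'M[R]_n) (hB : B \in unitmx).
Implicit Types (f g : 'rV[R]_n -> R[i]) (l k : 'cV[R]_n).

Definition lperiodic f := forall v x, lattice B v -> f (x + v) = f x.

Lemma lattice_row i : lattice B (row i B).
Proof.
exists (delta_mx 0 i); rewrite rowE; congr (_ *m _).
by apply/rowP => j; rewrite !mxE; case: (_ && _).
Qed.

Lemma fundamental_domain x : exists t v, [/\ cube t, lattice B v & x = t *m B + v].
Proof.
pose y := x *m invmx B.
pose z := \row_i Num.floor (y 0 i).
exists (y - map_mx intr z), (map_mx intr z *m B); split.
- move=> i; rewrite !mxE in_itv/= subr_ge0 ge_floor/=.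
  by rewrite lerBlDl; have := floorD1_gt (y 0 i); rewrite intrD mxE => /ltW.
- by exists z.
- by rewrite mulmxBl subrK mulmxKV.
Qed.

Lemma periodic_on_cube f g : lperiodic f -> lperiodic g ->
  (forall t, cube t -> f (t *m B) = g (t *m B)) -> f = g.
Proof.
move=> pf pg fg; apply/funext => x.
by have [t [v [ht hv ->]]] := fundamental_domain x; rewrite pf// pg// fg.
Qed.

Lemma cos_int (m : int) : cos (2 * pi * m%:~R) = 1 :> R.
Proof.
have H (p : nat) : cos (2 * pi * p%:R) = 1 :> R.
  have -> : 2 * pi * p%:R = pi *+ 2 *+ p :> R by rewrite -mulrnA -[RHS]mulr_natr natrM; ring.
  by have := periodicn (@cosD2pi R) p 0; rewrite add0r cos0.
case: (intP m) => [|p|p]; rewrite ?mulr0 ?cos0 ?H//.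
by rewrite mulrNz mulrN cosN H.
Qed.

Lemma sin_int (m : int) : sin (2 * pi * m%:~R) = 0 :> R.
Proof. by apply: cos1sin0; rewrite cos_int normr1. Qed.

(** The fractional part r of s satisfies cos (2 pi r) = 1, hence sin (pi r) =
    0, whereas sin is positive between 0 and pi. *)
Lemma cos_eq1_int (s : R) : cos (2 * pi * s) = 1 -> exists m : int, s = m%:~R.
Proof.
move=> h; exists (Num.floor s); apply/eqP; rewrite -subr_eq0; apply/eqP.
set r := s - _.
have r0 : 0 <= r by rewrite subr_ge0 ge_floor.
have r1 : r < 1 by rewrite ltrBlDl; have := floorD1_gt s; rewrite intrD.
have pi0 := @pi_gt0 R.
have {}h : cos (2 * pi * r) = 1.
  by rewrite /r mulrBr cosB h cos_int sin_int mulr0 addr0 mulr1.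
have s0 : sin (pi * r) = 0.
  have : cos ((pi * r) *+ 2) = 1 by rewrite -h; congr cos; rewrite -mulr_natl mulrA.
  rewrite cos_mulr2n cos2sin2 => hs.
  by apply/eqP; rewrite -sqrf_eq0; apply/eqP; lra.
apply/eqP; rewrite eq_le r0 andbT leNgt; apply/negP => rp.
have : 0 < sin (pi * r).
  by apply: sin_gt0_pi; rewrite mulr_gt0//= -[ltRHS]mulr1 ltr_pM2l.
by rewrite s0 ltxx.
Qed.

Lemma chi_periodic l : dual_lattice B l -> lperiodic (chi l).
Proof.
move=> hl v x /hl/intrP[m hm].
by apply: eq_complexP; rewrite /= pairingD hm mulrDr ?cosD ?sinD cos_int sin_int; ring.
Qed.

Lemma dual_latticeD l k : dual_lattice B l -> dual_lattice B k -> dual_lattice B (l + k).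
Proof. by move=> hl hk x hx; rewrite pairing_addl rpredD//; [exact: hl|exact: hk]. Qed.

Lemma dual_latticeN l : dual_lattice B l -> dual_lattice B (- l).
Proof. by move=> hl x hx; rewrite pairing_oppl rpredN; exact: hl. Qed.

Lemma dual_lattice0 : dual_lattice B 0.
Proof. by move=> x _; rewrite /pairing mulmx0 mxE. Qed.

Definition dual_basis i : 'cV[R]_n := col i (invmx B).

Lemma pairing_dual_basis i (t : 'rV[R]_n) : pairing (dual_basis i) (t *m B) = t 0 i.
Proof.
rewrite /pairing /dual_basis colE -!mulmxA (mulmxA B) mulmxV// mul1mx.
by rewrite -colE mxE.
Qed.

Lemma dual_basis_dual i : dual_lattice B (dual_basis i).
Proof. by move=> x [z ->]; rewrite pairing_dual_basis mxE. Qed.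

Local Notation T := (torus_integral B).

Lemma absdet_gt0 : 0 < `|\det B|.
Proof. by rewrite normr_gt0 -unitfE -unitmxE. Qed.

Lemma ccont_mulmx f : ccont f ->
  continuous (fun t : 'rV[R]_n => complex.Re (f (t *m B))) /\
  continuous (fun t : 'rV[R]_n => complex.Im (f (t *m B))).
Proof.
move=> [cr ci]; split.
  exact: (continuous_comp_mulmx (h := fun x => complex.Re (f x))).
exact: (continuous_comp_mulmx (h := fun x => complex.Im (f x))).
Qed.

Lemma torus_integral_lin (a : R[i]) f g : ccont f -> ccont g ->
  T (fun x => a * f x + g x) = a * T f + T g.
Proof.
move=> /ccont_mulmx[fr fi] /ccont_mulmx[gr gi].
apply: eq_complexP.
  rewrite [LHS]/=; under eq_fun do rewrite [complex.Re _]raddfD/= Re_mul -addrA -mulNr.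
  rewrite !cube_integral_lin//; last exact: continuous_lin.
  by rewrite [RHS]raddfD/= Re_mul/=; ring.
rewrite [LHS]/=; under eq_fun do rewrite [complex.Im _]raddfD/= Im_mul -addrA.
rewrite !cube_integral_lin//; last exact: continuous_lin.
by rewrite [RHS]raddfD/= Im_mul/=; ring.
Qed.

Lemma torus_integral_cst (c : R[i]) : T (fun=> c) = `|\det B|%:C * c.
Proof. by apply: eq_complexP; rewrite ?Re_mul ?Im_mul/= !cube_integral_cst; ring. Qed.

Lemma torus_integralJ f : ccont f -> T (fun x => (f x)^*) = (T f)^*.
Proof.
move=> /ccont_mulmx[fr fi]; apply: eq_complexP => /=.
  by under eq_fun do rewrite Re_cconj.
under eq_fun do rewrite Im_cconj -mulN1r.
by rewrite cube_integralZ//; ring.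
Qed.

Lemma torus_integralZ (a : R[i]) f : ccont f -> T (fun x => a * f x) = a * T f.
Proof.
move=> cf; have := torus_integral_lin a cf (ccont_cst 0).
by rewrite torus_integral_cst mulr0 addr0 => <-; under [in RHS]eq_fun do rewrite addr0.
Qed.

Lemma torus_integralD f g : ccont f -> ccont g ->
  T (fun x => f x + g x) = T f + T g.
Proof.
move=> cf cg; have := torus_integral_lin 1 cf cg.
by rewrite mul1r => <-; under [in RHS]eq_fun do rewrite mul1r.
Qed.

Lemma torus_integral_sum (I : Type) (r : seq I) (F : I -> 'rV[R]_n -> R[i]) :
  (forall i, ccont (F i)) ->
  T (fun x => \sum_(i <- r) F i x) = \sum_(i <- r) T (F i).
Proof.
move=> cF; elim: r => [|i r IH].
  by under eq_fun do rewrite big_nil; rewrite big_nil torus_integral_cst mulr0.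
under eq_fun do rewrite big_cons.
by rewrite torus_integralD ?IH ?big_cons//; exact: ccont_sum.
Qed.

(** Expressed in the rows of [B], the direction [v] is a combination of the
    coordinate directions of the cube, and a lattice periodic function is
    1-periodic in each of them. *)
Lemma torus_integral_cderive f v : smooth f -> lperiodic f -> T (cderive v f) = 0.
Proof.
move=> sf pf.
have real_part (g : 'rV[R]_n -> R) i : Ck 1 g -> (forall x, g (x + row i B) = g x) ->
    cube_integral (fun t => 'D_(row i B) g (t *m B)) = 0.
  move=> [cg /(_ (row i B))[dg [cdg _]]] pg.
  have Hd t : 'D_(row i B) g (t *m B) = 'D_(delta_mx 0 i) (fun t => g (t *m B)) t /\
      (derivable g (t *m B) (row i B) -> derivable (fun t => g (t *m B)) t (delta_mx 0 i)).
    by apply: derive_along => h; rewrite mulmxDl -scalemxAl rowE.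
  have E : (fun t => 'D_(row i B) g (t *m B)) = 'D_(delta_mx 0 i) (fun t => g (t *m B)).
    by apply/funext => t; have [-> _] := Hd t.
  rewrite E; apply: cube_integral_derive0.
  - exact: continuous_comp_mulmx.
  - by move=> t; have [_] := Hd t; apply.
  - by rewrite -E; exact: continuous_comp_mulmx cdg.
  - by move=> t; rewrite mulmxDl -rowE pg.
have basis i : T (cderive (row i B) f) = 0.
  have [cr ci] := sf 1%N.
  apply: eq_complexP; rewrite [LHS]/= real_part ?mulr0// => x.
    by rewrite pf//; exact: lattice_row.
  by rewrite pf//; exact: lattice_row.
have -> : v = \sum_i (v *m invmx B) 0 i *: row i B.
  by rewrite -mulmx_sum_row mulmxKV.
rewrite (_ : cderive _ f = fun x =>
    \sum_i ((v *m invmx B) 0 i)%:C * cderive (row i B) f x); last first.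
  by apply/funext => x; rewrite cderive_sum_dir.
rewrite torus_integral_sum.
  rewrite big1// => i _; rewrite torus_integralZ ?basis ?mulr0//.
  exact/smooth_ccont/smooth_cderive.
move=> i; apply: ccontM; first exact: ccont_cst.
exact/smooth_ccont/smooth_cderive.
Qed.

Lemma torus_integral_by_parts f g v :
  smooth f -> smooth g -> lperiodic f -> lperiodic g ->
  T (fun x => cderive v f x * g x) = - T (fun x => f x * cderive v g x).
Proof.
move=> sf sg pf pg; apply/eqP; rewrite -addr_eq0; apply/eqP.
rewrite -torus_integralD; try by apply: ccontM; apply: smooth_ccont => //; exact: smooth_cderive.
under eq_fun do rewrite -cderiveM//.
rewrite torus_integral_cderive//; first exact: smoothM.
by move=> u x hu; rewrite pf// pg.
Qed.

Lemma torus_integral_sqr_ge0 f : ccont f -> 0 <= complex.Re (T (fun x => f x * (f x)^*)).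
Proof.
move=> cf; rewrite /= mulr_ge0// -(@cube_integral_cst R n 0).
have [cr _] := ccont_mulmx (ccontM cf (ccontJ cf)).
apply: cube_integral_le => [|//|t _]; first exact: cst_continuous.
by case: (f _) => a b /=; rewrite mulrN opprK -!expr2 addr_ge0 ?sqr_ge0.
Qed.

Lemma torus_integral_sqr_eq0 f : ccont f -> lperiodic f ->
  complex.Re (T (fun x => f x * (f x)^*)) = 0 -> f = fun=> 0.
Proof.
move=> cf pf h0; apply: periodic_on_cube => // t ht.
have [cr ci] := ccontM cf (ccontJ cf).
have [/= cr' _] := ccont_mulmx (conj cr ci).
have Nsq (a : R[i]) : complex.Re (a * a^*) = complex.Re a ^+ 2 + complex.Im a ^+ 2.
  by case: a => a1 a2 /=; ring.
have [//|ft] := eqVneq (f (t *m B)) 0.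
have := @cube_integral_gt0 R n _ t cr' _ ht.
have -> : cube_integral (fun t => complex.Re (f (t *m B) * (f (t *m B))^*)) = 0.
  have /= /eqP := h0.
  by rewrite mulf_eq0 gt_eqF ?absdet_gt0//= => /eqP.
rewrite ltxx => H; suff : false by [].
apply: H => [y _|]; rewrite Nsq.
  by rewrite addr_ge0// sqr_ge0.
rewrite lt_def addr_ge0 ?sqr_ge0// andbT paddr_eq0 ?sqr_ge0// !sqrf_eq0.
apply: contra ft => /andP[/eqP h1 /eqP h2].
by apply/eqP/eq_complexP.
Qed.

End Torus.

(** * Uniqueness of Fourier coefficients *)

Section FourierUniqueness.
Context {R : realType} {n : nat} (B : 'M[R]_n) (hB : B \in unitmx).
Local Notation T := (torus_integral B).

Lemma double_Re (z : R[i]) : (2 * complex.Re z)%:C = z + z^*.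
Proof. by case: z => a b; apply: eq_complexP => /=; ring. Qed.

Lemma half_sum_conj (z : R[i]) : (complex.Re z)%:C = 2^-1 * (z + z^*).
Proof.
have -> : z + z^* = 2 * (complex.Re z)%:C.
  by case: z => a b; apply: eq_complexP; rewrite ?Re_mul ?Im_mul/=; ring.
by rewrite mulKf// pnatr_eq0.
Qed.

Lemma Re_chi_conj (l : 'cV[R]_n) x y :
  complex.Re (chi l x * (chi l y)^*) = cos (2 * pi * (pairing l x - pairing l y)).
Proof. by rewrite Re_mul/= mulrBr cosB; ring. Qed.

(** This is 1 + e - (n+1)^-1 sum_i (1 - cos (2 pi (t_i - t0_i))), where t and
    t0 are the coordinates of x and x0 in the lattice basis: it is 1 + e at x0
    and smaller away from the lattice translates of x0. The terms are written
    with characters to make it a trigonometric polynomial. As each of them is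
    at most 2, dividing by n+1 keeps the value above -1 for positive e, also
    if n = 0. *)
Definition bump_poly (x0 : 'rV[R]_n) (e : R) (x : 'rV[R]_n) : R :=
  1 + e - (n.+1%:R)^-1 *
    \sum_(i < n) (1 - complex.Re (chi (dual_basis B i) x * (chi (dual_basis B i) x0)^*)).

Lemma ccont_chi (l : 'cV[R]_n) : ccont (chi l).
Proof. exact/smooth_ccont/smooth_chi. Qed.

Lemma ccont_real (g : 'rV[R]_n -> R) : continuous g -> ccont (fun x => (g x)%:C).
Proof. by move=> cg; split => //; exact: cst_continuous. Qed.

Lemma continuous_bump_poly x0 e : continuous (bump_poly x0 e).
Proof.
apply: continuous_sub; first exact: cst_continuous.
apply: continuous_mul; first exact: cst_continuous.
apply: continuous_sum => i; apply: continuous_sub; first exact: cst_continuous.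
by have [] := ccontM (ccont_chi (dual_basis B i)) (ccont_cst (chi (dual_basis B i) x0)^*).
Qed.

Lemma bump_poly_expand x0 e x :
  (bump_poly x0 e x)%:C = (1 + e - n%:R / n.+1%:R)%:C + \sum_(i < n)
    ((n.+1%:R)^-1 / 2)%:C * ((chi (dual_basis B i) x0)^* * chi (dual_basis B i) x +
       chi (dual_basis B i) x0 * chi (- dual_basis B i) x).
Proof.
pose z i := chi (dual_basis B i) x * (chi (dual_basis B i) x0)^*.
have -> : bump_poly x0 e x = (1 + e - n%:R / n.+1%:R) +
    \sum_(i < n) (n.+1%:R)^-1 / 2 * (2 * complex.Re (z i)).
  rewrite /bump_poly sumrB sumr_const card_ord -mulr_sumr -mulr_sumr.
  by field; rewrite addrC natr1 pnatr_eq0.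
rewrite rmorphD rmorph_sum; congr (_ + _); apply: eq_bigr => i _.
rewrite rmorphM [RHS]mulrC [LHS]mulrC; congr (_ * _).
by rewrite [LHS]double_Re /z cconjM conjCK chiN; ring.
Qed.

Lemma continuous_exp (g : 'rV[R]_n -> R) N : continuous g -> continuous (fun x => g x ^+ N).
Proof.
move=> cg; elim: N => [|N IH]; first by under eq_fun do rewrite expr0; exact: cst_continuous.
by under eq_fun do rewrite exprS; exact: continuous_mul.
Qed.

(** Multiplication by [bump_poly] turns [chi l] into a combination of [chi l]
    and of the [chi (l +- dual_basis B i)], so that orthogonality to all
    characters passes from each power to the next. *)
Lemma integral_bump_pow (g : 'rV[R]_n -> R) x0 e N : continuous g ->
  (forall l, dual_lattice B l -> T (fun x => (g x)%:C * chi l x) = 0) ->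
  forall l, dual_lattice B l ->
    T (fun x => (g x * bump_poly x0 e x ^+ N)%:C * chi l x) = 0.
Proof.
move=> cg g0; elim: N => [|N IH] l hl.
  by under eq_fun do rewrite expr0 mulr1; exact: g0.
set h := fun x => g x * bump_poly x0 e x ^+ N.
have cch k : ccont (fun x => (h x)%:C * chi k x).
  apply: ccontM; last exact: ccont_chi; apply: ccont_real; apply: continuous_mul => //.
  by apply: continuous_exp; exact: continuous_bump_poly.
have -> : (fun x => (g x * bump_poly x0 e x ^+ N.+1)%:C * chi l x) = fun x =>
    (1 + e - n%:R / n.+1%:R)%:C * ((h x)%:C * chi l x) + \sum_(i < n)
    (((n.+1%:R)^-1 / 2)%:C * (chi (dual_basis B i) x0)^* * ((h x)%:C * chi (l + dual_basis B i) x) +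
     ((n.+1%:R)^-1 / 2)%:C * chi (dual_basis B i) x0 * ((h x)%:C * chi (l - dual_basis B i) x)).
  apply/funext => x; rewrite exprSr mulrA rmorphM/= bump_poly_expand mulrDr mulrDl.
  congr (_ + _); first by rewrite -/(h x); ring.
  rewrite mulr_sumr mulr_suml; apply: eq_bigr => i _; rewrite !chiD -/(h x); ring.
have cs i : ccont (fun x => ((n.+1%:R)^-1 / 2)%:C * (chi (dual_basis B i) x0)^* * ((h x)%:C * chi (l + dual_basis B i) x) +
     ((n.+1%:R)^-1 / 2)%:C * chi (dual_basis B i) x0 * ((h x)%:C * chi (l - dual_basis B i) x)).
  apply: ccont_lin => //; exact: ccontM (ccont_cst _) _.
rewrite torus_integral_lin//; last exact: ccont_sum.
rewrite IH// mulr0 add0r torus_integral_sum// big1// => i _.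
have hi := dual_basis_dual hB i.
rewrite torus_integral_lin//; last exact: ccontM (ccont_cst _) _.
rewrite torus_integralZ// !IH ?mulr0 ?addr0//; apply: dual_latticeD => //.
exact: dual_latticeN.
Qed.

(** A vanishing sum forces each cosine to be 1, hence each difference of
    coordinates to be an integer. *)
Lemma chi_separates (t t0 : 'rV[R]_n) :
  \sum_(i < n) (1 - complex.Re (chi (dual_basis B i) (t *m B) *
     (chi (dual_basis B i) (t0 *m B))^*)) = 0 ->
  exists2 v, lattice B v & t *m B = t0 *m B + v.
Proof.
move=> /eqP; rewrite psumr_eq0 => [|i _]; last first.
  by rewrite Re_chi_conj subr_ge0 cos_le1.
move=> /allP h.
have /choice[z hz] : forall i, exists m : int, t 0 i - t0 0 i = m%:~R.
  move=> i; apply: cos_eq1_int; have /eqP := h i (mem_index_enum _).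
  by rewrite Re_chi_conj !pairing_dual_basis// => ?; lra.
exists (map_mx intr (\row_i z i) *m B); first by eexists.
rewrite -mulmxDl; congr (_ *m _); apply/rowP => i.
by rewrite !mxE -hz; ring.
Qed.

Lemma bernoulli_le N (r : R) : 1 <= r -> 1 + N%:R * (r - 1) <= r ^+ N.
Proof.
move=> r1; elim: N => [|N IHN]; first by rewrite mul0r addr0 expr0.
have N0 : 0 <= N%:R :> R by [].
have h1 : 0 <= N%:R * (r - 1) ^+ 2 by rewrite mulr_ge0// sqr_ge0.
have h2 : r * (1 + N%:R * (r - 1)) <= r * r ^+ N by apply: ler_wpM2l => //; lra.
rewrite exprS -natr1; apply: le_trans h2; rewrite -subr_ge0.
by apply: le_trans h1 _; rewrite le_eqVlt; apply/orP; left; apply/eqP; ring.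
Qed.

(** Suppose that g exceeds c > 0 near x0 and let q be [bump_poly x0 e]. If e
    is small, then q exceeds 1 only where g exceeds c; there g q^N grows at
    least like c N (q - 1) by the Bernoulli inequality, while elsewhere |q| <=
    1 keeps g q^N bounded. Thus the integral of g q^N grows linearly with N,
    but it is 0 for every N by [integral_bump_pow]. *)
Lemma fourier_unique_real (g : 'rV[R]_n -> R) : continuous g ->
  (forall v x, lattice B v -> g (x + v) = g x) ->
  (forall l, dual_lattice B l -> T (fun x => (g x)%:C * chi l x) = 0) ->
  forall t, cube t -> g (t *m B) <= 0.
Proof.
move=> cg pg g0 t0 ht0; rewrite leNgt; apply/negP => gt0.
pose x0 := t0 *m B; pose c := g x0 / 2.
have c0 : 0 < c by rewrite divr_gt0.
have cG : continuous (fun t : 'rV[R]_n => g (t *m B)) by exact: continuous_comp_mulmx.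
pose h (t : 'rV[R]_n) : R := \sum_(i < n) (1 - complex.Re (chi (dual_basis B i) (t *m B) *
     (chi (dual_basis B i) x0)^*)).
have h_ge0 t : 0 <= h t.
  by apply: sumr_ge0 => i _; rewrite Re_chi_conj subr_ge0 cos_le1.
have h_le t : h t <= n%:R * 2.
  rewrite /h (le_trans (ler_sum _ (_ : forall i, true -> _ <= 2)))//.
    move=> i _; rewrite Re_chi_conj.
    have := cos_geN1 (2 * pi * (pairing (dual_basis B i) (t *m B) - pairing (dual_basis B i) x0)).
    lra.
  by rewrite sumr_const card_ord mulr_natl.
have QE e t : bump_poly x0 e (t *m B) = 1 + e - (n.+1%:R)^-1 * h t by [].
have ch : continuous h.
  have -> : h = fun t => n.+1%:R * 1 + - (n.+1%:R * bump_poly x0 0 (t *m B)).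
    by apply/funext => t; rewrite QE; field; rewrite addrC natr1 pnatr_eq0.
  apply: continuous_sub; first exact: cst_continuous.
  apply: continuous_mul; first exact: cst_continuous.
  exact/continuous_comp_mulmx/continuous_bump_poly.
have n1 : 0 < (n.+1%:R : R) by rewrite ltr0n.
pose K := @cube R n `&` [set t : 'rV[R]_n | g (t *m B) <= c].
have cK : compact K.
  apply: compact_closedI; first exact: cube_compact.
  apply: (@closed_comp _ _ (fun t : 'rV[R]_n => g (t *m B)) [set x | x <= c]).
    by move=> t _; exact: cG.
  exact: closed_le.
(* The minimum of h on the compact set K where g is at most c; it is positive,
   since h only vanishes at lattice translates of x0, where g = 2 c. *)
have [e e0 He] : exists2 e, 0 < e & forall t, K t -> (n.+1%:R)^-1 * h t >= e.
  have [K0|K0] := pselect (K !=set0); last first.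
    by exists 1 => // t Kt; case: K0; exists t.
  have [m] := compact_EVT_min K0 cK (continuous_subspaceT ch).
  rewrite in_setE => mK hm; exists ((n.+1%:R)^-1 * h m); last first.
    by move=> t Kt; rewrite ler_pM2l ?invr_gt0// hm// in_setE.
  rewrite mulr_gt0 ?invr_gt0// lt_def h_ge0 andbT; apply/eqP => /chi_separates[v hv E].
  by case: mK => _ /=; rewrite E pg// /c; lra.
pose q t := bump_poly x0 e (t *m B).
have cq : continuous q by exact/continuous_comp_mulmx/continuous_bump_poly.
have q_ge t : -1 <= q t.
  rewrite /q QE; suff : (n.+1%:R)^-1 * h t <= 2 by move: (_ * h t) e0 => r; lra.
  by rewrite ler_pdivrMl// (le_trans (h_le t))// ler_pM2r// ler_nat.
have q_K t : K t -> q t <= 1 by move=> /He; rewrite /q QE; move: (_ * h t) => r; lra.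
have [M hM] : exists M, forall t, cube t -> `|g (t *m B)| <= M.
  have [m _ hm] := compact_EVT_max (ex_intro _ t0 ht0) (@cube_compact R n)
    (continuous_subspaceT (fun t => continuous_comp (cG t) (@norm_continuous _ R^o _))).
  by exists `|g (m *m B)| => t ht; apply: hm; rewrite in_setE.
(* The positive part of q - 1 carries the linear growth; its integral is
   positive because p is e at t0. *)
pose p t : R := Num.max 0 (q t - 1).
have cp : continuous p.
  have cq1 : continuous (fun t => q t - 1) by apply: continuous_sub => //; exact: cst_continuous.
  by move=> t; exact: (continuous_max (@cst_continuous _ _ 0 t) (cq1 t)).
have J0 : 0 < cube_integral p.
  apply: (@cube_integral_gt0 _ _ _ t0) => //.
    by move=> t _; rewrite le_max lexx.
  rewrite lt_max /q QE (_ : h t0 = 0) ?mulr0; first by apply/orP; right; lra.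
  by apply: big1 => i _; rewrite chi_conj subrr.
have bound N t : cube t -> (c * N%:R) * p t + - M <= g (t *m B) * q t ^+ N.
  move=> ht; have := hM t ht; rewrite ler_norml => /andP[gM1 gM2].
  have M0 : 0 <= M by exact: le_trans (normr_ge0 _) (hM t ht).
  have small : q t <= 1 -> (c * N%:R) * p t + - M <= g (t *m B) * q t ^+ N.
    move=> q1; rewrite /p max_l ?subr_le0// mulr0 add0r.
    have : `|g (t *m B) * q t ^+ N| <= M.
      rewrite normrM -[leRHS]mulr1 ler_pM ?normr_ge0 ?hM// normrX exprn_ile1 ?normr_ge0//.
      by rewrite ler_norml q_ge q1.
    by rewrite ler_norml => /andP[].
  have [/small//|q1] := leP (q t) 1.
  have [gc|gc] := leP (g (t *m B)) c.
    by apply: small; apply: q_K; split.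
  rewrite /p max_r; last by rewrite subr_ge0 ltW.
  have B1 := bernoulli_le N (ltW q1).
  have qN0 : 0 <= N%:R * (q t - 1) by rewrite mulr_ge0// subr_ge0 ltW.
  apply: (@le_trans _ _ (c * q t ^+ N)); last first.
    by apply: ler_wpM2r; [apply: exprn_ge0; lra|exact: ltW].
  rewrite -mulrA; apply: (@le_trans _ _ (c * (N%:R * (q t - 1)))); first lra.
  by apply: ler_wpM2l; [exact: ltW|lra].
have key N : (c * N%:R) * cube_integral p <= M.
  have cgq : continuous (fun t : 'rV[R]_n => g (t *m B) * q t ^+ N).
    exact: (continuous_mul cG (@continuous_exp q N cq)).
  have I0 : cube_integral (fun t => g (t *m B) * q t ^+ N) = 0.
    have := integral_bump_pow x0 e N cg g0 (@dual_lattice0 R n B).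
    under eq_fun do rewrite chi0 mulr1; move=> /(congr1 (@complex.Re R)) /=.
    by move=> /eqP; rewrite mulf_eq0 gt_eqF ?absdet_gt0//= => /eqP.
  rewrite -subr_le0 -I0 -(@cube_integral_cst R n (- M)) -cube_integral_lin//; last first.
    exact: cst_continuous.
  apply: cube_integral_le => //; last by move=> t; exact: bound.
  by apply: continuous_lin => //; exact: cst_continuous.
have := key (Num.truncn (M / (c * cube_integral p))).+1.
rewrite mulrAC leNgt -ltr_pdivrMl ?mulr_gt0// mulrC => /negP; apply.
exact: truncnS_gt.
Qed.

(** The coefficients of the conjugate of f vanish as well, hence those of its
    real and imaginary parts, to which the real case applies with both signs.
    *)
Lemma fourier_unique (f : 'rV[R]_n -> R[i]) : ccont f -> lperiodic B f ->
  (forall l, dual_lattice B l -> T (fun x => f x * (chi l x)^*) = 0) -> f = fun=> 0.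
Proof.
move=> cf pf f0.
have real0 (g : 'rV[R]_n -> R) : continuous g ->
    (forall v x, lattice B v -> g (x + v) = g x) ->
    (forall l, dual_lattice B l -> T (fun x => (g x)%:C * chi l x) = 0) ->
    g = fun=> 0.
  move=> cg pg g0.
  have H t : cube t -> g (t *m B) = 0.
    move=> ht; apply/eqP; rewrite eq_le (fourier_unique_real cg pg g0)//= -oppr_le0.
    apply: (@fourier_unique_real (fun x => - g x)) => //.
    - by under eq_fun do rewrite -sub0r; apply: continuous_sub => //; exact: cst_continuous.
    - by move=> v x hv; rewrite pg.
    - move=> l hl; under eq_fun do rewrite rmorphN mulNr -mulN1r.
      rewrite torus_integralZ ?g0 ?mulr0//; apply: ccontM; [exact: ccont_real|exact: ccont_chi].
  apply/funext => x; have [t [v [ht hv ->]]] := fundamental_domain hB x.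
  by rewrite pg// H.
have f0' l : dual_lattice B l -> T (fun x => f x * chi l x) = 0.
  move=> hl; rewrite -(f0 (- l)); last exact: dual_latticeN.
  by congr torus_integral; apply/funext => x; rewrite chiN conjCK.
have fJ l : dual_lattice B l -> T (fun x => (f x)^* * chi l x) = 0.
  move=> hl; rewrite (_ : (fun x => _) = fun x => (f x * (chi l x)^*)^*); last first.
    by apply/funext => x; rewrite cconjM conjCK.
  by rewrite torus_integralJ ?f0 ?rmorph0//; apply: ccontM => //; exact/ccontJ/ccont_chi.
have cfl l : ccont (fun x => f x * chi l x) by apply: ccontM => //; exact: ccont_chi.
have cfJl l : ccont (fun x => (f x)^* * chi l x).
  by apply: ccontM; [exact: ccontJ|exact: ccont_chi].
have [cr ci] := cf.
have Re0 : (fun x => complex.Re (f x)) = fun=> 0.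
  apply: real0 => // [v x hv|l hl]; first by rewrite pf.
  rewrite (_ : (fun x => _) = fun x => 2^-1 * (f x * chi l x) + 2^-1 * ((f x)^* * chi l x)).
    rewrite torus_integral_lin//; last exact: ccontM (ccont_cst _) _.
    by rewrite torus_integralZ// f0'// fJ// !mulr0 addr0.
  by apply/funext => x; rewrite -mulrDr -mulrDl mulrA -half_sum_conj.
have Im0 : (fun x => complex.Im (f x)) = fun=> 0.
  apply: real0 => // [v x hv|l hl]; first by rewrite pf.
  rewrite (_ : (fun x => _) = fun x => (- 'i%C / 2) * (f x * chi l x) + ('i%C / 2) * ((f x)^* * chi l x)).
    rewrite torus_integral_lin//; last exact: ccontM (ccont_cst _) _.
    by rewrite torus_integralZ// f0'// fJ// !mulr0 addr0.
  apply/funext => x; rewrite !mulrA -mulrDl; congr (_ * _).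
  by case: (f x) => a b; apply: eq_complexP; rewrite ?Re_mul ?Im_mul/=; field.
apply/funext => x; apply: eq_complexP.
  by have /(congr1 (fun g => g x)) := Re0.
by have /(congr1 (fun g => g x)) := Im0.
Qed.

End FourierUniqueness.

(** * Alternating covectors *)

Section Multilinear.
Context {R : realType} {n : nat}.

Definition setrow p (i : 'I_p) (v : 'rV[R]_n) (A : 'M[R]_(p, n)) : 'M[R]_(p, n) :=
  \matrix_(k, j) if k == i then v 0 j else A k j.

Lemma row_setrow p (i k : 'I_p) v (A : 'M[R]_(p, n)) :
  row k (setrow i v A) = if k == i then v else row k A.
Proof. by case: ifP => ki; apply/rowP => j; rewrite !mxE ki. Qed.

Lemma setrow_row p (i : 'I_p) (A : 'M[R]_(p, n)) : setrow i (row i A) A = A.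
Proof. by apply/row_matrixP => k; rewrite row_setrow; case: eqP => // ->. Qed.

Lemma row'_eqP p (i : 'I_p) (A1 A2 : 'M[R]_(p, n)) :
  row' i A1 = row' i A2 <-> forall k, k != i -> row k A1 = row k A2.
Proof.
split=> [h k|h].
  rewrite eq_sym => /unlift_some[k' -> _]; apply/rowP => j.
  by have /matrixP/(_ k' j) := h; rewrite !mxE.
apply/matrixP => k j; rewrite !mxE.
have ki : lift i k != i by rewrite eq_sym neq_lift.
by have /rowP/(_ j) := h _ ki; rewrite !mxE.
Qed.

Section Fixed.
Context (p : nat) (w : covector R n p).

Lemma multilinear_setrow (i : 'I_p) a u v A : multilinear w ->
  w (setrow i (a *: u + v) A) = a%:C * w (setrow i u A) + w (setrow i v A).
Proof.
move=> mw; apply: (mw i).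
- by rewrite !row_setrow eqxx.
- by apply/row'_eqP => k /negPf ki; rewrite !row_setrow ki.
- by apply/row'_eqP => k /negPf ki; rewrite !row_setrow ki.
Qed.

Lemma multilinear_setrowP : (forall (i : 'I_p) a u v A,
    w (setrow i (a *: u + v) A) = a%:C * w (setrow i u A) + w (setrow i v A)) ->
  multilinear w.
Proof.
move=> h i a A A1 A2 E /row'_eqP E1 /row'_eqP E2.
rewrite -[A](setrow_row i) E h; congr (_ * w _ + w _); apply/row_matrixP => k;
  by rewrite row_setrow; case: eqVneq => [->//|ki]; rewrite ?E1 ?E2.
Qed.

Lemma multilinear_sum (i : 'I_p) (I : Type) (r : seq I) (c : I -> R)
    (v : I -> 'rV[R]_n) A : multilinear w ->
  w (setrow i (\sum_(j <- r) c j *: v j) A) =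
  \sum_(j <- r) (c j)%:C * w (setrow i (v j) A).
Proof.
move=> mw; elim: r => [|j r IH].
  rewrite !big_nil; have := multilinear_setrow i 1 0 0 A mw.
  by rewrite scaler0 addr0 mul1r => /eqP; rewrite -subr_eq subrr eq_sym => /eqP.
by rewrite !big_cons multilinear_setrow// IH.
Qed.

(** Expand w at A with both rows i and j replaced by the sum of the two. The
    vanishing is only assumed for the given pair of rows, so that this applies
    to adjacent rows before w is known to be alternating. *)
Lemma multilinear_swap (i j : 'I_p) A : multilinear w -> i != j ->
  (forall A', row i A' = row j A' -> w A' = 0) -> w (xrow i j A) = - w A.
Proof.
move=> mw ij h; have ji : j != i by rewrite eq_sym.
pose W u v := w (setrow i u (setrow j v A)).
have Wd u v v' : W u (v + v') = W u v + W u v'.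
  have C x y : setrow i x (setrow j y A) = setrow j y (setrow i x A).
    apply/row_matrixP => k; rewrite !row_setrow.
    by case: (eqVneq k i) => [->|//]; rewrite (negPf ij).
  by rewrite /W !C -[v]scale1r multilinear_setrow// mul1r scale1r.
have Wd' u u' v : W (u + u') v = W u v + W u' v.
  by rewrite /W -[u]scale1r multilinear_setrow// mul1r scale1r.
have W0 u : W u u = 0 by apply: h; rewrite !row_setrow !eqxx (negPf ji).
have := W0 (row i A + row j A); rewrite Wd Wd' Wd' !W0 add0r addr0 addrC.
have -> : W (row i A) (row j A) = w A by rewrite /W !setrow_row.
have -> : W (row j A) (row i A) = w (xrow i j A).
  congr w; apply/row_matrixP => k; rewrite !row_setrow.
  case: (eqVneq k i) => [->|ki]; first by apply/rowP => l; rewrite !mxE tpermL.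
  case: (eqVneq k j) => [->|kj]; first by apply/rowP => l; rewrite !mxE tpermR.
  by apply/rowP => l; rewrite !mxE tpermD// eq_sym.
by move=> /eqP; rewrite addrC addr_eq0 => /eqP.
Qed.

(** Swapping the later of two equal rows with the row above it brings them
    closer at the cost of a sign. *)
Lemma alternating_adjacent : multilinear w ->
  (forall A (i j : 'I_p), j = i.+1 :> nat -> row i A = row j A -> w A = 0) ->
  Defs.alternating w.
Proof.
move=> mw h.
suff H d : forall A (i j : 'I_p), j = (i + d).+1 :> nat -> row i A = row j A -> w A = 0.
  move=> A i j ij E; have [lt|gt|eq] := ltngtP i j.
  - by apply: (H (j - i.+1)%N A i j) => //; rewrite -addSn subnKC.
  - by apply: (H (i - j.+1)%N A j i) => //; rewrite -addSn subnKC.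
  - by case/eqP: ij; exact: val_inj.
elim: d => [|d IH] A i j; first by rewrite addn0; exact: h.
move=> E rE.
have kp : ((i + d).+1 < p)%N by rewrite (leq_trans _ (ltn_ord j))// E addnS.
pose k := Ordinal kp.
have kj : k != j by rewrite -val_eqE/= E addnS ltn_eqF.
have ki : k != i by rewrite -val_eqE/= gtn_eqF// ltnS leq_addr.
have ji : j != i by rewrite -val_eqE/= E gtn_eqF// ltnS leq_addr.
have := @multilinear_swap k j A mw kj (fun A' => h A' k j _).
rewrite E addnS => /(_ erefl) S.
apply: oppr_inj; rewrite -S oppr0; apply: (IH _ i k) => //.
apply/rowP => l; rewrite !mxE tpermL tpermD//.
by have /rowP/(_ l) := rE; rewrite !mxE.
Qed.

Hypothesis aw : alt_covector w.

Lemma alt_swap (i j : 'I_p) A : i != j -> w (xrow i j A) = - w A.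
Proof. by case: aw => mw al ij; apply: multilinear_swap => // A'; exact: al. Qed.

Lemma alt_row_perm (s : 'S_p) A : w (row_perm s A) = (-1) ^+ s * w A.
Proof.
case: (prod_tpermP s) => ts -> /allP; elim: ts => [|[i j] ts IH] hts.
  by rewrite big_nil row_perm1 odd_perm1 expr0 mul1r.
have ij : i != j by exact: (hts (i, j) (mem_head _ _)).
rewrite big_cons row_permM -/(xrow i j _) alt_swap// IH; last first.
  by move=> x hx; apply: hts; rewrite inE hx orbT.
by rewrite odd_permM odd_tperm ij/= signrN mulNr.
Qed.

(** The rows of A are expanded one after the other in the basis P; tuples with
    a repeated basis vector contribute nothing. *)
Lemma alt_zero_basis (P : 'M[R]_n) : P \in unitmx ->
  (forall f : 'I_p -> 'I_n, injective f -> w (rowsub f P) = 0) -> forall A, w A = 0.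
Proof.
case: aw => mw al uP h A.
have {}h (f : 'I_p -> 'I_n) : w (rowsub f P) = 0.
  have [/injectiveP/h//|/injectivePn[i [j ij fij]]] := boolP (injectiveb f).
  by apply: (al _ i j ij); apply/rowP => k; rewrite !mxE fij.
(* The rows from the k-th on are already basis vectors; the induction expands
   row k. *)
suff H k : forall A, (forall i : 'I_p, (k <= i)%N -> exists j, row i A = row j P) -> w A = 0.
  by apply: (H p) => i; rewrite leqNgt ltn_ord.
elim: k => [|k IH] {}A hA.
  have /choice[f hf] : forall i : 'I_p, exists j, row i A = row j P by move=> i; exact: hA.
  rewrite -(h f); congr w; apply/row_matrixP => i; rewrite hf.
  by apply/rowP => l; rewrite !mxE.
have [kp|kp] := ltnP k p; last first.
  by apply: IH => i; rewrite leqNgt (leq_trans (ltn_ord i) kp).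
pose i := Ordinal kp.
rewrite -[A](setrow_row i) -[row i A](mulmxKV uP) mulmx_sum_row multilinear_sum//.
apply: big1 => j _; rewrite IH ?mulr0// => l kl; rewrite row_setrow.
case: eqVneq => [_|li]; first by exists j.
by apply: hA; rewrite ltn_neqAle kl andbT eq_sym; exact: li.
Qed.

End Fixed.

(** The permutation that moves row i to the front has the parity of i. *)
Lemma alt_front p (w : covector R n p.+1) (i : 'I_p.+1) A : alt_covector w ->
  w (col_mx (row i A) (row' i A)) = (-1) ^+ i * w A.
Proof.
move=> aw; have <- : row_perm (lift_perm ord0 i 1) A = col_mx (row i A) (row' i A).
  apply/row_matrixP => k; case: (unliftP ord0 k) => [k' ->|->].
    apply/rowP => j; rewrite !mxE lift_perm_lift perm1.
    case: splitP => [l|l /=]; first by rewrite ord1.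
    by rewrite /bump/= add1n => -[/val_inj ->]; rewrite !mxE.
  apply/rowP => j; rewrite !mxE lift_perm_id.
  by case: splitP => [l _|l //=]; rewrite mxE.
by rewrite alt_row_perm// odd_lift_perm odd_perm1/= addbF signr_odd.
Qed.

Lemma alt_lin p (a : R[i]) (v w : covector R n p) : alt_covector v -> alt_covector w ->
  alt_covector (fun A => a * v A + w A).
Proof.
move=> [mv av] [mw aw]; split.
  move=> i b A A1 A2 E E1 E2; rewrite (mv i b A A1 A2)// (mw i b A A1 A2)//; ring.
by move=> A i j ij E; rewrite (av _ i j)// (aw _ i j)// mulr0 addr0.
Qed.

Lemma alt0 p : alt_covector ((fun=> 0) : covector R n p).
Proof. by split=> [i a A A1 A2 _ _ _|//]; rewrite mulr0 addr0. Qed.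

Lemma alt_scale p (a : R[i]) (w : covector R n p) : alt_covector w ->
  alt_covector (fun A => a * w A).
Proof.
move=> aw; have := alt_lin a aw (@alt0 p).
by congr alt_covector; apply/funext => A; rewrite addr0.
Qed.

Lemma alt_sum p (I : Type) (r : seq I) (w : I -> covector R n p) :
  (forall i, alt_covector (w i)) -> alt_covector (fun A => \sum_(i <- r) w i A).
Proof.
move=> aw; elim: r => [|i r IH].
  by rewrite (_ : (fun A => _) = fun=> 0); [exact: alt0|apply/funext => A; rewrite big_nil].
rewrite (_ : (fun A => _) = fun A => 1 * w i A + \sum_(j <- r) w j A).
  exact: alt_lin.
by apply/funext => A; rewrite big_cons mul1r.
Qed.

Lemma row_col_mx0 p (X : 'rV[R]_n) (A : 'M[R]_(p, n)) :
  row ord0 (col_mx X A : 'M[R]_(p.+1, n)) = X.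
Proof. by apply/rowP => j; rewrite !mxE; case: splitP => // k; rewrite ord1. Qed.

Lemma row_col_mxS p (X : 'rV[R]_n) (A : 'M[R]_(p, n)) i :
  row (lift ord0 i) (col_mx X A : 'M[R]_(p.+1, n)) = row i A.
Proof.
apply/rowP => j; rewrite !mxE; case: splitP => k /=; first by rewrite ord1.
by rewrite /bump /= add1n => -[/val_inj ->].
Qed.

Lemma row'_col_mx0 p (X : 'rV[R]_n) (A : 'M[R]_(p, n)) :
  row' ord0 (col_mx X A : 'M[R]_(p.+1, n)) = A.
Proof.
apply/row_matrixP => i; rewrite -[RHS](row_col_mxS X).
by apply/rowP => j; rewrite !mxE.
Qed.

Lemma row'_col_mxS p (X : 'rV[R]_n) (A : 'M[R]_(p.+1, n)) i :
  row' (lift ord0 i) (col_mx X A : 'M[R]_(p.+2, n)) = col_mx X (row' i A).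
Proof.
apply/row_matrixP => k; case: (unliftP ord0 k) => [k' ->|->].
  rewrite row_col_mxS; apply/rowP => j; rewrite [LHS]mxE [LHS]mxE.
  have -> : lift (lift ord0 i) (lift ord0 k') = lift ord0 (lift i k').
    by apply: val_inj; rewrite /= /bump/= !add1n !ltnS; case: (i <= k')%N.
  by have /rowP/(_ j) := row_col_mxS X A (lift i k'); rewrite !mxE => ->.
rewrite row_col_mx0; apply/rowP => j; rewrite [LHS]mxE [LHS]mxE.
have -> : lift (lift ord0 i) ord0 = ord0 by exact: val_inj.
by have /rowP/(_ j) := row_col_mx0 X A; rewrite [LHS]mxE.
Qed.

(** The antisymmetrization behind both [wedge] and [ext_d]: the vector
    argument of g is paired with l in the one case and is the direction of
    differentiation in the other. *)
Definition altsum p (g : 'rV[R]_n -> covector R n p) : covector R n p.+1 :=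
  fun A => \sum_(i < p.+1) (-1) ^+ i * g (row i A) (row' i A).

Lemma row_row' p (i : 'I_p.+1) (k : 'I_p) (A : 'M[R]_(p.+1, n)) :
  row k (row' i A) = row (lift i k) A.
Proof. by apply/rowP => j; rewrite !mxE. Qed.

(** If rows i and i + 1 agree, then deleting either leaves the same matrix, so
    that the terms i and i + 1 cancel. Every other term still contains both
    rows. *)
Lemma altsum_alt p (g : 'rV[R]_n -> covector R n p) :
  (forall a u v A, g (a *: u + v) A = a%:C * g u A + g v A) ->
  (forall v, alt_covector (g v)) -> alt_covector (altsum g).
Proof.
move=> lg ag.
have mg : multilinear (altsum g).
  apply: multilinear_setrowP => i a u v A.
  rewrite /altsum mulr_sumr -big_split; apply: eq_bigr => j _ /=.
  rewrite !row_setrow; case: (eqVneq j i) => [->|ji].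
    have E x : row' i (setrow i x A) = row' i A.
      by apply/row'_eqP => k /negPf ki; rewrite row_setrow ki.
    by rewrite !E lg; ring.
  have [k ik _] := unlift_some ji.
  have E x : row' j (setrow i x A) = setrow k x (row' j A).
    apply/row_matrixP => l; rewrite row_row' !row_setrow ik (inj_eq lift_inj).
    by rewrite row_row'.
  by rewrite !E multilinear_setrow; [ring|case: (ag (row j A))].
split=> //; apply: alternating_adjacent => // A i j ij E.
have jNi : j != i by rewrite -val_eqE/= ij gtn_eqF.
(* The remaining terms keep both equal rows; the terms i and j cancel. *)
rewrite /altsum (bigD1 i)//= (bigD1 j)//= big1 ?addr0.
  have -> : row' j A = row' i A.
    apply/row_matrixP => k; rewrite !row_row'.
    have [ki|ki|ki] := ltngtP k i.
    - congr row; apply: val_inj; rewrite /= /bump ij.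
      by rewrite ![(_ <= k)%N]leqNgt ki (ltn_trans ki).
    - congr row; apply: val_inj; rewrite /= /bump ij.
      by rewrite ki (ltnW ki).
    - have -> : lift j k = i by apply: val_inj; rewrite /= /bump ij ki ltnn.
      have -> : lift i k = j by apply: val_inj; rewrite /= /bump ij ki leqnn.
      by [].
  by rewrite E ij exprS; ring.
move=> k /andP[ki kj].
have [i' ii' _] := unlift_some ki; have [j' jj' _] := unlift_some kj.
have [_ /(_ _ i' j')->] := ag (row k A); rewrite ?mulr0//.
  by rewrite -(inj_eq (@lift_inj _ k)) -ii' -jj' eq_sym.
by rewrite !row_row' -ii' -jj'.
Qed.

Lemma contract_altsum p (g : 'rV[R]_n -> covector R n p.+1) X A :
  Defs.contract X (altsum g) A = g X A - altsum (fun v => Defs.contract X (g v)) A.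
Proof.
rewrite /Defs.contract /altsum big_ord_recl row_col_mx0 row'_col_mx0 expr0 mul1r.
congr (_ + _); rewrite -sumrN; apply: eq_bigr => i _.
by rewrite row_col_mxS row'_col_mxS /bump /= exprS; ring.
Qed.

Lemma contract_alt p X (w : covector R n p.+1) : alt_covector w ->
  alt_covector (Defs.contract X w).
Proof.
move=> [mw aw]; split.
  apply: multilinear_setrowP => i a u v A; rewrite /Defs.contract.
  have E x : col_mx X (setrow i x A) = setrow (lift ord0 i) x (col_mx X A : 'M[R]_(p.+1, n)).
    apply/row_matrixP => k; rewrite row_setrow; case: (unliftP ord0 k) => [k' ->|->].
      by rewrite !row_col_mxS row_setrow (inj_eq lift_inj).
    by rewrite !row_col_mx0.
  by rewrite !E multilinear_setrow.
move=> A i j ij E; apply: (aw _ (lift ord0 i) (lift ord0 j)).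
  by rewrite (inj_eq lift_inj).
by rewrite !row_col_mxS.
Qed.

Lemma contract_linear p (a : R) X Y (w : covector R n p.+1) A : multilinear w ->
  Defs.contract (a *: X + Y) w A = a%:C * Defs.contract X w A + Defs.contract Y w A.
Proof.
move=> mw; rewrite /Defs.contract.
have E x : col_mx x A = setrow ord0 x (col_mx (0 : 'rV[R]_n) A : 'M[R]_(p.+1, n)).
  apply/row_matrixP => k; rewrite row_setrow; case: (unliftP ord0 k) => [k' ->|->].
    by rewrite !row_col_mxS.
  by rewrite row_col_mx0.
by rewrite (E (a *: X + Y)) (E X) (E Y) multilinear_setrow.
Qed.

Lemma contract0 p (w : covector R n p.+1) A : multilinear w ->
  Defs.contract 0 w A = 0.
Proof.
move=> mw; have := contract_linear 1 0 0 A mw; rewrite scaler0 addr0 mul1r => /eqP.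
by rewrite -subr_eq subrr eq_sym => /eqP.
Qed.

Lemma wedgeE p (l : 'cV[R]_n) (w : covector R n p) :
  wedge l w = altsum (fun v A => (pairing l v)%:C * w A).
Proof. by apply/funext => A; apply: eq_bigr => i _; rewrite mulrA. Qed.

Lemma wedge_alt p (l : 'cV[R]_n) (w : covector R n p) : alt_covector w ->
  alt_covector (wedge l w).
Proof.
move=> aw; rewrite wedgeE; apply: altsum_alt => [a u v A|v].
  by rewrite /pairing mulmxDl -scalemxAl !mxE rmorphD rmorphM; ring.
exact: alt_scale.
Qed.

(** The Cartan identity. For [X = sharp l] it says that contraction after
    exterior product and exterior product after contraction add up to |l|^2.
    *)
Lemma contract_wedge p (l : 'cV[R]_n) X (w : covector R n p.+1) A :
  Defs.contract X (wedge l w) A = (pairing l X)%:C * w A - wedge l (Defs.contract X w) A.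
Proof. by rewrite !wedgeE contract_altsum. Qed.

End Multilinear.

(** * Frames, minors and frames adapted to a covector *)

Section Frames.
Context {R : realType} {n : nat}.

(** The increasing multi-indices of length p, encoded as sets of cardinal p.
    *)
Definition psubset p := {S : {set 'I_n} | #|S| == p}.

Definition sidx p (S : psubset p) (i : 'I_p) : 'I_n :=
  enum_val (cast_ord (esym (eqP (valP S))) i).

Lemma sidx_inj p (S : psubset p) : injective (sidx S).
Proof. by move=> i k /enum_val_inj/cast_ord_inj. Qed.

Lemma sidx_in p (S : psubset p) i : sidx S i \in val S.
Proof. exact: enum_valP. Qed.

Lemma sidx_onto p (S : psubset p) j : j \in val S -> exists i, sidx S i = j.
Proof.
move=> jS; exists (cast_ord (eqP (valP S)) (enum_rank_in jS j)).
by rewrite /sidx cast_ordK enum_rankK_in.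
Qed.

Lemma inj_sidx p (f : 'I_p -> 'I_n) : injective f ->
  exists (S : psubset p) (s : 'S_p), forall i, f i = sidx S (s i).
Proof.
move=> inj_f.
have cS : #|f @: [set: 'I_p]%SET| == p by rewrite card_imset// cardsT card_ord.
pose S : psubset p := exist (fun S : {set 'I_n} => #|S| == p) _ cS.
have /choice[g hg] : forall i, exists k, f i = sidx S k.
  move=> i; have [k <-] : exists k, sidx S k = f i; last by exists k.
  by apply: sidx_onto; rewrite /S /=; apply: imset_f; rewrite inE.
have inj_g : injective g by move=> i k gik; apply: inj_f; rewrite !hg gik.
by exists S, (perm inj_g) => i; rewrite permE.
Qed.

(** The values on these tuples of basis vectors are the coordinates of an
    alternating covector with respect to the basis P. *)
Definition frame p (P : 'M[R]_n) (S : psubset p) : 'M[R]_(p, n) := rowsub (sidx S) P.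

Lemma alt_rowsub_frame p (w : covector R n p) P (f : 'I_p -> 'I_n) : alt_covector w ->
  injective f -> exists (S : psubset p) (b : bool),
    (forall i, f i \in val S) /\ w (rowsub f P) = (-1) ^+ b * w (frame P S).
Proof.
move=> aw /inj_sidx[S [s hs]]; exists S, s; split; first by move=> i; rewrite hs sidx_in.
rewrite -alt_row_perm//; congr w; apply/matrixP => i j.
by rewrite !mxE hs.
Qed.

Lemma alt_frame_eq0 p (w : covector R n p) P : P \in unitmx -> alt_covector w ->
  (forall S, w (frame P S) = 0) -> forall A, w A = 0.
Proof.
move=> uP aw h; apply: (alt_zero_basis aw uP) => f /(alt_rowsub_frame P aw)[S [b [_ ->]]].
by rewrite h mulr0.
Qed.

Lemma alt_frame_eq p (v w : covector R n p) P : P \in unitmx ->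
  alt_covector v -> alt_covector w ->
  (forall S, v (frame P S) = w (frame P S)) -> v = w.
Proof.
move=> uP av aw h; apply/funext => A; apply/eqP; rewrite -subr_eq0; apply/eqP.
have := alt_frame_eq0 uP (alt_lin (-1) aw av) _ A; rewrite mulN1r addrC; apply => S.
by rewrite h mulN1r addNr.
Qed.

(** The p-minor with columns S of the coordinates in the basis P: the covector
    dual to [frame P S]. *)
Definition minor p (P : 'M[R]_n) (S : psubset p) : covector R n p :=
  fun A => (\det (colsub (sidx S) (A *m invmx P)))%:C.

Lemma minor_alt p P (S : psubset p) : alt_covector (minor P S).
Proof.
split.
  apply: multilinear_setrowP => i a u v A; rewrite /minor -rmorphM -rmorphD; congr (_%:C).
  rewrite -[X in _ = _ + X]mul1r.
  have E x : row' i (colsub (sidx S) (setrow i x A *m invmx P)) =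
      row' i (colsub (sidx S) (A *m invmx P)).
    apply/row'_eqP => k /negPf ki; apply/rowP => j; rewrite !mxE.
    by apply: eq_bigr => m _; rewrite !mxE ki.
  apply: (@determinant_multilinear _ _ _ _ _ i); rewrite ?E// scale1r.
  apply/rowP => j; rewrite !mxE mulr_sumr -big_split; apply: eq_bigr => m _ /=.
  by rewrite !mxE eqxx; ring.
move=> A i j ij E; rewrite /minor (@determinant_alternate _ _ _ i j)// => k.
rewrite !mxE; apply: eq_bigr => m _; congr (_ * _).
by have /rowP/(_ m) := E; rewrite !mxE.
Qed.

(** If S and T differ, some row of the coordinate matrix vanishes. *)
Lemma minor_frame p P (S T : psubset p) : P \in unitmx ->
  minor P S (frame P T) = (S == T)%:R.
Proof.
move=> uP; rewrite /minor /frame.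
have -> : colsub (sidx S) (rowsub (sidx T) P *m invmx P) =
    \matrix_(i, k) (sidx T i == sidx S k)%:R.
  apply/matrixP => i k; have /matrixP/(_ (sidx T i) (sidx S k)) := mulmxV uP.
  by rewrite !mxE => <-; apply: eq_bigr => m _; rewrite !mxE.
case: eqVneq => [->|ST].
  rewrite (_ : \matrix_(i, k) _ = 1%:M) ?det1//.
  by apply/matrixP => i k; rewrite !mxE (inj_eq (@sidx_inj _ _)).
have [i hi] : exists i, sidx T i \notin val S.
  apply/existsP; rewrite -negb_forall; apply: contra ST => /forallP h.
  rewrite eq_sym -val_eqE eqEcard (eqP (valP S)) (eqP (valP T)) leqnn andbT.
  by apply/fintype.subsetP => x /sidx_onto[i <-].
rewrite (expand_det_row _ i) big1// => k _.
by rewrite mxE; case: eqP hi => [->|_ _]; rewrite ?sidx_in// mul0r.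
Qed.

Lemma card_psubset_out p (j : 'I_n) :
  #|[pred S : psubset p | j \notin val S]| = 'C(n.-1, p).
Proof.
have <- : #|[set~ j]%SET| = n.-1 by rewrite cardsC1 card_ord.
rewrite -cards_draws.
have val_inj' : {in [pred S : psubset p | j \notin val S] &, injective (val : psubset p -> {set 'I_n})}.
  by move=> ? ? _ _; exact: val_inj.
rewrite -(card_in_image val_inj'); apply: eq_card => S.
rewrite !inE; apply/fintype.imageP/andP => [[T jT ->]|[Sj cS]].
  split; last exact: (valP T).
  by apply/fintype.subsetP => x; rewrite !inE; apply: contraTneq => ->.
exists (exist _ S cS) => //; rewrite inE /=; apply/negP => jS.
by move/fintype.subsetP/(_ j jS): Sj; rewrite !inE eqxx.
Qed.

(** The complement of [card_psubset_out], by the Pascal rule. *)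
Lemma card_psubset_in p (j : 'I_n) :
  #|[pred S : psubset p.+1 | j \in val S]| = 'C(n.-1, p).
Proof.
have n0 : (0 < n)%N by case: (n) j => [[]|].
apply/eqP; rewrite -(eqn_add2r 'C(n.-1, p.+1)) -{1}(card_psubset_out p.+1 j).
rewrite addnC [X in _ == X]addnC -binS prednK//.
rewrite addnC (cardC [pred S : psubset p.+1 | j \in val S]) card_sig -[X in 'C(X, _)](card_ord n).
by rewrite -card_draws; apply/eqP/eq_card => S; rewrite !inE.
Qed.

(** The square of the dual norm, as a polynomial in the entries. *)
Definition sqnorm (l : 'cV[R]_n) : R := pairing l (sharp l).

Lemma sqnormE l : sqnorm l = \sum_i l i 0 ^+ 2.
Proof. by rewrite /sqnorm /pairing /sharp mxE; apply: eq_bigr => i _; rewrite mxE. Qed.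

Lemma sqnorm_eq0 l : sqnorm l = 0 -> l = 0.
Proof.
rewrite sqnormE => /eqP; rewrite psumr_eq0 => [/allP h|i _]; last exact: sqr_ge0.
apply/colP => i; rewrite mxE; apply/eqP; rewrite -sqrf_eq0.
exact: h (mem_index_enum _).
Qed.

Lemma sqnorm0 : sqnorm 0 = 0.
Proof. by rewrite /sqnorm /pairing mulmx0 mxE. Qed.

(** In such a basis, exterior product with l and contraction with l^# act on
    the frames by inserting and deleting j. The condition on row j is void for
    l = 0, where both operations are zero and any basis serves. *)
Definition adapted (l : 'cV[R]_n) (P : 'M[R]_n) (j : 'I_n) : Prop :=
  [/\ P \in unitmx, forall i, i != j -> pairing l (row i P) = 0 &
      l <> 0 -> row j P = sharp l].

(** If the entry l_j is not zero, complete l^# by the vectors l_j e_i - l_i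
    e_j, which lie in the kernel of l. *)
Lemma exists_adapted l : (0 < n)%N -> exists P j, adapted l P j.
Proof.
move=> n0; have [->|l0] := eqVneq l 0.
  exists 1%:M, (Ordinal n0); split=> //; first exact: unitmx1.
  by move=> i _; rewrite /pairing mulmx0 mxE.
have [j lj] : exists j, l j 0 != 0.
  apply/existsP; rewrite -negb_forall; apply: contra l0 => /forallP h.
  by apply/eqP/colP => i; rewrite mxE; apply/eqP.
pose P : 'M[R]_n := \matrix_(i, k) if i == j then l k 0
  else (k == i)%:R * l j 0 - (k == j)%:R * l i 0.
have sum_delta (i : 'I_n) (F : 'I_n -> R) : \sum_k (k == i)%:R * F k = F i.
  rewrite (bigD1 i)//= eqxx mul1r big1 ?addr0// => k /negPf ->; exact: mul0r.
have rowj : row j P = sharp l by apply/rowP => k; rewrite !mxE eqxx.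
have rowi i : i != j -> pairing l (row i P) = 0.
  move=> /negPf ij; rewrite /pairing mxE.
  rewrite (eq_bigr (fun k => (k == i)%:R * (l j 0 * l k 0) - (k == j)%:R * (l i 0 * l k 0))).
    by rewrite sumrB !sum_delta; ring.
  by move=> k _; rewrite !mxE ij; ring.
exists P, j; split=> //.
rewrite -row_free_unit; apply: inj_row_free => v vP.
(* Pairing the relation v P = 0 with l leaves v_j |l|^2 = 0; after that,
   column i of the relation reads v_i l_j = 0. *)
have vj : v 0 j = 0.
  have : pairing l (v *m P) = 0 by rewrite vP /pairing mul0mx mxE.
  rewrite mulmx_sum_row /pairing mulmx_suml summxE (bigD1 j)//= big1 ?addr0.
    rewrite -scalemxAl mxE -/(pairing l _) rowj => /eqP.
    by rewrite mulf_eq0 => /orP[/eqP//|/eqP/sqnorm_eq0 lE]; rewrite lE eqxx in l0.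
  by move=> i ij; rewrite -scalemxAl mxE -/(pairing l _) rowi// mulr0.
apply/rowP => i; rewrite [RHS]mxE; have [->//|ij] := eqVneq i j.
have /rowP/(_ i) := vP; rewrite !mxE (bigD1 i)//= big1 ?addr0.
  rewrite !mxE (negPf ij) eqxx mul1r mul0r subr0 => /eqP.
  by rewrite mulf_eq0 (negPf lj) orbF => /eqP.
move=> k ki; rewrite !mxE; case: eqVneq => [->|kj]; first by rewrite vj mul0r.
by rewrite eq_sym (negPf ki) (negPf ij) !mul0r subrr mulr0.
Qed.

Section Adapted.
Context (l : 'cV[R]_n) (P : 'M[R]_n) (j : 'I_n) (ad : adapted l P j).

Let uP : P \in unitmx. Proof. by case: ad. Qed.

Lemma wedge_frame_out p (w : covector R n p) (S : psubset p.+1) :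
  j \notin val S -> wedge l w (frame P S) = 0.
Proof.
move=> jS; apply: big1 => i _; case: ad => _ h _.
have -> : row i (frame P S) = row (sidx S i) P by apply/rowP => k; rewrite !mxE.
rewrite h ?mulr0 ?mul0r//.
by apply: contraNneq jS => <-; exact: sidx_in.
Qed.

(** Only the term deleting the row l^# survives in the exterior product, and
    the contraction puts that row back in front: the two signs cancel. *)
Lemma wedge_contract_frame_in p (w : covector R n p.+1) (S : psubset p.+1) :
  alt_covector w -> j \in val S ->
  wedge l (Defs.contract (sharp l) w) (frame P S) = (sqnorm l)%:C * w (frame P S).
Proof.
move=> aw jS; have [l0|/eqP l0] := eqVneq l 0.
  rewrite l0 sqnorm0 mul0r; apply: big1 => i _.
  by rewrite /pairing mulmx0 mxE mulr0 mul0r.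
case: ad => _ h /(_ l0) rj; have [i ij] := sidx_onto jS.
have rowE k : row k (frame P S) = row (sidx S k) P by apply/rowP => m; rewrite !mxE.
rewrite /wedge (bigD1 i)//= big1 ?addr0.
  rewrite /Defs.contract rowE ij rj -/(sqnorm l) -rj -ij -rowE alt_front//.
  by rewrite mulrACA -expr2 sqrr_sign mul1r.
move=> k ki; rewrite rowE h ?mulr0 ?mul0r//.
by rewrite -ij (inj_eq (@sidx_inj _ S)).
Qed.

(** The complement of [wedge_frame_out] and [wedge_contract_frame_in], by the
    Cartan identity. *)
Lemma contract_wedge_frame p (w : covector R n p.+1) (S : psubset p.+1) :
  alt_covector w ->
  Defs.contract (sharp l) (wedge l w) (frame P S) =
    (if j \in val S then 0 else (sqnorm l)%:C * w (frame P S)).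
Proof.
move=> aw; rewrite contract_wedge -/(sqnorm l); case: ifPn => jS.
  by rewrite wedge_contract_frame_in// subrr.
by rewrite wedge_frame_out// subr0.
Qed.

Lemma contract_eq0_frame p (w : covector R n p.+1) (S : psubset p.+1) : l <> 0 ->
  alt_covector w -> Defs.contract (sharp l) w = 0 -> j \in val S -> w (frame P S) = 0.
Proof.
move=> l0 aw h jS; case: ad => _ _ /(_ l0) rj; have [i ij] := sidx_onto jS.
have : w (col_mx (row i (frame P S)) (row' i (frame P S))) = 0.
  have -> : row i (frame P S) = sharp l by rewrite -rj -ij; apply/rowP => m; rewrite !mxE.
  by have /(congr1 (fun f => f (row' i (frame P S)))) := h.
rewrite alt_front// => /eqP; rewrite mulf_eq0 signr_eq0 => /eqP//.
Qed.

(** The contraction evaluates w on tuples that start with l^#, which are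
    frames through j up to order. *)
Lemma frame_contract_eq0 p (w : covector R n p.+1) : alt_covector w ->
  (forall S : psubset p.+1, j \in val S -> w (frame P S) = 0) ->
  Defs.contract (sharp l) w = 0.
Proof.
move=> aw h; have [l0|/eqP l0] := eqVneq l 0.
  by apply/funext => A; rewrite l0 /sharp trmx0 contract0//; case: aw.
case: ad => _ _ /(_ l0) rj.
apply/funext; apply: (alt_zero_basis (contract_alt _ aw) uP) => f inj_f.
rewrite /Defs.contract -rj.
pose g (i : 'I_p.+1) := if unlift ord0 i is Some k then f k else j.
have -> : col_mx (row j P) (rowsub f P) = rowsub g P.
  apply/row_matrixP => k; case: (unliftP ord0 k) => [k' ->|->].
    by rewrite row_col_mxS; apply/rowP => m; rewrite !mxE /g liftK.
  by rewrite row_col_mx0; apply/rowP => m; rewrite !mxE /g unlift_none.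
have [/injectiveP inj_g|/injectivePn[i [k ik gik]]] := boolP (injectiveb g).
  have [S [b [hS ->]]] := alt_rowsub_frame P aw inj_g.
  by rewrite h ?mulr0//; have := hS ord0; rewrite /g unlift_none.
by apply: (proj2 aw _ i k ik); apply/rowP => m; rewrite !mxE gik.
Qed.

(** An explicit preimage: l wedge (l^# _| w) is |l|^2 w, since w is carried by
    the frames through j. *)
Lemma frame_wedge p (w : covector R n p.+1) : l <> 0 -> alt_covector w ->
  (forall S : psubset p.+1, j \notin val S -> w (frame P S) = 0) ->
  w = wedge l (fun A => (sqnorm l)^-1%:C * Defs.contract (sharp l) w A).
Proof.
move=> l0 aw h.
have n0 : sqnorm l != 0 by apply/eqP => /sqnorm_eq0.
have E : wedge l (fun A => (sqnorm l)^-1%:C * Defs.contract (sharp l) w A) =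
    fun A => (sqnorm l)^-1%:C * wedge l (Defs.contract (sharp l) w) A.
  apply/funext => A; rewrite /wedge mulr_sumr.
  by apply: eq_bigr => i _; rewrite mulrCA mulrA.
have aE := alt_scale (sqnorm l)^-1%:C (wedge_alt l (contract_alt (sharp l) aw)).
rewrite E; apply: (alt_frame_eq uP aw aE) => S.
have [jS|jS] := boolP (j \in val S); last by rewrite h// wedge_frame_out// mulr0.
by rewrite wedge_contract_frame_in// mulrA -rmorphM mulVf// mul1r.
Qed.

End Adapted.
End Frames.

(** * The codifferential and the Fourier coefficients of forms *)

Section Codifferential.
Context {R : realType} {n : nat} (B : 'M[R]_n) (hB : B \in unitmx).
Local Notation T := (torus_integral B).
Local Notation e j := (row j (1%:M : 'M[R]_n)).

Lemma sum_e (v : 'rV[R]_n) : v = \sum_j v 0 j *: e j.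
Proof. by rewrite -mulmx_sum_row mulmx1. Qed.

Lemma cderive_periodic v (f : 'rV[R]_n -> R[i]) :
  lperiodic B f -> lperiodic B (cderive v f).
Proof.
move=> pf u x hu.
have shift (g : 'rV[R]_n -> R) : (forall y, g (y + u) = g y) -> 'D_v g (x + u) = 'D_v g x.
  move=> pg; have H (h : R) : g (h *: v + (x + u)) = g (h *: v + x) by rewrite addrA pg.
  by have [] := derive_along H.
by apply: eq_complexP; apply: shift => y; rewrite pf.
Qed.

Lemma Omega_smooth p (w : covfield R n p) A : Omega B w -> smooth (fun x => w x A).
Proof. by case. Qed.

Lemma Omega_periodic p (w : covfield R n p) A : Omega B w -> lperiodic B (fun x => w x A).
Proof. by case=> _ _ pw v x hv; rewrite pw. Qed.

Lemma Omega_lin p (a : R[i]) (v w : covfield R n p) : Omega B v -> Omega B w ->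
  Omega B (fun x A => a * v x A + w x A).
Proof.
move=> [av sv pv] [aw sw pw]; split.
- by move=> x; exact: alt_lin.
- by move=> A; exact: smooth_lin.
- by move=> u x hu; rewrite pv// pw.
Qed.

Lemma Omega_scale p (a : R[i]) (w : covfield R n p) : Omega B w ->
  Omega B (fun x A => a * w x A).
Proof.
move=> [aw sw pw]; split=> [x|A|v x hv].
- exact: alt_scale.
- exact: smoothZ.
- by rewrite pw.
Qed.

Lemma cderive_alt p (w : covfield R n p) v x : Omega B w ->
  alt_covector (fun A => cderive v (fun y => w y A) x).
Proof.
move=> hw; have [aw sw _] := hw; split.
  move=> i a A A1 A2 E E1 E2.
  under eq_fun => y do rewrite (proj1 (aw y) i a A A1 A2 E E1 E2).
  by rewrite cderiveD ?cderiveZ//; exact: smoothZ.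
move=> A i j ij E.
under eq_fun => y do rewrite (proj2 (aw y) A i j ij E).
exact: cderive_cst.
Qed.

Lemma ext_dE p (w : covfield R n p) x :
  ext_d w x = altsum (fun v A => cderive v (fun y => w y A) x).
Proof. by []. Qed.

Lemma ext_d_Omega p (w : covfield R n p) : Omega B w -> Omega B (ext_d w).
Proof.
move=> hw; split.
- move=> x; rewrite ext_dE; apply: altsum_alt => [a u v A|v].
    by rewrite cderive_linear_dir//; exact: Omega_smooth hw.
  exact: cderive_alt.
- move=> A; apply: smooth_sum => i; apply: smoothZ.
  exact/smooth_cderive/Omega_smooth.
- move=> v x hv; apply/funext => A; apply: eq_bigr => i _; congr (_ * _).
  exact: (cderive_periodic _ (Omega_periodic _ hw)).
Qed.

(** The classical formula - sum_j e_j _| D_j w for the codifferential on flat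
    space. *)
Definition divergence p (w : covfield R n p.+1) : covfield R n p :=
  fun x A => - \sum_j cderive (e j) (fun y => w y (col_mx (e j) A)) x.

Lemma divergence_Omega p (w : covfield R n p.+1) : Omega B w -> Omega B (divergence w).
Proof.
move=> hw; split.
- move=> x.
  rewrite (_ : divergence w x = fun A => (-1) * (\sum_j
    Defs.contract (e j) (fun A => cderive (e j) (fun y => w y A) x) A)).
    apply: (@alt_scale R n p (-1) (fun A => \sum_j _)).
    by apply: alt_sum => j; apply: contract_alt (cderive_alt _ _ hw).
  by apply/funext => A; rewrite mulN1r.
- move=> A; under eq_fun do rewrite /divergence -mulN1r.
  apply: smoothZ; apply: smooth_sum => j.
  exact/smooth_cderive/Omega_smooth.
- move=> v x hv; apply/funext => A; congr (- _); apply: eq_bigr => j _.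
  exact: (cderive_periodic _ (Omega_periodic _ hw)).
Qed.

(** Reinserts at i an entry split off a multi-index; the bijection behind
    [sum_insert]. *)
Definition insert_ffun p (i : 'I_p.+1) (jg : 'I_n * {ffun 'I_p -> 'I_n}) :
    {ffun 'I_p.+1 -> 'I_n} :=
  [ffun k => if unlift i k is Some k' then jg.2 k' else jg.1].

Lemma sum_insert p (i : 'I_p.+1) (G : {ffun 'I_p.+1 -> 'I_n} -> R[i]) :
  \sum_f G f = \sum_j \sum_g G (insert_ffun i (j, g)).
Proof.
rewrite pair_big; apply: (reindex (@insert_ffun p i)) => /=.
exists (fun f : {ffun 'I_p.+1 -> 'I_n} => (f i, [ffun k => f (lift i k)])).
  move=> [j g] _; rewrite /insert_ffun ffunE unlift_none; congr (_, _).
  by apply/ffunP => k; rewrite !ffunE liftK.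
move=> f _; apply/ffunP => k; rewrite ffunE /=.
by case: unliftP => [k' ->|->//]; rewrite ffunE.
Qed.

Local Notation E f := (rowsub f (1%:M : 'M[R]_n)).

(** Moving the i-th index to the front cancels the sign in [ext_d], so that
    its p+1 terms contribute equally; the factor p+1 turns the normalization
    1/(p+1)! into 1/p!. *)
Lemma inner_ext_d p (v : covfield R n p) (w : covfield R n p.+1) x :
  alt_covector (w x) ->
  inner (ext_d v x) (w x) = (p`!%:R)^-1 * \sum_j \sum_(g : {ffun 'I_p -> 'I_n})
    cderive (e j) (fun y => v y (E g)) x * (w x (col_mx (e j) (E g)))^*.
Proof.
move=> aw; rewrite /inner /ext_d.
under eq_bigr do rewrite mulr_suml.
rewrite exchange_big /=.
have term (i : 'I_p.+1) : \sum_(f : {ffun 'I_p.+1 -> 'I_n})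
    (-1) ^+ i * cderive (row i (E f)) (fun y => v y (row' i (E f))) x * (w x (E f))^* =
  \sum_j \sum_(g : {ffun 'I_p -> 'I_n})
    cderive (e j) (fun y => v y (E g)) x * (w x (col_mx (e j) (E g)))^*.
  rewrite (sum_insert i); apply: eq_bigr => j _; apply: eq_bigr => g _.
  set f := insert_ffun i (j, g).
  have r1 : row i (E f) = e j.
    by apply/rowP => k; rewrite !mxE /f /insert_ffun ffunE unlift_none.
  have r2 : row' i (E f) = E g.
    by apply/matrixP => k m; rewrite !mxE /f /insert_ffun ffunE liftK.
  have -> : w x (E f) = (-1) ^+ i * w x (col_mx (e j) (E g)).
    by rewrite -r1 -r2 alt_front// mulrA -expr2 sqrr_sign mul1r.
  rewrite r1 r2 cconjM (_ : ((-1) ^+ i)^* = (-1) ^+ i); last first.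
    by rewrite rmorph_sign.
  by rewrite mulrACA -expr2 sqrr_sign mul1r.
under eq_bigr do rewrite term.
have sum_const (c : R[i]) : \sum_(i < p.+1) c = p.+1%:R * c.
  by rewrite sumr_const card_ord mulr_natl.
rewrite sum_const mulrA; congr (_ * _).
by rewrite factS natrM invfM mulrC mulrA mulfV ?mul1r// pnatr_eq0.
Qed.

Lemma ccont_coef p (w : covfield R n p) A : Omega B w -> ccont (fun x => w x A).
Proof. by move=> hw; apply: smooth_ccont; exact: Omega_smooth. Qed.

Lemma smooth_coefD p (w : covfield R n p) A v : Omega B w ->
  smooth (cderive v (fun x => w x A)).
Proof. by move=> hw; apply: smooth_cderive; exact: Omega_smooth. Qed.

(** Integration by parts in each term of [inner_ext_d]. *)
Lemma divergence_adjoint p (v : covfield R n p) (w : covfield R n p.+1) :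
  Omega B v -> Omega B w -> L2_inner B (ext_d v) w = L2_inner B v (divergence w).
Proof.
move=> hv hw; rewrite /L2_inner.
have sJ A : smooth (fun x => (w x A)^*) by apply: smoothJ; exact: Omega_smooth.
have cL j (g : {ffun 'I_p -> 'I_n}) : ccont (fun x =>
    cderive (e j) (fun y => v y (E g)) x * (w x (col_mx (e j) (E g)))^*).
  by apply: ccontM; apply: smooth_ccont => //; exact: smooth_coefD.
have cR j (g : {ffun 'I_p -> 'I_n}) : ccont (fun x =>
    v x (E g) * cderive (e j) (fun y => (w y (col_mx (e j) (E g)))^*) x).
  by apply: ccontM; [exact: ccont_coef|exact/smooth_ccont/smooth_cderive].
transitivity (\sum_j \sum_(g : {ffun 'I_p -> 'I_n}) (p`!%:R)^-1 *
    T (fun x => cderive (e j) (fun y => v y (E g)) x * (w x (col_mx (e j) (E g)))^*)).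
  under eq_fun => x do rewrite (inner_ext_d v (let: And3 aw _ _ := hw in aw x)).
  rewrite torus_integralZ; last by apply: ccont_sum => j; apply: ccont_sum => g.
  rewrite torus_integral_sum; last by move=> j; apply: ccont_sum => g.
  rewrite mulr_sumr; apply: eq_bigr => j _.
  by rewrite torus_integral_sum// mulr_sumr.
transitivity (\sum_j \sum_(g : {ffun 'I_p -> 'I_n}) (- (p`!%:R)^-1) *
    T (fun x => v x (E g) * cderive (e j) (fun y => (w y (col_mx (e j) (E g)))^*) x)).
  apply: eq_bigr => j _; apply: eq_bigr => g _.
  rewrite torus_integral_by_parts ?mulrN ?mulNr//; try exact: Omega_smooth.
    exact: Omega_periodic.
  by move=> u x hu /=; have := Omega_periodic (col_mx (e j) (E g)) hw x hu => /= ->.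
have -> : (fun x => inner (v x) (divergence w x)) = fun x => - (p`!%:R)^-1 *
    \sum_j \sum_(g : {ffun 'I_p -> 'I_n})
      v x (E g) * cderive (e j) (fun y => (w y (col_mx (e j) (E g)))^*) x.
  apply/funext => x; rewrite /inner mulNr -mulrN exchange_big -sumrN; congr (_ * _).
  apply: eq_bigr => g _; rewrite -mulr_sumr -mulrN; congr (_ * _).
  rewrite /divergence rmorphN rmorph_sum; congr (- _); apply: eq_bigr => j _.
  by rewrite /= cderiveJ//; exact: Omega_smooth.
rewrite torus_integralZ; last by apply: ccont_sum => j; apply: ccont_sum => g.
rewrite torus_integral_sum; last by move=> j; apply: ccont_sum => g.
rewrite mulr_sumr; apply: eq_bigr => j _.
by rewrite torus_integral_sum// mulr_sumr.
Qed.

Lemma L2_inner_subr p (v u u' : covfield R n p) : Omega B v -> Omega B u -> Omega B u' ->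
  L2_inner B v (fun x A => (-1) * u' x A + u x A) = L2_inner B v u - L2_inner B v u'.
Proof.
move=> hv hu hu'; rewrite /L2_inner.
have cc (a b : covfield R n p) : Omega B a -> Omega B b -> ccont (fun x => inner (a x) (b x)).
  move=> ha hb; apply: ccontM; first exact: ccont_cst.
  by apply: ccont_sum => f; apply: ccontM; [|apply: ccontJ]; exact: ccont_coef.
rewrite [RHS]addrC -[- T _]mulN1r -torus_integral_lin; [|exact: cc..].
congr torus_integral; apply/funext => x; rewrite /inner mulrCA -mulrDr; congr (_ * _).
rewrite mulr_sumr -big_split; apply: eq_bigr => f _ /=.
by rewrite !mulN1r rmorphD rmorphN; ring.
Qed.

Lemma L2_inner_nondegenerate p (u : covfield R n p) : Omega B u ->
  L2_inner B u u = 0 -> u = fun _ _ => 0.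
Proof.
move=> hu; rewrite /L2_inner torus_integralZ; last first.
  by apply: ccont_sum => f; apply: ccontM; [|apply: ccontJ]; exact: ccont_coef.
move=> /eqP; rewrite mulf_eq0 invr_eq0 pnatr_eq0 gtn_eqF ?fact_gt0//= => /eqP.
rewrite torus_integral_sum; last first.
  by move=> f; apply: ccontM; [|apply: ccontJ]; exact: ccont_coef.
move=> /(congr1 (@complex.Re R)); rewrite raddf_sum => /eqP.
rewrite psumr_eq0 => [/allP h|f _]; last first.
  by apply: torus_integral_sqr_ge0; exact: ccont_coef.
have [au _ _] := hu.
apply/funext => x; apply/funext; apply: (alt_zero_basis (au x) (unitmx1 _ _)) => f _.
have /eqP/torus_integral_sqr_eq0 := h [ffun i => f i] (mem_index_enum _).
move=> /(_ hB (ccont_coef _ hu) (Omega_periodic _ hu)) /(congr1 (fun g => g x)) <-.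
by congr (u x _); apply/matrixP => i j; rewrite !mxE ffunE.
Qed.

(** An adjoint exists, by [divergence_adjoint]. The difference of two adjoints
    is orthogonal to all forms, in particular to itself. *)
Lemma codiffE p (w : covfield R n p.+1) : Omega B w -> codiff B w = divergence w.
Proof.
move=> hw.
have adj : formal_adjoint_at B w (divergence w).
  by split; [exact: divergence_Omega|move=> v hv; exact: divergence_adjoint].
have [hc hadj] : formal_adjoint_at B w (codiff B w) by apply: xgetPex; exists (divergence w).
pose D : covfield R n p := fun x A => (-1) * divergence w x A + codiff B w x A.
have hD : Omega B D by apply: Omega_lin => //; exact: divergence_Omega.
have := L2_inner_nondegenerate hD.
rewrite L2_inner_subr//; last exact: divergence_Omega.
rewrite -hadj// divergence_adjoint// subrr => /(_ erefl) D0.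
apply/funext => x; apply/funext => A; have /(congr1 (fun g => g x A)) := D0.
by rewrite /D mulN1r addrC => /eqP; rewrite subr_eq0 => /eqP.
Qed.

End Codifferential.

Section Fourier.
Context {R : realType} {n : nat} (B : 'M[R]_n) (hB : B \in unitmx).
Local Notation T := (torus_integral B).
Local Notation e j := (row j (1%:M : 'M[R]_n)).

Definition wave p (l : 'cV[R]_n) (c : covector R n p) : covfield R n p :=
  fun x A => chi l x * c A.

Lemma wave_Omega p l (c : covector R n p) : dual_lattice B l -> alt_covector c ->
  Omega B (wave l c).
Proof.
move=> hl ac; split.
- by move=> x; exact: alt_scale.
- move=> A; apply: smoothM; [exact: smooth_chi|exact: smooth_cst].
- by move=> v x hv; apply/funext => A; rewrite /wave (chi_periodic hl).
Qed.

(** The factor produced by differentiating a character. *)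
Definition tau : R[i] := (2 * pi)%:C * 'i%C.

Lemma contract_sum p (v : 'rV[R]_n) (w : covector R n p.+1) A : multilinear w ->
  Defs.contract v w A = \sum_j (v 0 j)%:C * Defs.contract (e j) w A.
Proof.
move=> mw; rewrite {1}(sum_e v); elim: (index_enum _) => [|j r IH].
  by rewrite !big_nil contract0.
by rewrite !big_cons contract_linear// IH.
Qed.

Lemma pairing_e l j : pairing l (e j) = l j 0.
Proof. by rewrite /pairing -row_mul mul1mx mxE. Qed.

(** Not divided by the volume of the torus: the relations below are
    homogeneous. *)
Definition fcoef p (w : covfield R n p) (l : 'cV[R]_n) : covector R n p :=
  fun A => T (fun x => w x A * (chi l x)^*).

Lemma ccont_fcoef p (w : covfield R n p) l A : Omega B w ->
  ccont (fun x => w x A * (chi l x)^*).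
Proof.
move=> hw; apply: ccontM; first exact: (ccont_coef _ hw).
exact/ccontJ/smooth_ccont/smooth_chi.
Qed.

Lemma fcoef_lin p (a : R[i]) (v w : covfield R n p) l A : Omega B v -> Omega B w ->
  fcoef (fun x A => a * v x A + w x A) l A = a * fcoef v l A + fcoef w l A.
Proof.
move=> hv hw; rewrite -torus_integral_lin; [|exact: ccont_fcoef..].
by congr torus_integral; apply/funext => x; ring.
Qed.

Lemma fcoef_scale p (a : R[i]) (w : covfield R n p) l A : Omega B w ->
  fcoef (fun x A => a * w x A) l A = a * fcoef w l A.
Proof.
move=> hw; rewrite /fcoef -torus_integralZ; last exact: (ccont_fcoef l A hw).
by congr torus_integral; apply/funext => x; rewrite mulrA.
Qed.

Lemma fcoef_alt p (w : covfield R n p) l : Omega B w -> alt_covector (fcoef w l).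
Proof.
move=> hw; have [aw _ _] := hw; split.
  move=> i a A A1 A2 E E1 E2; rewrite -torus_integral_lin; [|exact: ccont_fcoef..].
  congr torus_integral; apply/funext => x.
  by rewrite (proj1 (aw x) i a A A1 A2 E E1 E2); ring.
move=> A i j ij E; rewrite /fcoef (_ : (fun x => _) = fun=> 0).
  by rewrite torus_integral_cst mulr0.
by apply/funext => x; rewrite (proj2 (aw x) A i j ij E) mul0r.
Qed.

(** Integration by parts moves the derivative to the conjugate character. *)
Lemma fcoef_cderive p (w : covfield R n p) l v A : Omega B w -> dual_lattice B l ->
  T (fun x => cderive v (fun y => w y A) x * (chi l x)^*) =
  tau * ((pairing l v)%:C * fcoef w l A).
Proof.
move=> hw hl; have sw := Omega_smooth A hw; have sc := smooth_chi l.
rewrite torus_integral_by_parts//; last 3 first.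
- exact: smoothJ.
- exact: (Omega_periodic _ hw).
- by move=> u x hu; rewrite (chi_periodic hl).
rewrite (_ : (fun x => _) = fun x => (- (tau * (pairing l v)%:C)) * (w x A * (chi l x)^*)).
  by rewrite torus_integralZ; [rewrite mulNr opprK mulrA|exact: ccont_fcoef].
apply/funext => x; rewrite cderiveJ// cderive_chi.
apply: eq_complexP; rewrite /tau; case: (w x A) => a b; case: (chi l x) => c d /=; ring.
Qed.

Lemma fcoef_ext_d p (w : covfield R n p) l : Omega B w -> dual_lattice B l ->
  forall A, fcoef (ext_d w) l A = tau * wedge l (fcoef w l) A.
Proof.
move=> hw hl A; rewrite /fcoef.
have cc (i : 'I_p.+1) : ccont (fun x =>
    cderive (row i A) (fun y => w y (row' i A)) x * (chi l x)^*).
  apply: ccontM; first exact/smooth_ccont/(smooth_coefD _ _ hw).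
  exact/ccontJ/smooth_ccont/smooth_chi.
rewrite (_ : (fun x => _) = fun x => \sum_(i < p.+1) (-1) ^+ i *
    (cderive (row i A) (fun y => w y (row' i A)) x * (chi l x)^*)); last first.
  by apply/funext => x; rewrite /ext_d mulr_suml; apply: eq_bigr => i _; rewrite mulrA.
rewrite torus_integral_sum; last by move=> i; apply: ccontM (ccont_cst _) _.
rewrite /wedge mulr_sumr; apply: eq_bigr => i _.
by rewrite torus_integralZ// fcoef_cderive// /fcoef; ring.
Qed.

Lemma fcoef_divergence p (w : covfield R n p.+1) l : Omega B w -> dual_lattice B l ->
  forall A, fcoef (divergence w) l A = - tau * Defs.contract (sharp l) (fcoef w l) A.
Proof.
move=> hw hl A; rewrite /fcoef.
have cc j : ccont (fun x =>
    cderive (e j) (fun y => w y (col_mx (e j) A)) x * (chi l x)^*).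
  apply: ccontM; first exact/smooth_ccont/(smooth_coefD _ _ hw).
  exact/ccontJ/smooth_ccont/smooth_chi.
rewrite (_ : (fun x => _) = fun x => (-1) * \sum_j
    cderive (e j) (fun y => w y (col_mx (e j) A)) x * (chi l x)^*); last first.
  by apply/funext => x; rewrite /divergence mulN1r mulNr mulr_suml.
rewrite torus_integralZ; last exact: ccont_sum.
rewrite torus_integral_sum// contract_sum; last by case: (fcoef_alt l hw).
rewrite mulN1r mulNr; congr (- _); rewrite mulr_sumr; apply: eq_bigr => j _.
by rewrite fcoef_cderive// pairing_e /sharp mxE /Defs.contract /fcoef; ring.
Qed.

(** The derivative of [chi l] along l^# is a nonzero multiple of [chi l], and
    its integral vanishes. *)
Lemma integral_chi l : dual_lattice B l -> l <> 0 -> T (chi l) = 0.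
Proof.
move=> hl l0; have h := torus_integral_cderive hB (sharp l) (smooth_chi l) (chi_periodic hl).
have : T (fun x => (tau * (sqnorm l)%:C) * chi l x) = 0.
  rewrite -[RHS]h; congr torus_integral; apply/funext => x.
  by rewrite cderive_chi -/(sqnorm l) /tau !rmorphM; ring.
rewrite torus_integralZ; last exact/smooth_ccont/smooth_chi.
move=> /eqP; rewrite mulf_eq0 => /orP[|/eqP//]; rewrite mulf_eq0 /tau.
have pi0 : 2 * pi != 0 :> R by rewrite mulf_neq0 ?pnatr_eq0// gt_eqF// pi_gt0.
rewrite mulf_eq0 => /orP[/orP[]|]; rewrite ?fmorph_eq0 ?(negPf pi0)//.
  by rewrite eq_complex /= oner_eq0 andbF.
by move=> /eqP/sqnorm_eq0.
Qed.

Lemma fcoef_wave p l k (c : covector R n p) A : dual_lattice B l -> dual_lattice B k ->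
  fcoef (wave l c) k A = if l == k then `|\det B|%:C * c A else 0.
Proof.
move=> hl hk; rewrite /fcoef.
rewrite (_ : (fun x => _) = fun x => c A * chi (l - k) x); last first.
  by apply/funext => x; rewrite chiD chiN /wave; ring.
rewrite torus_integralZ; last exact/smooth_ccont/smooth_chi.
case: eqVneq => [->|lk].
  rewrite (_ : chi (k - k) = fun=> 1); last by apply/funext => x; rewrite subrr chi0.
  by rewrite torus_integral_cst mulr1 mulrC.
rewrite integral_chi ?mulr0//; first by apply: dual_latticeD => //; exact: dual_latticeN.
by apply/eqP; rewrite subr_eq0.
Qed.

Lemma fcoef_inj p (w : covfield R n p) : Omega B w ->
  (forall l, dual_lattice B l -> fcoef w l = fun=> 0) -> w = fun _ _ => 0.
Proof.
move=> hw h; apply/funext => x; apply/funext => A.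
have := @fourier_unique R n B hB (fun x => w x A) (ccont_coef _ hw) (Omega_periodic _ hw).
move=> /(_ _)/(congr1 (fun g => g x)); apply => l hl.
exact: (congr1 (fun g => g A) (h l hl)).
Qed.

Lemma fcoef_eq p (v w : covfield R n p) : Omega B v -> Omega B w ->
  (forall l, dual_lattice B l -> forall A, fcoef v l A = fcoef w l A) -> v = w.
Proof.
move=> hv hw h.
have D0 : (fun x A => (-1) * w x A + v x A) = fun _ _ => 0.
  apply: (fcoef_inj (Omega_lin (-1) hw hv)) => l hl; apply/funext => A.
  by rewrite (fcoef_lin _ _ _ hw hv) h// mulN1r addNr.
apply/funext => x; apply/funext => A; have := congr1 (fun g => g x A) D0.
by rewrite /= mulN1r addrC => /eqP; rewrite subr_eq0 => /eqP.
Qed.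

End Fourier.

(** * The dual norm and the operator on Fourier coefficients *)

Section DualNorm.
Context {R : realType} {n : nat}.
Implicit Types (l : 'cV[R]_n) (x : 'rV[R]_n).

Lemma sqnorm_ge0 l : 0 <= sqnorm l.
Proof. by rewrite sqnormE; apply: sumr_ge0 => i _; exact: sqr_ge0. Qed.

Lemma pairingE l x : pairing l x = \sum_i x 0 i * l i 0.
Proof. by rewrite /pairing mxE. Qed.

(** The Cauchy-Schwarz inequality, from the squared distance of x to the unit
    vector l^# / |l|. *)
Lemma pairing_le_norm l x : euclid_norm x <= 1 -> pairing l x <= Num.sqrt (sqnorm l).
Proof.
move=> x1; have x2 : \sum_i x 0 i ^+ 2 <= 1.
  have h0 : 0 <= \sum_i x 0 i ^+ 2 by apply: sumr_ge0 => i _; exact: sqr_ge0.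
  by rewrite -(sqr_sqrtr h0) -[leRHS](expr1n _ 2) lerXn2r ?nnegrE ?sqrtr_ge0.
have [l0|l0] := eqVneq (sqnorm l) 0.
  by rewrite (sqnorm_eq0 l0) /pairing mulmx0 mxE sqrtr_ge0.
have N0 : 0 < Num.sqrt (sqnorm l) by rewrite sqrtr_gt0 lt_def l0 sqnorm_ge0.
set N := Num.sqrt _ in N0 *.
have N2 : N ^+ 2 = sqnorm l by rewrite sqr_sqrtr// sqnorm_ge0.
have : 0 <= \sum_i (N^-1 * l i 0 - x 0 i) ^+ 2 by apply: sumr_ge0 => i _; exact: sqr_ge0.
have -> : \sum_i (N^-1 * l i 0 - x 0 i) ^+ 2 =
    N^-2 * sqnorm l - 2 * N^-1 * pairing l x + \sum_i x 0 i ^+ 2.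
  rewrite sqnormE pairingE !mulr_sumr -sumrB -big_split; apply: eq_bigr => i _ /=.
  by field; rewrite gt_eqF.
rewrite -N2 mulVf ?expf_neq0 ?gt_eqF// => h.
have : N^-1 * pairing l x <= 1 by move: (N^-1 * _) (mulrA 2 N^-1 (pairing l x)) h => y <-; lra.
by rewrite ler_pdivrMl// mulr1.
Qed.

(** The supremum is attained at l^# / |l|. *)
Lemma dual_normE l : dual_norm l = Num.sqrt (sqnorm l).
Proof.
have ub : ubound [set `|pairing l x| | x in [set x | euclid_norm x <= 1]] (Num.sqrt (sqnorm l)).
  move=> _ [x /= x1 <-]; rewrite ler_norml pairing_le_norm// andbT lerNl.
  have -> : - pairing l x = pairing l (- x) by rewrite /pairing mulNmx [RHS]mxE.
  apply: pairing_le_norm; rewrite (le_trans _ x1)// /euclid_norm ler_wsqrtr//.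
  by apply: ler_sum => i _; rewrite mxE sqrrN.
apply/eqP; rewrite eq_le; apply/andP; split.
  apply: ge_sup => //; exists `|pairing l 0|; exists 0 => //=.
  by rewrite /euclid_norm big1 ?sqrtr0// => i _; rewrite mxE expr0n.
apply: ub_le_sup; first by exists (Num.sqrt (sqnorm l)).
have [l0|l0] := eqVneq (sqnorm l) 0.
  exists 0; rewrite /=; last by rewrite l0 sqrtr0 /pairing mul0mx mxE normr0.
  by rewrite /euclid_norm big1 ?sqrtr0// => i _; rewrite mxE expr0n.
have N0 : 0 < Num.sqrt (sqnorm l) by rewrite sqrtr_gt0 lt_def l0 sqnorm_ge0.
have N2 : Num.sqrt (sqnorm l) ^+ 2 = sqnorm l by rewrite sqr_sqrtr// sqnorm_ge0.
set N := Num.sqrt _ in N0 N2 *.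
exists (N^-1 *: sharp l) => /=.
  rewrite /euclid_norm (_ : \sum_i _ = 1) ?sqrtr1//.
  under eq_bigr => i _ do rewrite !mxE exprMn.
  by rewrite -mulr_sumr -sqnormE -N2 exprVn mulVf// expf_neq0// gt_eqF.
by rewrite pairingZ -/(sqnorm l) -N2 expr2 mulKf ?gt_eqF// gtr0_norm.
Qed.

Lemma dual_norm_ge0 l : 0 <= dual_norm l.
Proof. by rewrite dual_normE sqrtr_ge0. Qed.

Lemma lambdaE gamma l : lambda gamma l = 4 * pi ^+ 2 * gamma * sqnorm l.
Proof. by rewrite /lambda dual_normE sqr_sqrtr// sqnorm_ge0. Qed.

Lemma lambda_eq gamma gamma' l (k : 'cV[R]_n) : 0 < gamma -> 0 < gamma' ->
  lambda gamma l = lambda gamma' k <-> dual_norm l = Num.sqrt (gamma' / gamma) * dual_norm k.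
Proof.
move=> g0 g0'; have pi0 : 4 * pi ^+ 2 != 0 :> R.
  by rewrite mulf_neq0 ?pnatr_eq0// expf_neq0// gt_eqF// pi_gt0.
have d0 : 0 <= gamma' / gamma by rewrite ltW// divr_gt0.
have q : (Num.sqrt (gamma' / gamma) * dual_norm k) ^+ 2 = gamma' / gamma * dual_norm k ^+ 2.
  by rewrite exprMn sqr_sqrtr.
split=> h.
  apply: (@pexpIrn _ 2) => //; rewrite ?nnegrE ?mulr_ge0 ?sqrtr_ge0 ?dual_norm_ge0// q.
  move: h; rewrite /lambda -(mulrA (4 * pi ^+ 2)) -[RHS]mulrA => /(mulfI pi0) h.
  apply: (mulfI (_ : gamma != 0)); first by rewrite gt_eqF.
  by rewrite h; field; rewrite gt_eqF.
rewrite /lambda h q; field; exact: lt0r_neq0.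
Qed.

(** An element l of the dual lattice is determined by the integers [B *m l],
    its values on the lattice basis, and these are bounded on a ball. *)
Lemma finite_dual_ball (B : 'M[R]_n) (M : R) : B \in unitmx ->
  finite_set [set l | dual_lattice B l /\ sqnorm l <= M].
Proof.
move=> uB; pose K : R := (M + 1) * \sum_i \sum_k `|B i k|.
pose N := Num.bound K.
(* The integers of absolute value at most N, shifted to be indices. *)
pose F (f : {ffun 'I_n -> 'I_(N + N).+1}) : 'cV[R]_n :=
  invmx B *m \col_i ((f i)%:R - N%:R).
apply: (@sub_finite_set _ _ (range F)); last exact: finite_image.
move=> l [hl lM]; have lk k : `|l k 0| <= M + 1.
  have h : l k 0 ^+ 2 <= M.
    apply: le_trans lM; rewrite sqnormE (bigD1 k)//= lerDl.
    by apply: sumr_ge0 => i _; exact: sqr_ge0.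
  by rewrite ler_norml; apply/andP; split; nra.
have M0 : 0 <= M + 1 by have := sqnorm_ge0 l; lra.
have /choice[z hz] : forall i, exists m : int, (B *m l) i 0 = m%:~R.
  move=> i; have /intrP[m hm] := hl _ (lattice_row B i).
  by exists m; rewrite -hm /pairing -row_mul !mxE.
have zN i : (`|z i| <= N)%N.
  have zK : (`|z i|%N)%:R <= K.
    rewrite natr_absz intr_norm -hz mxE (le_trans (ler_norm_sum _ _ _))//.
    apply: (@le_trans _ _ ((M + 1) * \sum_k `|B i k|)).
      by rewrite mulr_sumr; apply: ler_sum => k _; rewrite normrM mulrC ler_wpM2r.
    rewrite ler_wpM2l// [leRHS](bigD1 i)//= lerDl.
    by apply: sumr_ge0 => j _; exact: sumr_ge0.
  have K0 : 0 <= K by exact: le_trans zK.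
  by have := le_lt_trans zK (archi_boundP K0); rewrite ltr_nat => /ltnW.
exists [ffun i => inord (absz (z i + N%:Z)%R)] => //.
rewrite /F; apply: (canLR (mulKmx uB)); apply/colP => i.
rewrite hz mxE ffunE inordK; last by have := zN i; lia.
rewrite natr_absz ger0_norm ?intrD ?addrK//; have := zN i; lia.
Qed.

End DualNorm.

Section Spectrum.
Context {R : realType} {n : nat} (B : 'M[R]_n) (alpha beta : R) (p : nat).
Hypothesis (hB : B \in unitmx).
Implicit Types (c : covector R n p.+1) (w : covfield R n p.+1) (l k : 'cV[R]_n).

(** Up to the factor 4 pi^2, the action of the operator on the Fourier
    coefficient at l. *)
Definition symbol l c : covector R n p.+1 := fun A =>
  alpha%:C * wedge l (Defs.contract (sharp l) c) A +
  beta%:C * Defs.contract (sharp l) (wedge l c) A.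

Lemma F_opE w : Omega B w -> F_op B alpha beta w = fun x A =>
  alpha%:C * ext_d (divergence w) x A + beta%:C * divergence (ext_d w) x A.
Proof.
by move=> hw; rewrite /F_op (codiffE hB hw) (codiffE hB (ext_d_Omega hw)).
Qed.

Lemma F_op_Omega w : Omega B w -> Omega B (F_op B alpha beta w).
Proof.
move=> hw; rewrite (F_opE hw).
exact: Omega_lin (ext_d_Omega (divergence_Omega hw))
  (Omega_scale _ (divergence_Omega (ext_d_Omega hw))).
Qed.

Lemma tau_sqr : - ((tau : R[i]) * tau) = (4 * pi ^+ 2)%:C.
Proof. by apply: eq_complexP; rewrite /tau /=; ring. Qed.

Lemma fcoef_F_op w l A : Omega B w -> dual_lattice B l ->
  fcoef B (F_op B alpha beta w) l A = (4 * pi ^+ 2)%:C * symbol l (fcoef B w l) A.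
Proof.
move=> hw hl; rewrite (F_opE hw).
have hd := ext_d_Omega (divergence_Omega hw).
have hd' := divergence_Omega (ext_d_Omega hw).
rewrite (fcoef_lin _ _ _ hd (Omega_scale _ hd')) (fcoef_scale _ _ _ hd').
rewrite (fcoef_ext_d hB (divergence_Omega hw) hl) (fcoef_divergence hB (ext_d_Omega hw) hl).
have -> : wedge l (fcoef B (divergence w) l) A =
    - tau * wedge l (Defs.contract (sharp l) (fcoef B w l)) A.
  rewrite /wedge mulr_sumr; apply: eq_bigr => i _.
  by rewrite (fcoef_divergence hB hw hl); ring.
have -> : Defs.contract (sharp l) (fcoef B (ext_d w) l) A =
    tau * Defs.contract (sharp l) (wedge l (fcoef B w l)) A.
  by rewrite /Defs.contract (fcoef_ext_d hB hw hl).
by rewrite -tau_sqr /symbol; ring.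
Qed.

(** By completeness of the characters, the equation F w = z w holds as soon as
    it holds for all Fourier coefficients. The eigenvalue problem thus splits
    into algebraic problems, one for each l. *)
Lemma Eig_fcoef z w : Eig B alpha beta p z w <->
  Omega B w /\ forall l, dual_lattice B l -> forall A,
    (4 * pi ^+ 2)%:C * symbol l (fcoef B w l) A = z * fcoef B w l A.
Proof.
split=> [[hw E]|[hw E]]; split=> //.
  by move=> l hl A; rewrite -(fcoef_F_op _ hw hl) E -(fcoef_scale _ _ _ hw).
apply: (fcoef_eq hB (F_op_Omega hw) (Omega_scale z hw)) => l hl A.
by rewrite (fcoef_F_op _ hw hl) E// (fcoef_scale _ _ _ hw).
Qed.

(** The eigenvalue of the operator on the covectors carried by the frame S at
    frequency l, for a basis adapted to l at j. *)
Definition frame_ev l (j : 'I_n) (S : @psubset n p.+1) : R :=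
  lambda (if j \in val S then alpha else beta) l.

Lemma symbol_frame l P j c S : adapted l P j -> alt_covector c ->
  (4 * pi ^+ 2)%:C * symbol l c (frame P S) = (frame_ev l j S)%:C * c (frame P S).
Proof.
move=> ad ac; rewrite /symbol (contract_wedge_frame ad)// /frame_ev lambdaE.
case: ifPn => jS.
  by rewrite (wedge_contract_frame_in ad)// !rmorphM mulr0 addr0; ring.
by rewrite (wedge_frame_out ad)// !rmorphM mulr0 add0r; ring.
Qed.

Lemma symbol_alt l c : alt_covector c -> alt_covector (symbol l c).
Proof.
move=> ac; apply: alt_lin; first exact/wedge_alt/contract_alt.
exact/alt_scale/contract_alt/wedge_alt.
Qed.

(** The symbol is diagonal in the coordinates given by the frames. *)
Lemma symbol_eigen z l P j c : adapted l P j -> alt_covector c ->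
  (forall A, (4 * pi ^+ 2)%:C * symbol l c A = z * c A) <->
  (forall S, (frame_ev l j S)%:C <> z -> c (frame P S) = 0).
Proof.
move=> ad ac; split=> [E S zS|h A].
  have /eqP := E (frame P S); rewrite (symbol_frame _ ad)// -subr_eq0 -mulrBl.
  by rewrite mulf_eq0 subr_eq0 => /orP[/eqP//|/eqP].
have [uP _ _] := ad.
have a1 := alt_scale (4 * pi ^+ 2)%:C (symbol_alt l ac).
have E : (fun A => (4 * pi ^+ 2)%:C * symbol l c A) = (fun A => z * c A).
  apply: (alt_frame_eq uP a1 (alt_scale z ac)) => S; rewrite (symbol_frame _ ad)//.
  by have [<-//|/eqP/h->] := eqVneq (frame_ev l j S)%:C z; rewrite !mulr0.
exact: (congr1 (fun g => g A) E).
Qed.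

End Spectrum.

(** * Multiplicities and eigenspaces *)

Section FormSpace.
Context {R : realType} {n : nat} (B : 'M[R]_n) (hB : B \in unitmx) (q : nat).
Implicit Types (v w : covfield R n q) (l k : 'cV[R]_n).

Lemma Omega0 : Omega B (0 : covfield R n q).
Proof. by split=> [x|A|//]; [exact: alt0|exact: smooth_cst]. Qed.

Lemma OmegaD v w : Omega B v -> Omega B w -> Omega B (v + w).
Proof.
move=> hv hw; have := Omega_lin 1 hv hw; congr Omega.
by apply/funext => x; apply/funext => A; rewrite mul1r.
Qed.

Lemma OmegaZ (a : R[i]) w : Omega B w -> Omega B (a *: w).
Proof. exact: Omega_scale. Qed.

Lemma Omega_sum (I : eqType) (r : seq I) (F : I -> covfield R n q) :
  (forall i, i \in r -> Omega B (F i)) -> Omega B (\sum_(i <- r) F i).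
Proof.
elim: r => [|i r IH] h; first by rewrite big_nil; exact: Omega0.
rewrite big_cons; apply: OmegaD; first exact: h (mem_head _ _).
by apply: IH => k kr; apply: h; rewrite inE kr orbT.
Qed.

Lemma fcoef0 l A : fcoef B (0 : covfield R n q) l A = 0.
Proof.
rewrite /fcoef (_ : (fun x => _) = fun=> 0) ?torus_integral_cst ?mulr0//.
by apply/funext => x; rewrite mul0r.
Qed.

Lemma fcoefD v w l A : Omega B v -> Omega B w ->
  fcoef B (v + w) l A = fcoef B v l A + fcoef B w l A.
Proof.
move=> hv hw; have := fcoef_lin 1 l A hv hw; rewrite mul1r => <-.
by congr torus_integral; apply/funext => x; rewrite mul1r.
Qed.

Lemma fcoefZ (a : R[i]) w l A : Omega B w -> fcoef B (a *: w) l A = a * fcoef B w l A.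
Proof. by move=> hw; rewrite -fcoef_scale. Qed.

Lemma fcoef_sum (I : eqType) (r : seq I) (F : I -> covfield R n q) l A :
  (forall i, i \in r -> Omega B (F i)) ->
  fcoef B (\sum_(i <- r) F i) l A = \sum_(i <- r) fcoef B (F i) l A.
Proof.
elim: r => [|i r IH] h; first by rewrite !big_nil fcoef0.
have hr j : j \in r -> Omega B (F j) by move=> jr; apply: h; rewrite inE jr orbT.
rewrite !big_cons fcoefD ?IH//; first exact: h (mem_head _ _).
exact: Omega_sum.
Qed.

End FormSpace.

Lemma has_dim_fintype (K : fieldType) (V : lmodType K) (E : set V) (I : finType)
    (b : I -> V) :
  set_bij setT E (fun c : {ffun I -> K} => \sum_i c i *: b i) -> has_dim E #|I|.
Proof.
move=> [fE iE sE]; exists (fun k => b (enum_val k)).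
have key (c : {ffun 'I_#|I| -> K}) : \sum_k c k *: b (enum_val k) =
    \sum_i [ffun i => c (enum_rank i)] i *: b i.
  rewrite [RHS](reindex (@enum_val I predT)) /=; last exact: onW_bij _ (enum_val_bij I).
  by apply: eq_bigr => k _; rewrite ffunE enum_valK.
split.
- by move=> c _; rewrite key; exact: fE.
- move=> c c' _ _; rewrite !key => /(iE _ _ (in_setT _) (in_setT _)) /ffunP h.
  by apply/ffunP => k; have := h (enum_val k); rewrite !ffunE enum_valK.
- move=> v /sE[c _ <-]; exists [ffun k => c (enum_val k)] => //; rewrite key.
  by apply: eq_bigr => i _; rewrite !ffunE enum_rankK.
Qed.

Lemma card_seq_set (T : choiceType) (s : seq T) : uniq s -> [set` s] #= `I_(size s).
Proof.
move=> us; have <- : [set` [fset x in s]%fset] = [set` s].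
  by rewrite predeqE => x; split; rewrite /= in_fset.
by apply/card_eq_fsetP; rewrite card_fseq undup_id.
Qed.

Section Main.
Context {R : realType} {n : nat} (B : 'M[R]_n) (alpha beta : R) (p : nat).
Hypothesis (hB : B \in unitmx) (ha : 0 < alpha) (hb : 0 < beta).
Context (P : 'cV[R]_n -> 'M[R]_n) (j : 'cV[R]_n -> 'I_n).
Hypothesis ad : forall l, adapted l (P l) (j l).
Implicit Types (w : covfield R n p.+1) (l k : 'cV[R]_n)
  (S : @psubset n p.+1).
Local Notation ev l S := (frame_ev alpha beta l (j l) S).
Local Notation fc w l S := (fcoef B w l (frame (P l) S)).
Local Notation vol := (`|\det B|%:C).

Lemma vol_neq0 : vol != 0 :> R[i].
Proof. by rewrite fmorph_eq0 gt_eqF// absdet_gt0. Qed.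

(** Eigenforms in coordinates: the pairs (l, S) with eigenvalue z are free,
    all others vanish. *)
Lemma Eig_frame z w : Eig B alpha beta p z w <->
  Omega B w /\ forall l, dual_lattice B l -> forall S, (ev l S)%:C <> z -> fc w l S = 0.
Proof.
split=> [/(Eig_fcoef _ _ hB)[hw E]|[hw E]].
  split=> // l hl; have := symbol_eigen alpha beta z (ad l) (fcoef_alt l hw).
  by move=> -[h _]; exact: h (E l hl).
apply/(Eig_fcoef _ _ hB); split=> // l hl.
have := symbol_eigen alpha beta z (ad l) (fcoef_alt l hw).
by move=> -[_ h]; exact: h (E l hl).
Qed.

Lemma form_eq (v w : covfield R n p.+1) : Omega B v -> Omega B w ->
  (forall l, dual_lattice B l -> forall S, fc v l S = fc w l S) -> v = w.
Proof.
move=> hv hw h; apply: (fcoef_eq hB hv hw) => l hl A; have [uP _ _] := ad l.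
have := alt_frame_eq uP (fcoef_alt l hv) (fcoef_alt l hw) (h l hl).
exact: (congr1 (fun g => g A)).
Qed.

Lemma ev_cases l S : ev l S = lambda alpha l \/ ev l S = lambda beta l.
Proof. by rewrite /frame_ev; case: ifP; [left|right]. Qed.

Lemma finite_level z :
  finite_set [set l | dual_lattice B l /\
    ((lambda alpha l)%:C = z \/ (lambda beta l)%:C = z)].
Proof.
pose M := complex.Re z; pose f g := (4 * pi ^+ 2 * g)^-1 * M.
apply: (sub_finite_set _ (finite_dual_ball (Num.max (f alpha) (f beta)) hB)).
have H g l : 0 < g -> (lambda g l)%:C = z -> sqnorm l = f g.
  move=> g0 /(congr1 (@complex.Re R)) /=; rewrite lambdaE -/M /f => <-.
  rewrite mulKf// !mulf_neq0 ?pnatr_eq0 ?expf_neq0 ?gt_eqF//; exact: pi_gt0.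
by move=> l [hl [/H h|/H h]]; split=> //; rewrite h// le_max lexx ?orbT.
Qed.

Section Dimension.
Context (z : R[i]) (s : seq 'cV[R]_n).
Hypothesis us : uniq s.
Hypothesis sE : forall l, l \in s <-> dual_lattice B l /\
    ((lambda alpha l)%:C = z \/ (lambda beta l)%:C = z).

Local Notation freq i := (nth (0 : 'cV[R]_n)%R s i).

Definition good_pair (x : 'I_(size s) * @psubset n p.+1) : bool :=
  (ev (freq x.1) x.2)%:C == z.

(** The frequency is given by its position in [s], to obtain a finite type of
    pairs. *)
Definition eig_index := {x | good_pair x}.

(** By orthogonality of characters and duality of minors and frames, the
    coordinates of these forms are Kronecker symbols, up to the volume. *)
Definition eig_basis (x : eig_index) : covfield R n p.+1 :=
  let l := freq (val x).1 in wave l (minor (P l) (val x).2).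

Let dual_nth (i : 'I_(size s)) : dual_lattice B (freq i).
Proof. by have /sE[] := mem_nth 0 (ltn_ord i). Qed.

Lemma eig_basis_Omega x : Omega B (eig_basis x).
Proof. exact: wave_Omega (dual_nth _) (minor_alt _ _). Qed.

Lemma eig_basis_fcoef x l S : dual_lattice B l ->
  fc (eig_basis x) l S = vol * ((freq (val x).1 == l) && ((val x).2 == S))%:R.
Proof.
move=> hl; rewrite /eig_basis (fcoef_wave hB _ _ (dual_nth _) hl).
case: eqVneq => [<-|_]; last by rewrite mulr0.
by rewrite minor_frame//; case: (ad (freq (val x).1)).
Qed.

Definition eig_comb (c : {ffun eig_index -> R[i]}) : covfield R n p.+1 :=
  \sum_x c x *: eig_basis x.

Lemma eig_comb_Omega c : Omega B (eig_comb c).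
Proof. by apply: Omega_sum => x _; apply: OmegaZ; exact: eig_basis_Omega. Qed.

Lemma eig_comb_fcoef c l S : dual_lattice B l ->
  fc (eig_comb c) l S =
  vol * \sum_x c x * ((freq (val x).1 == l) && ((val x).2 == S))%:R.
Proof.
move=> hl; rewrite fcoef_sum; last by move=> x _; apply: OmegaZ; exact: eig_basis_Omega.
rewrite mulr_sumr; apply: eq_bigr => x _.
by rewrite fcoefZ ?eig_basis_fcoef//; [rewrite mulrCA|exact: eig_basis_Omega].
Qed.

Lemma eig_comb_in c (x : eig_index) :
  fc (eig_comb c) (freq (val x).1) (val x).2 = vol * c x.
Proof.
rewrite eig_comb_fcoef//; congr (_ * _); rewrite (bigD1 x)//= !eqxx mulr1 big1 ?addr0//.
move=> y yx; case: andP => [[/eqP E1 /eqP E2]|_]; last by rewrite mulr0.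
case/eqP: yx; apply: val_inj; apply: injective_projections => //.
apply: val_inj; apply/eqP.
by rewrite -(nth_uniq 0 (ltn_ord _) (ltn_ord _) us); apply/eqP.
Qed.

Lemma eig_comb_out c l S : dual_lattice B l -> (ev l S)%:C <> z -> fc (eig_comb c) l S = 0.
Proof.
move=> hl ne; rewrite eig_comb_fcoef// big1 ?mulr0// => x _.
case: andP => [[/eqP E1 /eqP E2]|_]; last by rewrite mulr0.
by have /eqP := valP x; rewrite E1 E2.
Qed.

Lemma eig_pairP l S : dual_lattice B l -> (ev l S)%:C = z ->
  exists x : eig_index, freq (val x).1 = l /\ (val x).2 = S.
Proof.
move=> hl E; have ls : l \in s.
  by apply/sE; split=> //; have [<-|<-] := ev_cases l S; [left|right].
have il : (index l s < size s)%N by rewrite index_mem.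
have g : good_pair (Ordinal il, S) by rewrite /good_pair /= nth_index// E.
by exists (exist (fun x => good_pair x) _ g); rewrite /= nth_index.
Qed.

Lemma eig_basis_bij : set_bij setT (Eig B alpha beta p z) eig_comb.
Proof.
split.
- move=> c _; apply/Eig_frame; split; first exact: eig_comb_Omega.
  by move=> l hl S; exact: eig_comb_out.
- move=> c c' _ _ E; apply/ffunP => x.
  by apply: (mulfI vol_neq0); rewrite -!eig_comb_in E.
- move=> w /Eig_frame[hw hz].
  pose c := [ffun x : eig_index => vol^-1 * fc w (freq (val x).1) (val x).2].
  exists c => //; apply: form_eq => //; first exact: eig_comb_Omega.
  move=> l hl S; have [E|/eqP E] := eqVneq (ev l S)%:C z; last first.
    by rewrite hz// eig_comb_out.
  have [x [<- <-]] := eig_pairP hl E.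
  by rewrite eig_comb_in ffunE mulrA mulfV ?vol_neq0// mul1r.
Qed.

(** At each l, the subsets through j have eigenvalue lambda_alpha and the
    others lambda_beta. *)
Lemma card_eig_index : #|{: eig_index}| =
  ('C(n.-1, p) * size [seq l <- s | (lambda alpha l)%:C == z] +
   'C(n.-1, p.+1) * size [seq l <- s | (lambda beta l)%:C == z])%N.
Proof.
rewrite card_sig -sum1_card /= big_mkcond /=.
rewrite -(pair_bigA _ (fun i S => if good_pair (i, S) then 1%N else 0%N)) /=.
have H (i : 'I_(size s)) : (\sum_S (if good_pair (i, S) then 1 else 0) =
    'C(n.-1, p) * ((lambda alpha (freq i))%:C == z) +
    'C(n.-1, p.+1) * ((lambda beta (freq i))%:C == z))%N.
  rewrite (bigID (fun S : @psubset n p.+1 => j (freq i) \in val S)) /=.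
  congr (_ + _)%N.
    rewrite (eq_bigr (fun=> ((lambda alpha (freq i))%:C == z) : nat)).
      by rewrite sum_nat_const (card_psubset_in p (j (freq i))).
    by move=> S jS; rewrite /good_pair /frame_ev /= jS; case: eqP.
  rewrite (eq_bigr (fun=> ((lambda beta (freq i))%:C == z) : nat)).
    by rewrite sum_nat_const (card_psubset_out p.+1 (j (freq i))).
  by move=> S /negPf jS; rewrite /good_pair /frame_ev /= jS; case: eqP.
under eq_bigr do rewrite H.
rewrite big_split -!big_distrr /=.
have cnt (a : pred 'cV[R]_n) : (\sum_(i < size s) a (freq i) = size [seq l <- s | a l])%N.
  rewrite size_filter -sum1_count (big_nth 0) big_mkord [RHS]big_mkcond.
  by apply: eq_bigr => i _; case: (a _).
by rewrite (cnt (fun l => (lambda alpha l)%:C == z)) (cnt (fun l => (lambda beta l)%:C == z)).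
Qed.

End Dimension.

Lemma Spec_formula (z : R[i]) : exists a b : nat,
     [/\ [set l | dual_lattice B l /\ (lambda alpha l)%:C = z] #= `I_a,
         [set l | dual_lattice B l /\ (lambda beta l)%:C = z] #= `I_b &
         Spec B alpha beta p z ('C(n.-1, p) * a + 'C(n.-1, p.+1) * b)%N].
Proof.
have /finite_seqP[s0 Es0] := finite_level z.
pose s := undup s0; have us : uniq s by exact: undup_uniq.
have sE l : l \in s <-> dual_lattice B l /\
    ((lambda alpha l)%:C = z \/ (lambda beta l)%:C = z).
  by rewrite mem_undup; have /(congr1 (fun X => X l)) /= := Es0 => ->.
exists (size [seq l <- s | (lambda alpha l)%:C == z]),
       (size [seq l <- s | (lambda beta l)%:C == z]); split.
- rewrite (_ : [set l | _] = [set` [seq l <- s | (lambda alpha l)%:C == z]]).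
    by apply: card_seq_set; exact: filter_uniq.
  apply/seteqP; split=> l /=; rewrite mem_filter.
    by move=> [hl E]; rewrite E eqxx; apply/sE; split=> //; left.
  by move=> /andP[/eqP E /sE[hl _]].
- rewrite (_ : [set l | _] = [set` [seq l <- s | (lambda beta l)%:C == z]]).
    by apply: card_seq_set; exact: filter_uniq.
  apply/seteqP; split=> l /=; rewrite mem_filter.
    by move=> [hl E]; rewrite E eqxx; apply/sE; split=> //; right.
  by move=> /andP[/eqP E /sE[hl _]].
- rewrite /Spec -card_eig_index.
  exact: has_dim_fintype (eig_basis_bij us sE).
Qed.

Definition freq_of (i : 'cV[R]_n + 'cV[R]_n) : 'cV[R]_n :=
  match i with inl l => l | inr l => l end.

(** The frames on which the covectors of a summand may be nonzero. For l = 0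
    the space V_l vanishes and W_l contains all parallel forms, whatever j is.
    *)
Definition supp (i : 'cV[R]_n + 'cV[R]_n) S : bool :=
  match i with
  | inl l => (l != 0) && (j l \in val S)
  | inr l => ~~ ((l != 0) && (j l \in val S))
  end.

(** Each pair (l, S) lies in the support of exactly one summand, which is the
    reason why the sum is direct. *)
Definition slot l S : 'cV[R]_n + 'cV[R]_n := if supp (inl l) S then inl l else inr l.

Lemma freq_slot l S : freq_of (slot l S) = l.
Proof. by rewrite /slot; case: ifP. Qed.

Lemma supp_slot l S : supp (slot l S) S.
Proof. by rewrite /slot; case: ifPn. Qed.

Lemma slotP i S : supp i S -> slot (freq_of i) S = i.
Proof. by case: i => l /=; rewrite /slot /=; [move=> ->|move=> /negPf ->]. Qed.

(** For nonzero l, the spaces V_l and W_l are the waves at l whose covectors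
    are carried by the frames through j, respectively by the others. *)
Lemma VW_spaceP i w : VW_space p i w <-> exists c : covector R n p.+1,
  [/\ alt_covector c, w = wave (freq_of i) c &
      forall S, ~~ supp i S -> c (frame (P (freq_of i)) S) = 0].
Proof.
case: i => l /=; have [uP _ _] := ad l.
  split.
    move=> [eta [c ac ->] <-]; exists (wedge l c); split=> //; first exact: wedge_alt.
    move=> S; rewrite negb_and negbK => /orP[/eqP l0|]; last exact: (wedge_frame_out (ad l)).
    by apply: big1 => i _; rewrite l0 /pairing mulmx0 mxE mulr0 mul0r.
  move=> [c [ac -> hc]]; have [l0|/eqP l0] := eqVneq l 0.
    have c0 : c = fun=> 0.
      by apply: (alt_frame_eq uP ac (@alt0 R n _)) => S; rewrite hc// l0 eqxx.
    exists (fun=> fun=> 0); first by exists (fun=> 0) => //; exact: alt0.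
    apply/funext => x; apply/funext => A; rewrite /wave c0 mulr0.
    rewrite -[RHS](mulr0 (chi l x)); congr (_ * _); apply: big1 => i _; exact: mulr0.
  pose eta : covector R n p := fun A => (sqnorm l)^-1%:C * Defs.contract (sharp l) c A.
  exists (fun=> eta).
    by exists eta => //; apply: alt_scale; exact: contract_alt.
  rewrite [in RHS](frame_wedge (ad l) l0 ac)// => S jS.
  by apply: hc; rewrite negb_and jS orbT.
split.
  move=> [_ [[c ac ->] hc] <-]; exists c; split=> // S; rewrite negbK => /andP[/eqP l0 jS].
  exact: (contract_eq0_frame (ad l) l0 ac (hc 0)).
move=> [c [ac -> hc]]; exists (fun=> c) => //; split=> [|_]; first by exists c.
have [l0|l0] := eqVneq l 0; last first.
  by apply: (frame_contract_eq0 (ad l) ac) => S jS; apply: hc; rewrite negbK l0.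
by apply/funext => A; rewrite l0 /sharp trmx0 contract0//; case: ac.
Qed.

Section DirectSum.
Context (z r s : R).
Hypothesis rE : forall l, dual_norm l = r <-> lambda alpha l = z.
Hypothesis sE : forall l, dual_norm l = s <-> lambda beta l = z.
Local Notation D := (VW_index B r s).
Local Notation total u := (\sum_(i \in D) u i : covfield R n p.+1).
Implicit Types u : 'cV[R]_n + 'cV[R]_n -> covfield R n p.+1.

Lemma finite_VW_index : finite_set D.
Proof.
have fin := finite_level z%:C.
apply: (@sub_finite_set _ _ (inl @` [set l | dual_lattice B l /\
    ((lambda alpha l)%:C = z%:C \/ (lambda beta l)%:C = z%:C)] `|`
  inr @` [set l | dual_lattice B l /\
    ((lambda alpha l)%:C = z%:C \/ (lambda beta l)%:C = z%:C)])); last first.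
  by rewrite finite_setU; split; exact: finite_image.
move=> [l|l] [hl].
  by move=> /rE h; left; exists l => //; split=> //; left; rewrite h.
by move=> /sE h; right; exists l => //; split=> //; right; rewrite h.
Qed.

Lemma VW_index_dual i : D i -> dual_lattice B (freq_of i).
Proof. by case: i => l []. Qed.

Lemma VW_index_slot l S : dual_lattice B l -> D (slot l S) <-> ev l S = z.
Proof.
move=> hl; rewrite /slot /frame_ev /supp.
have [l0|l0] := eqVneq l 0.
  have lam0 g : lambda g l = 0 by rewrite lambdaE l0 sqnorm0 mulr0.
  rewrite lam0 /=; split=> [[_ /sE <-]|z0]; first by rewrite lam0.
  by split=> //; apply/sE; rewrite lam0.
rewrite /=; case: ifPn => jS /=; split.
- by move=> [_ /rE].
- by move=> E; split=> //; apply/rE.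
- by move=> [_ /sE].
- by move=> E; split=> //; apply/sE.
Qed.

Section Total.
Context u (hu : ext_dsum D (VW_space p) u).

Lemma summand_Omega i : Omega B (u i).
Proof.
have [uD uND _] := hu; have [Di|nDi] := pselect (D i); last by rewrite uND//; exact: Omega0.
have [c [ac -> _]] := (proj1 (VW_spaceP _ _)) (uD i Di).
exact: wave_Omega (VW_index_dual Di) ac.
Qed.

Lemma summand_fcoef i l S : dual_lattice B l -> i != slot l S -> fc (u i) l S = 0.
Proof.
move=> hl ne; have [uD uND _] := hu.
have [Di|nDi] := pselect (D i); last by rewrite uND// fcoef0.
have [c [ac -> hc]] := (proj1 (VW_spaceP _ _)) (uD i Di).
rewrite (fcoef_wave hB _ _ (VW_index_dual Di) hl); case: eqVneq => // E.
by rewrite -E hc ?mulr0//; apply: contra ne => /slotP; rewrite E => ->.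
Qed.

Lemma total_seq : exists2 t : seq ('cV[R]_n + 'cV[R]_n), uniq t &
  (forall i, i \in t <-> D i) /\ total u = \sum_(i <- t) u i.
Proof.
have /finite_seqP[t0 Et0] := finite_VW_index.
exists (undup t0); first exact: undup_uniq.
have E : D = [set` undup t0].
  by rewrite Et0 predeqE => i /=; rewrite mem_undup.
split; last by rewrite (fsbig_seq _ _ (undup_uniq t0)) E.
by move=> i; rewrite E.
Qed.

Lemma total_Omega : Omega B (total u).
Proof.
by have [t _ [_ ->]] := total_seq; apply: Omega_sum => i _; exact: summand_Omega.
Qed.

(** No summand other than [slot l S] has a nonzero coordinate at (l, S). *)
Lemma total_fcoef l S : dual_lattice B l -> fc (total u) l S = fc (u (slot l S)) l S.
Proof.
move=> hl; have [t ut [tE ->]] := total_seq.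
rewrite fcoef_sum; last by move=> i _; exact: summand_Omega.
have [ts|ts] := boolP (slot l S \in t).
  rewrite (bigD1_seq _ ts ut) /= big1_seq ?addr0// => i /andP[ne _].
  exact: summand_fcoef.
have [_ uND _] := hu; rewrite uND ?fcoef0; last by move=> /tE; apply/negP.
rewrite big1_seq// => i /andP[_ it]; apply: summand_fcoef => //.
by apply: contraNneq ts => <-.
Qed.

End Total.

(** By [total_fcoef] the coordinates of the summands can be read off from
    those of the sum, which gives injectivity; conversely, an eigenform is the
    sum of the waves obtained by distributing its coordinates over the slots.
    *)
Lemma eig_direct_sum : is_direct_sum (Eig B alpha beta p z%:C) D (VW_space p).
Proof.
split.
- move=> u hu; apply/Eig_frame; split; first exact: total_Omega.
  move=> l hl S ne; rewrite total_fcoef//.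
  have [_ uND _] := hu; rewrite uND ?fcoef0// => /(VW_index_slot _ hl) E.
  by apply: ne; rewrite E.
- move=> u u' /set_mem hu /set_mem hu' E; apply/funext => i.
  have [uD uND _] := hu; have [uD' uND' _] := hu'.
  have [Di|nDi] := pselect (D i); last by rewrite uND// uND'.
  have hi := VW_index_dual Di.
  have [c [ac uE hc]] := (proj1 (VW_spaceP _ _)) (uD i Di).
  have [c' [ac' uE' hc']] := (proj1 (VW_spaceP _ _)) (uD' i Di).
  rewrite uE uE'; congr wave; have [uP _ _] := ad (freq_of i).
  apply: (alt_frame_eq uP ac ac') => S.
  have [iS|iS] := boolP (supp i S); last by rewrite hc// hc'.
  have := total_fcoef hu S hi; rewrite E total_fcoef// slotP// uE uE'.
  by rewrite !(fcoef_wave hB _ _ hi hi) eqxx => /(mulfI vol_neq0).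
- move=> w /Eig_frame[hw hz].
  pose c i : covector R n p.+1 := fun A => \sum_S (if supp i S then
    vol^-1 * fc w (freq_of i) S else 0) * minor (P (freq_of i)) S A.
  have ac i : alt_covector (c i) by apply: alt_sum => S; apply: alt_scale; exact: minor_alt.
  have cS i S : c i (frame (P (freq_of i)) S) =
      if supp i S then vol^-1 * fc w (freq_of i) S else 0.
    have [uP _ _] := ad (freq_of i).
    rewrite /c (bigD1 S)//= minor_frame// eqxx mulr1 big1 ?addr0// => T TS.
    by rewrite minor_frame// (negPf TS) mulr0.
  pose u i : covfield R n p.+1 := if pselect (D i) then wave (freq_of i) (c i) else 0.
  have uD i : D i -> u i = wave (freq_of i) (c i) by rewrite /u; case: pselect.
  have hu : ext_dsum D (VW_space p) u.
    split=> [i Di|i nDi|].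
    + apply/VW_spaceP; exists (c i); split=> //; first exact: uD.
      by move=> S /negPf nS; rewrite cS nS.
    + by rewrite /u; case: pselect.
    + apply: sub_finite_set finite_VW_index => i /=.
      by rewrite /u; case: pselect.
  exists u => //; apply: form_eq => //; first exact: total_Omega.
  move=> l hl S; rewrite total_fcoef//.
  have [Ds|nDs] := pselect (D (slot l S)).
    rewrite uD// (fcoef_wave hB _ _ (VW_index_dual Ds) hl) freq_slot eqxx.
    rewrite -{2}(freq_slot l S) cS supp_slot freq_slot mulrA mulfV ?mul1r//.
    exact: vol_neq0.
  have [_ uND _] := hu; rewrite uND// fcoef0 hz// => E.
  by apply: nDs; apply/(VW_index_slot _ hl); exact: (congr1 (@complex.Re R) E).
Qed.

End DirectSum.

End Main.

Theorem theorem3p7 (R : realType) (n : nat) (B : 'M[R]_n) (alpha beta : R) (p : nat)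
    (hn : (1 <= n)%N) (hB : B \in unitmx) (halpha : 0 < alpha) (hbeta : 0 < beta)
    (hp : (p.+1 <= n)%N) :
  (forall z : R[i], exists a b : nat,
     [/\ [set l | dual_lattice B l /\ (lambda alpha l)%:C = z] #= `I_a,
         [set l | dual_lattice B l /\ (lambda beta l)%:C = z] #= `I_b &
         Spec B alpha beta p z ('C(n.-1, p) * a + 'C(n.-1, p.+1) * b)%N]) /\
  (forall k : 'cV[R]_n, dual_lattice B k ->
     is_direct_sum (Eig B alpha beta p (lambda alpha k)%:C)
       (VW_index B (dual_norm k) (Num.sqrt (alpha / beta) * dual_norm k))
       (VW_space p)
     /\
     is_direct_sum (Eig B alpha beta p (lambda beta k)%:C)
       (VW_index B (Num.sqrt (beta / alpha) * dual_norm k) (dual_norm k))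
       (VW_space p)).
Proof.
have /choice[Pj hPj] : forall l : 'cV[R]_n, exists Pj : 'M[R]_n * 'I_n, adapted l Pj.1 Pj.2.
  by move=> l; have [P [j h]] := exists_adapted l hn; exists (P, j).
have ad l : adapted l ((fun l => (Pj l).1) l) ((fun l => (Pj l).2) l) by exact: hPj.
have norm_eq (g : R) (l k : 'cV[R]_n) : 0 < g -> dual_norm l = dual_norm k <-> lambda g l = lambda g k.
  move=> g0; rewrite (lambda_eq l k g0 g0) divff ?gt_eqF// sqrtr1 mul1r.
  by split.
split=> [z|k hk]; first exact: (Spec_formula p hB halpha hbeta ad).
split; apply: (eig_direct_sum p hB halpha hbeta ad) => l.
- exact: norm_eq.
- by rewrite (lambda_eq l k hbeta halpha).
- by rewrite (lambda_eq l k halpha hbeta).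
- exact: norm_eq.
Qed.
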